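(* Let $k\ge 2$ be a fixed integer. All asymptotic notation refers to $n\to\infty$, and $o(1)$ denotes a quantity tending to $0$. (1) For $0\le p\le \frac12$ the probability of satisfiability is asymptotically non-increasing as a function of $p$: for any $0\le p\le q\le \frac12$ and any sequence $m=m(n)$ of positive integers, $$\Pr\big(\Phi_m(n,k,p)\text{ is satisfiable}\big)\ \ge\ \Pr\big(\Phi_m(n,k,q)\text{ is satisfiable}\big)-o(1).$$ (2) For any $0\le p\le\frac12$, the median satisfiability threshold $\alpha_k(p,n)$ satisfies $$\alpha_k(n)-o(1)\ \le\ \alpha_k(p,n)\ \le\ \frac{1+o(1)}{-\log_2(1-2^{-k})},$$ where $\alpha_k(n)=\alpha_k(\tfrac12,n)$.
   Context: Polarized random $k$-SAT. For $0\le p\le 1$, $\Phi_m=\Phi_m(n,k,p)$ is the random formula $C_1\wedge\dots\wedge C_m$ on Boolean variables $x_1,\dots,x_n$, where the clauses $C_i$ are independent and each is generated as follows: choose a $k$-tuple $K_i=(v_1,\dots,v_k)$ of distinct indices from $\{1,\dots,n\}$ uniformly at random (i.e. drawn without replacement); independently choose $B_i\in\{-1,1\}$ with $\Pr(B_i=1)=\Pr(B_i=-1)=\frac12$, and independent $P_{i1},\dots,P_{ik}\in\{-1,1\}$ with $\Pr(P_{ij}=1)=p$, $\Pr(P_{ij}=-1)=1-p$; set the literal $z_j=x_{v_j}$ if $B_iP_{ij}=1$ and $z_j=\neg x_{v_j}$ otherwise; and let $C_i=z_1\vee\dots\vee z_k$. The case $p=\frac12$ is classical random $k$-SAT. The median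 satisfiability threshold is $\alpha_k(p,n):=\min\{m/n:\Pr(\Phi_m(n,k,p)\text{ is satisfiable})\le\frac12\}$, and $\alpha_k(n):=\alpha_k(\frac12,n)$. *)

(* Defs.v *)
(* MathComp and MathComp-Analysis; reals are an arbitrary R : realType. *)
From mathcomp Require Import all_boot all_order all_algebra.
From mathcomp Require Import all_classical all_reals all_analysis.

Set Implicit Arguments.
Unset Strict Implicit.
Unset Printing Implicit Defensive.

Import Order.TTheory GRing.Theory Num.Theory.

Local Open Scope ring_scope.

(* The literal (v, true) is x_v and (v, false) is its negation. *)
Definition literal (n : nat) : Type := ('I_n * bool)%type.

Definition clause (k n : nat) : Type := {ffun 'I_k -> literal n}.

Definition formula (m k n : nat) : Type := {ffun 'I_m -> clause k n}.

Definition lit_true (n : nat) (s : {ffun 'I_n -> bool}) (z : literal n) : bool :=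
  s z.1 == z.2.

Definition satisfiable (m k n : nat) (F : formula m k n) : bool :=
  [exists s : {ffun 'I_n -> bool},
    [forall i : 'I_m, [exists j : 'I_k, lit_true s (F i j)]]].

Definition index_tuple (k n : nat) : finType :=
  {K : {ffun 'I_k -> 'I_n} | injectiveb K}.

(* The random choices (K, B, P) behind one clause; the signs B and P_j in
   {-1, 1} are encoded as booleans, with 1 as true and -1 as false. *)
Definition clause_draw (k n : nat) : finType :=
  (index_tuple k n * bool * {ffun 'I_k -> bool})%type.

(* The equality of booleans encodes B * P_j = 1. *)
Definition clause_of (k n : nat) (w : clause_draw k n) : clause k n :=
  let: (K, B, P) := w in [ffun j => (val K j, B == P j)].

Definition formula_of (m k n : nat) (w : {ffun 'I_m -> clause_draw k n}) :
  formula m k n := [ffun i => clause_of (w i)].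

(* This is a probability mass function only for k <= n, since otherwise
   there are no k-tuples of distinct indices to draw from. *)
Definition clause_mass (R : realType) (k n : nat) (p : R) (w : clause_draw k n) : R :=
  let: (_, _, P) := w in
  #|index_tuple k n|%:R^-1 * 2^-1 * \prod_(j < k) (if P j then p else 1 - p).

Definition draws_mass (R : realType) (m k n : nat) (p : R)
    (w : {ffun 'I_m -> clause_draw k n}) : R :=
  \prod_(i < m) clause_mass p (w i).

Definition prob_sat (R : realType) (m n k : nat) (p : R) : R :=
  \sum_(w : {ffun 'I_m -> clause_draw k n} | satisfiable (formula_of w))
    draws_mass p w.

Lemma sum_clause_mass (R : realType) (k n : nat) (p : R) :
  (k <= n)%N -> \sum_(w : clause_draw k n) clause_mass p w = 1.
Proof.
move=> le_kn.
have card_gt0 : (0 < #|index_tuple k n|)%N.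
  apply/card_gt0P; have inj : injectiveb [ffun j : 'I_k => widen_ord le_kn j].
    by apply/injectiveP => i j; rewrite !ffunE => /(congr1 val) /= /val_inj.
  by exists (exist (fun K : {ffun _ -> _} => injectiveb K) _ inj).
have P1 : \sum_(P : {ffun 'I_k -> bool}) \prod_(j < k) (if P j then p else 1 - p) = 1.
  rewrite -(bigA_distr_bigA (fun (_ : 'I_k) b => if b then p else 1 - p)) big1 // => i _.
  by rewrite big_bool /= addrC subrK.
transitivity (\sum_(KB : index_tuple k n * bool) \sum_(P : {ffun 'I_k -> bool})
    clause_mass p (KB, P)); first by rewrite pair_bigA; apply: eq_bigr => -[].
rewrite (eq_bigr (fun=> #|index_tuple k n|%:R^-1 * 2^-1)); last first.
  by move=> [K B] _; rewrite -mulr_sumr P1 mulr1.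
rewrite sumr_const card_prod card_bool -[LHS]mulr_natr natrM mulrACA mulVf ?mul1r ?mulVf //.
by rewrite pnatr_eq0 -lt0n.
Qed.

Lemma sum_draws_mass (R : realType) (m k n : nat) (p : R) :
  (k <= n)%N ->
  \sum_(w : {ffun 'I_m -> clause_draw k n}) draws_mass p w = 1.
Proof.
move=> le_kn.
rewrite -(bigA_distr_bigA (fun (_ : 'I_m) w => clause_mass p w)) big1 // => i _.
exact: sum_clause_mass.
Qed.

(* For fixed n > 0, the least m / n is attained at the least m.  The minimum
   over the empty set is +oo; this happens e.g. for p = 0 and k <= n < 2k - 1,
   where every formula is satisfiable. *)
Definition median_threshold (R : realType) (k : nat) (p : R) (n : nat) : \bar R :=
  match pselect (exists m : nat, prob_sat m n k p <= 2^-1) with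
  | left ex_m => ((ex_minn ex_m)%:R / n%:R)%:E
  | right _ => +oo%E
  end.

Definition log2 (R : realType) (x : R) : R := ln x / ln 2.

(* Main.v *)
(* Random formulas with fixed signs p and with p = 1/2 have asymptotically the
   same probability of satisfiability when m = O(n); for larger m the first
   moment bound makes both negligible.

   (a) P_p <= P_(1/2) + o(1). Replace the clauses one by one. A clause kills a
   solution set S exactly when it contradicts values frozen in S; by convexity of
   x |-> x^k, signs of law p are at least as likely to do so as fair signs, up to
   an error of order |frozen S| / n^2 due to drawing without replacement. If S has
   many frozen variables then a random clause is decisive with probability bounded
   below; but decisive clauses are rare, since the number of clauses with a private
   variable, which are never decisive, fluctuates by O(sqrt n) only.

   (b) P_(1/2) <= P_p + o(1). Replace the variables one by one. Split a variable v
   into two copies, each slot choosing its copy by a fair coin. Identifying the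
   copies with equal signs gives back signs of law p, with opposite signs it gives
   fair signs. The difference of the two probabilities is the expectation of
   sigma(u, u') = [some solution has s u = s u'] - [some solution has s u <> s u'],
   a positive semidefinite kernel. Averaging over the exchangeable p-variables,
   it is at least -beta / r up to constants when r variables have law p, where
   beta bounds the probability that ignoring one variable destroys satisfiability;
   beta is estimated as in (a), and summing over r costs a logarithm.

   (c) For the thresholds, Efron's inequality P(1 - P) <= m (P_(m-1) - P_m) rules
   out a plateau of m |-> P_m at height 1/2. *)
Require Import Defs.
(* [all_boot] comes last so that [set0], [subsetP], etc. refer to finite sets. *)
From mathcomp Require Import all_classical all_reals all_analysis.
From mathcomp Require Import all_boot all_order all_fingroup all_algebra.
From mathcomp Require Import ring lra zify.
Set Implicit Arguments.
Unset Strict Implicit.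
Unset Printing Implicit Defensive.
Import Order.TTheory GRing.Theory Num.Theory numFieldNormedType.Exports.
Local Open Scope ring_scope.

(** The loss of order |frozen S| / n^2 per clause adds up, over m = O(n) clauses, to a constant when
    a positive fraction of the variables is frozen; this is why decisive clauses have to be rare at
    every single step. Their rarity is known only in total: the probabilities that clause i is
    decisive sum to O(sqrt n). At step l the m - l clauses not yet replaced are exchangeable, so
    each is decisive with probability O(sqrt n / (m - l)), and the steps add up to sqrt n times a
    harmonic sum. A parameter s settles what many frozen variables means: a frozen fraction below
    about 2 / s costs O(1 / s), while above it a random clause is decisive with probability at least
    of order s^-k, which leaves an error s^k log n / sqrt n. In (a) s is a large constant. In (b)
    the bound is multiplied by another harmonic sum, so s has to grow like log n. The sign law
    depends on the variable because the hybrids of (b) mix p and 1/2; clauses carry a set of ignored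
    variables so that one replacement argument serves both (a) and the estimate of beta. *)

Section ProductExpectation.
Variables (R : realFieldType) (I T : finType).
Implicit Types (w : I -> T -> R) (Phi : {ffun I -> T} -> R) (F : {ffun I -> T}).

Definition pexp w Phi : R := \sum_(F : {ffun I -> T}) (\prod_i w i (F i)) * Phi F.

Definition upd F i c : {ffun I -> T} := [ffun l => if l == i then c else F l].

Lemma eq_pexp w w' Phi Phi' :
  (forall i c, w i c = w' i c) -> (forall F, Phi F = Phi' F) ->
  pexp w Phi = pexp w' Phi'.
Proof.
by move=> eqw eqP; apply: eq_bigr => F _; rewrite eqP; congr (_ * _); apply: eq_bigr.
Qed.

Lemma pexp_prod w (g : I -> T -> R) :
  pexp w (fun F => \prod_i g i (F i)) = \prod_i \sum_c w i c * g i c.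
Proof.
by rewrite bigA_distr_bigA; apply: eq_bigr => F _; rewrite -big_split.
Qed.

Lemma pexp_sum w (J : finType) (P : pred J) (Phi : J -> {ffun I -> T} -> R) :
  pexp w (fun F => \sum_(j | P j) Phi j F) = \sum_(j | P j) pexp w (Phi j).
Proof.
rewrite exchange_big /=; apply: eq_bigr => F _; exact: mulr_sumr.
Qed.

Lemma pexpZ w a Phi : pexp w (fun F => a * Phi F) = a * pexp w Phi.
Proof. by rewrite [RHS]mulr_sumr; apply: eq_bigr => F _; rewrite mulrCA. Qed.

Lemma pexpD w Phi Phi' : pexp w (fun F => Phi F + Phi' F) = pexp w Phi + pexp w Phi'.
Proof. by rewrite -big_split; apply: eq_bigr => F _; rewrite mulrDr. Qed.

Lemma pexpB w Phi Phi' : pexp w (fun F => Phi F - Phi' F) = pexp w Phi - pexp w Phi'.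
Proof. by rewrite -sumrB; apply: eq_bigr => F _; rewrite mulrBr. Qed.

Lemma pexp_cst w a : (forall i, \sum_c w i c = 1) -> pexp w (fun=> a) = a.
Proof.
by move=> w1; rewrite /pexp -mulr_suml -bigA_distr_bigA big1 ?mul1r.
Qed.

Lemma ler_pexp w Phi Phi' : (forall i c, 0 <= w i c) ->
  (forall F, (forall i, w i (F i) != 0) -> Phi F <= Phi' F) -> pexp w Phi <= pexp w Phi'.
Proof.
move=> w0 le; apply: ler_sum => F _.
case: (boolP [forall i, w i (F i) != 0]) => [/forallP nz|/forallPn [i]].
  by rewrite ler_wpM2l ?le// prodr_ge0.
by rewrite negbK => /eqP z; rewrite (bigD1 i)//= z !mul0r.
Qed.

Lemma pexp_ge0 w Phi : (forall i c, 0 <= w i c) -> (forall F, 0 <= Phi F) ->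
  0 <= pexp w Phi.
Proof. by move=> w0 P0; apply: sumr_ge0 => F _; rewrite mulr_ge0 ?prodr_ge0. Qed.

(** Swapping [F i] with a spare value of law [w i] is an involution on pairs ([F], spare value).
    Hence [w] and [w'] need only agree off [i]. *)
Lemma pexp_resample w w' i Phi :
  (forall l c, l != i -> w' l c = w l c) -> \sum_c w i c = 1 ->
  pexp w' Phi = pexp w (fun F => \sum_c w' i c * Phi (upd F i c)).
Proof.
move=> eqw w1; rewrite /pexp.
transitivity (\sum_(x : {ffun I -> T} * T)
    (\prod_l w' l (x.1 l)) * Phi x.1 * w i x.2).
  rewrite -(pair_bigA _ (fun F c => (\prod_l w' l (F l)) * Phi F * w i c)) /=.
  by apply: eq_bigr => F _; rewrite -mulr_sumr w1 mulr1.
under [RHS]eq_bigr do rewrite mulr_sumr.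
rewrite (pair_bigA _ (fun F c => (\prod_l w l (F l)) * (w' i c * Phi (upd F i c)))) /=.
pose h (x : {ffun I -> T} * T) := (upd x.1 i x.2, x.1 i).
have hK : involutive h.
  move=> [F c]; congr pair; last by rewrite /= ffunE eqxx.
  by apply/ffunP => l; rewrite !ffunE; case: eqP => // ->.
rewrite (reindex_inj (inv_inj hK)) /=; apply: eq_bigr => -[F c] _ /=.
rewrite (bigD1 i) //= [in RHS](bigD1 i) //= ffunE eqxx.
under eq_bigr => l li do rewrite ffunE (negbTE li) eqw //.
by ring.
Qed.

Definition mix (P : pred I) F G : {ffun I -> T} := [ffun i => if P i then G i else F i].

(** The coordinates in [P] are exchanged between two independent copies, which preserves their joint
    law. *)
Lemma pexp_mix w (P : pred I) Phi : (forall i, \sum_c w i c = 1) ->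
  pexp w (fun G => pexp w (fun F => Phi (mix P F G))) = pexp w Phi.
Proof.
move=> w1; rewrite -[in RHS](pexp_cst (pexp w Phi) w1) /pexp.
under eq_bigr do rewrite mulr_sumr; under [RHS]eq_bigr do rewrite mulr_sumr.
rewrite (pair_bigA _ (fun G F : {ffun I -> T} =>
  (\prod_i w i (G i)) * ((\prod_i w i (F i)) * Phi (mix P F G)))).
rewrite [RHS](pair_bigA _ (fun G F : {ffun I -> T} =>
  (\prod_i w i (G i)) * ((\prod_i w i (F i)) * Phi F))) /=.
pose h (x : {ffun I -> T} * {ffun I -> T}) := (mix P x.1 x.2, mix P x.2 x.1).
have hK : involutive h.
  by move=> [G F]; congr pair; apply/ffunP => i; rewrite !ffunE /=; case: (P i).
rewrite [RHS](reindex_inj (inv_inj hK)) /=; apply: eq_bigr => -[G F] _ /=.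
rewrite !mulrA -!big_split /=; congr (_ * _); apply: eq_bigr => i _.
by rewrite !ffunE; case: (P i) => //; rewrite mulrC.
Qed.

Lemma pexp_perm (s : {perm I}) w Phi :
  pexp (fun i => w (s i)) Phi = pexp w (fun F => Phi [ffun i => F (s i)]).
Proof.
pose h F : {ffun I -> T} := [ffun i => F (s i)].
have hb : bijective h.
  exists (fun F => [ffun i => F ((s^-1)%g i)]) => F; apply/ffunP => i;
  by rewrite !ffunE ?permK ?permKV.
rewrite /pexp (reindex h) /=; last exact: onW_bij.
apply: eq_bigr => F _; congr (_ * _).
rewrite [RHS](reindex_perm s) /=.
by apply: eq_bigr => i _; rewrite ffunE.
Qed.

(* Cauchy-Schwarz against the constant 1, through |x| <= t / 2 + x^2 / (2 t). *)
Lemma pexp_norm_le w Phi (t : R) : (forall i c, 0 <= w i c) -> (forall i, \sum_c w i c = 1) ->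
  0 < t -> pexp w (fun F => Phi F ^+ 2) <= t ^+ 2 -> pexp w (fun F => `|Phi F|) <= t.
Proof.
move=> w0 w1 t0 le.
have : pexp w (fun F => `|Phi F|) <= pexp w (fun F => t / 2 + (2 * t)^-1 * Phi F ^+ 2).
  apply: ler_pexp => // F _; rewrite -real_normK ?num_real//.
  set y := `|_|; have : 0 <= (t - y) ^+ 2 by exact: sqr_ge0.
  rewrite -(pmulr_rge0 _ (_ : 0 < (2 * t)^-1)); last by rewrite invr_gt0; lra.
  move=> h; rewrite -subr_ge0.
  suff -> : t / 2 + (2 * t)^-1 * y ^+ 2 - y = (2 * t)^-1 * (t - y) ^+ 2 by [].
  by field; lra.
move/le_trans; apply; rewrite pexpD pexp_cst // pexpZ.
have : (2 * t)^-1 * pexp w (fun F => Phi F ^+ 2) <= (2 * t)^-1 * t ^+ 2.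
  by rewrite ler_wpM2l // invr_ge0; lra.
have -> : (2 * t)^-1 * t ^+ 2 = t / 2 by field; lra.
by move=> h; apply: le_trans (lerD (lexx _) h) _; rewrite -splitr.
Qed.

End ProductExpectation.

Lemma pexp_push (R : realFieldType) (I T T' : finType) (f : T' -> T)
    (w : I -> T -> R) (w' : I -> T' -> R) Phi :
  (forall i c, w i c = \sum_(c' | f c' == c) w' i c') ->
  pexp w Phi = pexp w' (fun F => Phi [ffun i => f (F i)]).
Proof.
move=> eqw; rewrite /pexp.
rewrite (partition_big (fun F' : {ffun I -> T'} => [ffun i => f (F' i)]) predT) //=.
apply: eq_bigr => F _.
rewrite (eq_bigr (fun i => \sum_(c' | f c' == F i) w' i c')) => [|i _]; last exact: eqw.
rewrite bigA_distr_big_dep mulr_suml; symmetry; apply: eq_big => [F'|F' /eqP -> //].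
apply/eqP/familyP => [<- i|h]; first by rewrite ffunE; exact: eqxx.
by apply/ffunP => i; rewrite ffunE; apply/eqP/h.
Qed.

Definition bern (R : realFieldType) (x : R) (b : bool) : R := if b then x else 1 - x.

Lemma bern_ge0 (R : realFieldType) (x : R) b : 0 <= x <= 1 -> 0 <= bern x b.
Proof. by case: b => /andP [x0 x1] //=; rewrite subr_ge0. Qed.

Lemma sum_bern (R : realFieldType) (x : R) : \sum_b bern x b = 1.
Proof. by rewrite big_bool /= addrC subrK. Qed.

Lemma sum_bernN (R : realFieldType) (x : R) : \sum_b bern x (~~ b) = 1.
Proof. by rewrite big_bool /= subrK. Qed.

(** * Law of one random clause and sampling of distinct variables *)

Section ClauseLaw.
Variables (R : realFieldType) (k : nat) (V : finType).
Local Notation vclause := {ffun 'I_k -> V * bool}.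
Implicit Types (f : V -> R) (c : vclause) (K : {ffun 'I_k -> V}).

Definition cvars c : {ffun 'I_k -> V} := [ffun j => (c j).1].

(* Law of one clause when the sign P_j of an occurrence of v is positive with
   probability f v: the two products are the contributions of B = 1 and B = -1. *)
Definition wt f c : R :=
  (injectiveb (cvars c))%:R / (#|V| ^_ k)%:R
    * (2^-1 * (\prod_j bern (f (c j).1) (c j).2 + \prod_j bern (f (c j).1) (~~ (c j).2))).

Definition mean_inj (h : {ffun 'I_k -> V} -> R) : R :=
  (#|V| ^_ k)%:R^-1 * \sum_(K : {ffun 'I_k -> V} | injectiveb K) h K.

(** Given the tuple and the common sign B, the slot signs are independent, so the sum over signs
    factorises slot by slot. *)
Lemma sum_wt f (h : {ffun 'I_k -> V} -> R) (g : 'I_k -> V -> bool -> R) :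
  \sum_c wt f c * (h (cvars c) * \prod_j g j (c j).1 (c j).2) =
  mean_inj (fun K => h K * (2^-1 *
     (\prod_j (\sum_b bern (f (K j)) b * g j (K j) b)
      + \prod_j (\sum_b bern (f (K j)) (~~ b) * g j (K j) b)))).
Proof.
pose mk (x : {ffun 'I_k -> V} * {ffun 'I_k -> bool}) : vclause :=
  [ffun j => (x.1 j, x.2 j)].
have mkb : bijective mk.
  exists (fun c => (cvars c, [ffun j => (c j).2])).
    by move=> [K z]; congr pair; apply/ffunP => j; rewrite !ffunE.
  by move=> c; apply/ffunP => j; rewrite !ffunE; case: (c j).
have cK x : cvars (mk x) = x.1 by apply/ffunP => j; rewrite !ffunE.
rewrite (reindex mk) /=; last exact: onW_bij.
under eq_bigr => x _ do rewrite /wt cK.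
rewrite (eq_bigr (fun x : {ffun 'I_k -> V} * {ffun 'I_k -> bool} =>
  (injectiveb x.1)%:R / (#|V| ^_ k)%:R * (h x.1 * (2^-1 *
     (\prod_j (bern (f (x.1 j)) (x.2 j) * g j (x.1 j) (x.2 j))
      + \prod_j (bern (f (x.1 j)) (~~ (x.2 j)) * g j (x.1 j) (x.2 j))))))); last first.
  move=> x _; rewrite -[LHS]mulrA; congr (_ * _).
  rewrite mulrCA -mulrA mulrDl -!big_split /=; congr (_ * (_ * (_ + _)));
  by apply: eq_bigr => j _; rewrite ffunE.
rewrite -(pair_bigA _ (fun K (z : {ffun 'I_k -> bool}) => (injectiveb K)%:R / (#|V| ^_ k)%:R
   * (h K * (2^-1 *
     (\prod_j (bern (f (K j)) (z j) * g j (K j) (z j))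
      + \prod_j (bern (f (K j)) (~~ (z j)) * g j (K j) (z j))))))) /=.
rewrite /mean_inj mulr_sumr [RHS]big_mkcond /=; apply: eq_bigr => K _.
rewrite -mulr_sumr; case: injectiveb; last by rewrite !mul0r.
rewrite mul1r; congr (_ * _); rewrite -!mulr_sumr big_split /=; congr (_ * (_ * (_ + _))).
  by rewrite bigA_distr_bigA.
by rewrite bigA_distr_bigA.
Qed.

Lemma mean_inj_le h h' : (forall K, injectiveb K -> h K <= h' K) ->
  mean_inj h <= mean_inj h'.
Proof. by move=> le; rewrite ler_wpM2l ?invr_ge0 ?ler0n// ler_sum. Qed.

Lemma eq_mean_inj h h' : (forall K, injectiveb K -> h K = h' K) ->
  mean_inj h = mean_inj h'.
Proof. by move=> le; congr (_ * _); apply: eq_bigr. Qed.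

Lemma mean_injZ a h : mean_inj (fun K => a * h K) = a * mean_inj h.
Proof. by rewrite /mean_inj -mulr_sumr mulrCA. Qed.

Lemma mean_inj_sum (J : finType) (P : pred J) (h : J -> {ffun 'I_k -> V} -> R) :
  mean_inj (fun K => \sum_(j | P j) h j K) = \sum_(j | P j) mean_inj (h j).
Proof. by rewrite /mean_inj exchange_big mulr_sumr. Qed.

Lemma wt_ge0 f c : (forall v, 0 <= f v <= 1) -> 0 <= wt f c.
Proof.
move=> f01; rewrite mulr_ge0 ?divr_ge0 ?ler0n// mulr_ge0 ?invr_ge0 ?ler0n//.
by rewrite addr_ge0// prodr_ge0// => j _; exact: bern_ge0.
Qed.

Lemma wt_inj f c : wt f c != 0 -> injective (cvars c).
Proof.
rewrite /wt; case: (boolP (injectiveb _)) => [/injectiveP //|].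
by rewrite !mul0r eqxx.
Qed.

Lemma sum_wt_vars f h : \sum_c wt f c * h (cvars c) = mean_inj h.
Proof.
transitivity (\sum_c wt f c * (h (cvars c) * \prod_(j < k) 1)).
  by apply: eq_bigr => c _; rewrite big1_eq mulr1.
rewrite (sum_wt f h (fun _ _ _ => 1)); apply: eq_mean_inj => K _.
rewrite !big1 => [|j _|j _]; first by field.
- by under eq_bigr do rewrite mulr1; rewrite sum_bernN.
- by under eq_bigr do rewrite mulr1; rewrite sum_bern.
Qed.

Lemma card_inj_in (D : {set V}) :
  \sum_(K : {ffun 'I_k -> V} | injectiveb K) ([forall j, K j \in D])%:R
    = (#|D| ^_ k)%:R :> R.
Proof.
rewrite -[in RHS](card_ord k) -card_inj_ffuns_on -sum1_card natr_sum.
rewrite [LHS]big_mkcond [RHS]big_mkcond /=; apply: eq_bigr => K _.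
rewrite inE; have -> : (K \in ffun_on D) = [forall j, K j \in D].
  by apply/ffun_onP/forallP.
by case: injectiveb => /=; rewrite ?andbF ?andbT //; case: [forall j, _].
Qed.

Lemma mean_inj_in (D : {set V}) :
  mean_inj (fun K => ([forall j, K j \in D])%:R) = (#|D| ^_ k)%:R / (#|V| ^_ k)%:R.
Proof. by rewrite /mean_inj card_inj_in mulrC. Qed.

Hypothesis le_kV : (k <= #|V|)%N.

Lemma ffact_neq0 : (#|V| ^_ k)%:R != 0 :> R.
Proof. by rewrite pnatr_eq0 -lt0n ffact_gt0. Qed.

Lemma mean_inj_cst a : mean_inj (fun=> a) = a.
Proof.
transitivity (a * mean_inj (fun K => ([forall j, K j \in [set: V]])%:R)).
  rewrite -mean_injZ; apply: eq_mean_inj => K _.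
  by rewrite (_ : [forall _, _]) ?mulr1//; apply/forallP => j; rewrite inE.
by rewrite mean_inj_in cardsT divff ?mulr1// ffact_neq0.
Qed.

Lemma sum_wt1 f : \sum_c wt f c = 1.
Proof.
rewrite -[RHS]mean_inj_cst -(sum_wt_vars f).
by apply: eq_bigr => c _; rewrite mulr1.
Qed.

Lemma mean_inj_perm (s : {perm V}) h :
  mean_inj h = mean_inj (fun K => h [ffun j => s (K j)]).
Proof.
congr (_ * _).
pose t (K : {ffun 'I_k -> V}) : {ffun 'I_k -> V} := [ffun j => s (K j)].
have tb : bijective t.
  exists (fun K => [ffun j => (s^-1)%g (K j)]) => K; apply/ffunP => j;
  by rewrite !ffunE ?permK ?permKV.
rewrite (reindex t) /=; last exact: onW_bij.
apply: eq_bigl => K; apply/injectiveP/injectiveP => i a b.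
  by move=> e; apply: i; rewrite !ffunE e.
by rewrite !ffunE => /perm_inj /i.
Qed.

(** Transpositions show that slot [j] takes every value equally often, and these frequencies sum to
    1. *)
Lemma mean_inj_at (j : 'I_k) x : mean_inj (fun K => (K j == x)%:R) = #|V|%:R^-1.
Proof.
have V0 : #|V|%:R != 0 :> R.
  by rewrite pnatr_eq0 -lt0n; apply/card_gt0P; exists x.
have eqx y : mean_inj (fun K => (K j == y)%:R) = mean_inj (fun K => (K j == x)%:R).
  rewrite (mean_inj_perm (tperm x y)); apply: eq_mean_inj => K _.
  by rewrite ffunE (canF_eq (tpermK x y)) tpermR.
apply: (mulfI V0); rewrite divff// -[RHS](mean_inj_cst 1).
transitivity (mean_inj (fun K => \sum_y (K j == y)%:R)).
  rewrite mean_inj_sum (eq_bigr _ (fun y _ => eqx y)) sumr_const mulr_natl.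
  by rewrite cardT -cardE.
apply: eq_mean_inj => K _; rewrite (bigD1 (K j)) //= eqxx big1 ?addr0// => y.
by rewrite eq_sym => /negbTE ->.
Qed.

Lemma mean_inj_at2 (j l : 'I_k) x y : j != l -> x != y ->
  mean_inj (fun K => ((K j == x) && (K l == y))%:R) = (#|V|%:R * (#|V|%:R - 1))^-1.
Proof.
move=> jl xy.
have V1 : (1 < #|V|)%N by rewrite (cardD1 x) (cardD1 y) !inE eq_sym xy.
have V0 : (#|V|%:R - 1) != 0 :> R.
  by rewrite subr_eq0 (eqr_nat _ _ 1) gtn_eqF.
have eqy z : z != x -> mean_inj (fun K => ((K j == x) && (K l == z))%:R)
    = mean_inj (fun K => ((K j == x) && (K l == y))%:R).
  move=> zx; rewrite (mean_inj_perm (tperm y z)); apply: eq_mean_inj => K _.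
  by rewrite !ffunE !(canF_eq (tpermK y z)) tpermR tpermD // eq_sym.
apply: (mulfI V0); rewrite [in RHS]invfM [RHS]mulrCA mulfV// mulr1 -(mean_inj_at j x).
transitivity (mean_inj (fun K => \sum_(z | z != x) ((K j == x) && (K l == z))%:R)).
  rewrite mean_inj_sum (eq_bigr _ eqy) sumr_const -[RHS]mulr_natl; congr (_ * _).
  by rewrite cardC1 -subn1 natrB // ltnW.
apply: eq_mean_inj => K /injectiveP iK; case: eqP => [e|_] /=; last by rewrite big1.
have nx : K l != x by rewrite -e (inj_eq iK) eq_sym.
rewrite (bigD1 (K l)) //= eqxx big1 ?addr0// => z /andP [_].
by rewrite eq_sym => /negbTE ->.
Qed.

End ClauseLaw.

Lemma ffact_ge_exp d k : (d ^ k <= (d + k) ^_ k)%N.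
Proof.
elim: k => [|k IH]; first by rewrite ffactn0.
by rewrite addnS ffactSS expnS leq_mul//; lia.
Qed.

Lemma ffact_le_exp n k : (n ^_ k <= n ^ k)%N.
Proof.
elim: k n => [|k IH] [|n] //; rewrite ffactSS expnS leq_mul//.
by apply: leq_trans (IH n) _; case: k {IH} => // k; rewrite leq_exp2r.
Qed.

Lemma leq_ffact a b k : (a <= b)%N -> (a ^_ k <= b ^_ k)%N.
Proof.
elim: k a b => [|k IH] [|a] [|b] // ab; rewrite ?ffact0n // !ffactSS.
by rewrite leq_mul // IH.
Qed.

(** Convexity of the power function; the induction step is Chebyshev's inequality for [x, y] and
    [x ^+ k, y ^+ k], which are ordered alike. *)
Lemma exp_midpoint (R : realFieldType) (x y : R) k : 0 <= x -> 0 <= y ->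
  ((x + y) / 2) ^+ k <= 2^-1 * (x ^+ k + y ^+ k).
Proof.
move=> x0 y0; elim: k => [|k IH]; first by rewrite !expr0; lra.
rewrite exprS; apply: (@le_trans _ _ ((x + y) / 2 * (2^-1 * (x ^+ k + y ^+ k)))).
  by rewrite ler_wpM2l//; lra.
have : 0 <= (x - y) * (x ^+ k - y ^+ k).
  case: (lerP x y) => [xy|/ltW xy].
    by rewrite mulr_le0 // subr_le0 // lerXn2r.
  by rewrite mulr_ge0 // subr_ge0 // lerXn2r.
by rewrite !exprS; lra.
Qed.

(** * Probability that a random clause kills a solution set *)

Section Kill.
Variables (R : realFieldType) (k : nat) (V : finType).
Local Notation vclause := {ffun 'I_k -> V * bool}.
Local Notation asg := {ffun V -> bool}.
Implicit Types (f : V -> R) (c : vclause) (K : {ffun 'I_k -> V}) (S : {set asg}).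
Local Notation n := #|V|.

Definition csat (I : {set V}) c (s : asg) : bool :=
  [exists j, ((c j).1 \notin I) && (s (c j).1 == (c j).2)].

(* Probability that a random clause, its literals on [I] being ignored, is
   violated by all of the nonempty set [S] of assignments. *)
Definition kill f I S : R :=
  \sum_(c : vclause) wt f c * ((S != set0) && [forall s in S, ~~ csat I c s])%:R.

(** The literal ([v], [b]) is false throughout [S]. Recording avoided rather than taken values
    matches killing: every slot that is not ignored must hold an avoided literal. *)
Definition avoids S v b := [forall s in S, s v != b].

Definition frozen S : {set V} := [set v | avoids S v true || avoids S v false].

Lemma killedE I c S : [forall s in S, ~~ csat I c s] =
  [forall j, ((c j).1 \in I) || avoids S (c j).1 (c j).2].
Proof.
apply/'forall_implyP/forallP => [h j|h s sS].
  case: (boolP (_ \in I)) => //= nI; apply/'forall_implyP => s /h.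
  by rewrite /csat => /existsPn /(_ j); rewrite nI.
apply/existsPn => j; case/orP: (h j) => [->//|/'forall_implyP/(_ _ sS) /negbTE ->].
by rewrite andbF.
Qed.

Section Nonempty.
Variable S : {set asg}.
Hypothesis S0 : S != set0.

Lemma avoidsF v : ~~ (avoids S v true && avoids S v false).
Proof.
case/set0Pn: S0 => s sS; apply/negP => /andP [/'forall_implyP/(_ _ sS) + /'forall_implyP/(_ _ sS)].
by case: (s v).
Qed.

(** Probabilities that a slot at [v] receives an avoided sign, for B = 1 and B = -1. By [yD] they
    add up to 1 on frozen variables and to 0 elsewhere, the constraint behind the convexity
    argument. *)
Let y f v := \sum_b bern (f v) b * (avoids S v b)%:R : R.
Let y' f v := \sum_b bern (f v) (~~ b) * (avoids S v b)%:R : R.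

Lemma killE f : kill f set0 S =
  mean_inj (fun K => 2^-1 * (\prod_j y f (K j) + \prod_j y' f (K j))).
Proof.
rewrite /kill S0 /=.
transitivity (\sum_(c : vclause) wt f c * (1 * \prod_j (avoids S (c j).1 (c j).2)%:R)).
  apply: eq_bigr => c _; rewrite killedE mul1r; congr (_ * _).
  case: (boolP [forall j, _]) => [/forallP h|/forallPn [j]].
    by rewrite big1 // => j _; have := h j; rewrite in_set0 /= => ->.
  by rewrite in_set0 /= => /negbTE e; rewrite (bigD1 j) //= e mul0r.
rewrite (sum_wt f (fun=> 1) (fun j v b => (avoids S v b)%:R)).
by apply: eq_mean_inj => K _; rewrite mul1r.
Qed.

Lemma yD f v : y f v + y' f v = (v \in frozen S)%:R.
Proof.
rewrite /y /y' !big_bool /= inE; have := avoidsF v.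
by case: (avoids S v true); case: (avoids S v false) => //= _; ring.
Qed.

Lemma y_ge0 f v : 0 <= f v <= 1 -> 0 <= y f v.
Proof. by move=> f01; apply: sumr_ge0 => b _; rewrite mulr_ge0 ?bern_ge0. Qed.

Lemma y'_ge0 f v : 0 <= f v <= 1 -> 0 <= y' f v.
Proof. by move=> f01; apply: sumr_ge0 => b _; rewrite mulr_ge0 ?bern_ge0. Qed.

Lemma y_le1 f v : 0 <= f v <= 1 -> y f v <= (v \in frozen S)%:R.
Proof. by move=> f01; rewrite -(yD f) lerDl y'_ge0. Qed.

Lemma y'_le1 f v : 0 <= f v <= 1 -> y' f v <= (v \in frozen S)%:R.
Proof. by move=> f01; rewrite -(yD f) lerDr y_ge0. Qed.

(** A frozen variable has [y] or [y'] at least 1/2, so by pigeonhole one of the two kinds has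
    [d + k] members. The spare [k] pays for distinctness in [ffact_ge_exp]; one factor 1/2 is for B,
    the other k are for the signs. *)
Lemma kill_ge f d : (forall v, 0 <= f v <= 1) -> (k <= n)%N ->
  (2 * (d + k) <= #|frozen S|)%N ->
  2 ^- k.+1 * (d%:R / n%:R) ^+ k <= kill f set0 S.
Proof.
move=> f01 kn dF; rewrite killE.
pose D := [set v in frozen S | 2^-1 <= y f v].
pose D' := [set v in frozen S | 2^-1 <= y' f v].
have FD : (#|frozen S| <= #|D| + #|D'|)%N.
  apply: leq_trans (_ : #|D :|: D'| <= _)%N; last by rewrite cardsU leq_subr.
  apply: subset_leq_card; apply/subsetP => v vF; rewrite !inE; have := vF; rewrite inE => -> /=.
  have := yD f v; rewrite vF /=; case: lerP => //= h1 h2; lra.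
have aux (E : {set V}) : (d + k <= #|E|)%N -> 2 ^- k.+1 * (d%:R / n%:R) ^+ k
    <= 2 ^- k.+1 * (#|E| ^_ k)%:R / (n ^_ k)%:R :> R.
  move=> dE; rewrite -mulrA ler_wpM2l ?invr_ge0 ?exprn_ge0 ?ler0n//.
  rewrite expr_div_n; apply: ler_pM; rewrite ?exprn_ge0 ?invr_ge0 ?exprn_ge0 ?ler0n//.
    by rewrite -natrX ler_nat; apply: leq_trans (ffact_ge_exp _ _) _; exact: leq_ffact.
  have a0 : (0 < n ^_ k)%N by rewrite ffact_gt0.
  have a1 := ffact_le_exp n k.
  by rewrite -natrX lef_pV2 ?posrE ?ltr0n ?ler_nat // (leq_trans a0).
have prod_half (z : V -> R) (E : {set V}) K : (forall v, 0 <= z v) ->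
    (forall v, v \in E -> 2^-1 <= z v) ->
    2 ^- k * ([forall j, K j \in E])%:R <= \prod_j z (K j).
  move=> z0 zE; case: (boolP [forall j, _]) => [/forallP h|_].
    rewrite mulr1 -exprVn -[k in _ ^+ k]card_ord -prodr_const.
    by apply: ler_prod => j _; rewrite invr_ge0 ler0n zE.
  by rewrite mulr0 prodr_ge0.
have py K : 0 <= \prod_j y f (K j) by apply: prodr_ge0 => j _; exact: y_ge0.
have py' K : 0 <= \prod_j y' f (K j) by apply: prodr_ge0 => j _; exact: y'_ge0.
have [dD|dD'] : ((d + k <= #|D|) \/ (d + k <= #|D'|))%N by lia.
- apply: le_trans (aux _ dD) _; rewrite -mulrA -mean_inj_in -mean_injZ.
  apply: mean_inj_le => K _.
  have := @prod_half (y f) D K (fun v => y_ge0 (f01 v)).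
  rewrite exprS invfM -mulrA => h; rewrite ler_wpM2l ?invr_ge0 ?ler0n//.
  apply: le_trans (h _) _; last by rewrite lerDl.
  by move=> v; rewrite inE => /andP [].
- apply: le_trans (aux _ dD') _; rewrite -mulrA -mean_inj_in -mean_injZ.
  apply: mean_inj_le => K _.
  have := @prod_half (y' f) D' K (fun v => y'_ge0 (f01 v)).
  rewrite exprS invfM -mulrA => h; rewrite ler_wpM2l ?invr_ge0 ?ler0n//.
  apply: le_trans (h _) _; last by rewrite lerDr.
  by move=> v; rewrite inE => /andP [].
Qed.

(** A clause that kills only once [u] is ignored has [u] in one slot and a frozen variable other
    than [u] in every other slot. One such other slot is kept, giving the pair probability 1 / (n (n
    - 1)). *)
Lemma kill_ignore1 f u : (forall v, 0 <= f v <= 1) -> (2 <= k <= n)%N ->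
  kill f [set u] S - kill f set0 S <= k%:R * #|frozen S|%:R / (n%:R * (n%:R - 1)).
Proof.
move=> f01 /andP [k2 kn]; rewrite /kill S0 /= -sumrB.
have k0 : (0 < k)%N by exact: ltnW.
(* Some slot different from [j]; [2 <= k] guarantees it. *)
pose l (j : 'I_k) : 'I_k := if val j == 0%N then Ordinal k2 else Ordinal k0.
have lj j : j != l j by rewrite /l -val_eqE; case: ifP => [/eqP ->|/negbT].
pose h K : R := \sum_j \sum_(v in frozen S :\ u) ((K j == u) && (K (l j) == v))%:R.
apply: (@le_trans _ _ (\sum_c wt f c * h (cvars c))).
  apply: ler_sum => c _; rewrite -mulrBr.
  have [->|/wt_inj ic] := eqVneq (wt f c) 0; first by rewrite !mul0r.
  rewrite ler_wpM2l ?wt_ge0 // !killedE.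
  have h0 : 0 <= h (cvars c) by apply: sumr_ge0 => j _; apply: sumr_ge0.
  case: (boolP [forall j, _ || _]) => /= [/forallP a1|_]; last first.
    by apply: le_trans h0; rewrite sub0r oppr_le0 ler0n.
  case: (boolP [forall j, _ || _]) => /= [_|]; first by rewrite subrr.
  move=> /forallPn [j]; rewrite in_set0 /= subr0 => nj.
  have cu : (c j).1 = u.
    by have := a1 j; rewrite (negbTE nj) orbF inE => /eqP.
  have clu : (c (l j)).1 != u.
    have := lj j; rewrite -(inj_eq ic) !ffunE cu; by rewrite eq_sym.
  have lF : (c (l j)).1 \in frozen S :\ u.
    rewrite in_setD1 clu /= inE; have := a1 (l j); rewrite inE (negbTE clu) /=.
    by case: (c (l j)).2 => ->; rewrite ?orbT.
  rewrite /h (bigD1 j) //= (bigD1 ((c (l j)).1)) //= !ffunE cu !eqxx /=.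
  by rewrite -addrA lerDl addr_ge0 // sumr_ge0 // => j' _; rewrite ?sumr_ge0.
rewrite sum_wt_vars /h mean_inj_sum.
apply: (@le_trans _ _ (\sum_(j < k) \sum_(v in frozen S :\ u) (n%:R * (n%:R - 1))^-1)).
  apply: ler_sum => j _; rewrite mean_inj_sum; apply: ler_sum => v.
  by rewrite in_setD1 eq_sym => /andP [uv _]; rewrite mean_inj_at2.
rewrite sumr_const card_ord sumr_const -[leLHS]mulr_natl -[_ *+ #|_|]mulr_natl mulrA.
have n1 : 1 <= n%:R :> R by rewrite (ler_nat _ 1) (leq_trans k0).
rewrite ler_wpM2r ?invr_ge0 ?mulr_ge0 ?ler0n ?subr_ge0 // ler_wpM2l ?ler0n // ler_nat.
exact: subset_leq_card (subsetDl _ _).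
Qed.

(** The power on the left is the sum over all tuples. A tuple with a repetition counts only if the
    repeated variable is frozen, whence [#|frozen S| * n ^+ (k - 2)] for each of at most k^2 pairs
    of slots. *)
Lemma sum_prod_inj_ge (z : V -> R) : (forall v, 0 <= z v <= (v \in frozen S)%:R) ->
  (\sum_v z v) ^+ k - k%:R ^+ 2 * #|frozen S|%:R * n%:R ^+ (k - 2)
  <= \sum_(K : {ffun 'I_k -> V} | injectiveb K) \prod_j z (K j).
Proof.
move=> zF.
have z0 v : 0 <= z v by case/andP: (zF v).
have z1 v : z v <= (v \in frozen S)%:R by case/andP: (zF v).
have z11 v : z v <= 1 by apply: le_trans (z1 v) _; case: (_ \in _).
rewrite -[k in _ ^+ k - _]card_ord -prodr_const bigA_distr_bigA /=.
rewrite (bigID (fun K : {ffun 'I_k -> V} => injectiveb K)) /= lerBlDr lerD2l.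
pose g K : R := \sum_(p : 'I_k * 'I_k | p.1 != p.2) \sum_(v in frozen S)
   ((K p.1 == v) && (K p.2 == v))%:R.
apply: (@le_trans _ _ (\sum_(K : {ffun 'I_k -> V}) g K)).
  rewrite [leLHS]big_mkcond; apply: ler_sum => K _.
  have g0 : 0 <= g K by apply: sumr_ge0 => p _; apply: sumr_ge0.
  case: ifP => // /injectivePn [i [j ij e]].
  apply: (@le_trans _ _ (K i \in frozen S)%:R).
    rewrite (bigD1 i) //=; apply: le_trans (z1 _); rewrite ler_piMr//.
    by apply: prodr_ile1 => l _; rewrite z0 z11.
  case: (boolP (_ \in _)) => // Ki.
  rewrite /g (bigD1 (i, j)) //= (bigD1 (K i)) //= -e eqxx /=.
  by rewrite -addrA lerDl addr_ge0 // sumr_ge0 // => p _; rewrite ?sumr_ge0.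
rewrite exchange_big /=.
have cnt (p : 'I_k * 'I_k) : p.1 != p.2 ->
    \sum_(K : {ffun 'I_k -> V}) \sum_(v in frozen S) ((K p.1 == v) && (K p.2 == v))%:R
    = #|frozen S|%:R * n%:R ^+ (k - 2) :> R.
  move=> np; rewrite exchange_big /= -sum1_card natr_sum mulr_suml.
  apply: eq_bigr => v _; rewrite mul1r.
  transitivity (\prod_(i < k)
    \sum_(x : V) (if (i == p.1) || (i == p.2) then (x == v)%:R else 1) : R).
    rewrite bigA_distr_bigA /=; apply: eq_bigr => K _.
    rewrite (bigD1 p.1) //= (bigD1 p.2) ?[p.2 == p.1]eq_sym ?np //= !eqxx orbT /= big1 => [|i].
      by rewrite mulr1 -natrM mulnb.
    by case/andP => /negbTE -> /negbTE ->.
  rewrite (bigD1 p.1) //= (bigD1 p.2) ?[p.2 == p.1]eq_sym ?np //= !eqxx orbT /=.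
  have sv : \sum_(x : V) (x == v)%:R = 1 :> R.
    by rewrite (bigD1 v) //= eqxx big1 ?addr0 // => x /negbTE ->.
  rewrite sv !mul1r (eq_bigr (fun=> n%:R)) => [|i /andP [/negbTE -> /negbTE ->]]; last first.
    by rewrite sumr_const.
  rewrite prodr_const; congr (_ ^+ _).
  have := cardC (pred2 p.1 p.2); rewrite card2 np card_ord.
  rewrite (eq_card (_ : [predC pred2 p.1 p.2] =i [pred i | (i != p.1) && (i != p.2)])).
    by move=> /(congr1 (fun x => x - 2)%N); rewrite addKn.
  by move=> i; rewrite !inE negb_or.
rewrite (eq_bigr _ cnt) sumr_const -[leLHS]mulr_natl -[leRHS]mulrA.
rewrite ler_wpM2r ?mulr_ge0 ?exprn_ge0 ?ler0n//.
rewrite -natrX ler_nat; apply: leq_trans (max_card _) _.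
by rewrite card_prod card_ord.
Qed.

(** For fair signs both products sum, over all tuples, to [(#|frozen S| / 2) ^+ k]. Since the sums
    of [y] and [y'] add up to [#|frozen S|], [exp_midpoint] bounds this by the mean of their k-th
    powers, and only the tuples with repetitions are lost. *)
Lemma kill_half_le f : (forall v, 0 <= f v <= 1) ->
  kill (fun=> 2^-1) set0 S - kill f set0 S
    <= k%:R ^+ 2 * #|frozen S|%:R * n%:R ^+ (k - 2) / (n ^_ k)%:R.
Proof.
move=> f01; rewrite !killE /mean_inj -mulrBr [leRHS]mulrC.
rewrite ler_wpM2l ?invr_ge0 ?ler0n // -!mulr_sumr -mulrBr !big_split /=.
have yh v : y (fun=> 2^-1) v = 2^-1 * (v \in frozen S)%:R.
  rewrite /y big_bool /= inE; have := avoidsF v.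
  by case: (avoids S v true); case: (avoids S v false) => //= _; field.
have y'h v : y' (fun=> 2^-1) v = 2^-1 * (v \in frozen S)%:R.
  rewrite /y' big_bool /= inE; have := avoidsF v.
  by case: (avoids S v true); case: (avoids S v false) => //= _; field.
have up (z : V -> R) : (forall v, z v = 2^-1 * (v \in frozen S)%:R) ->
    \sum_(K : {ffun 'I_k -> V} | injectiveb K) \prod_j z (K j) <= (#|frozen S|%:R / 2) ^+ k.
  move=> zE.
  have -> : #|frozen S|%:R / 2 = \sum_v z v.
    rewrite (eq_bigr _ (fun v _ => zE v)) -mulr_sumr mulrC; congr (_ * _).
    by rewrite -sum1_card natr_sum big_mkcond /=; apply: eq_bigr => v _; case: (_ \in _).
  rewrite -[k in _ ^+ k]card_ord -prodr_const bigA_distr_bigA /=.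
  rewrite [leLHS]big_mkcond; apply: ler_sum => K _.
  have : 0 <= \prod_j z (K j) by apply: prodr_ge0 => j _; rewrite zE mulr_ge0 ?invr_ge0.
  by case: ifP.
have lo1 := @sum_prod_inj_ge (y f) (fun v => introT andP (conj (y_ge0 (f01 v)) (y_le1 (f01 v)))).
have lo2 := @sum_prod_inj_ge (y' f) (fun v => introT andP (conj (y'_ge0 (f01 v)) (y'_le1 (f01 v)))).
have up1 := up _ yh; have up2 := up _ y'h.
have : (#|frozen S|%:R / 2) ^+ k <= 2^-1 * ((\sum_v y f v) ^+ k + (\sum_v y' f v) ^+ k).
  have -> : #|frozen S|%:R = \sum_v y f v + \sum_v y' f v.
    rewrite -big_split /= -sum1_card natr_sum big_mkcond /=; apply: eq_bigr => v _.
    by rewrite yD; case: (_ \in _).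
  by apply: exp_midpoint; apply: sumr_ge0 => v _; rewrite ?y_ge0 ?y'_ge0.
set e := k%:R ^+ 2 * _ * _ in lo1 lo2 *; lra.
Qed.

End Nonempty.
End Kill.

(** * Random formulas, decisive clauses and private variables *)

Section Formula.
Variables (R : realFieldType) (k : nat) (V I : finType).
Local Notation vclause := {ffun 'I_k -> V * bool}.
Local Notation asg := {ffun V -> bool}.
Implicit Types (f : I -> V -> R) (o : I -> option {set V}) (F : {ffun I -> vclause}).
Local Notation n := #|V|.
Local Notation m := #|I|.

(* Clause i is void if [o i = None]; otherwise its literals on [o i] are ignored. *)
Definition ksat (x : option {set V}) (c : vclause) (s : asg) : bool :=
  if x is Some J then csat J c s else true.

Definition sol o F : {set asg} := [set s | [forall i, ksat (o i) (F i) s]].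

Definition law f : I -> vclause -> R := fun i => wt (f i).

Definition psat f o : R := pexp (law f) (fun F => (sol o F != set0)%:R).

Definition setk o i x : I -> option {set V} := fun l => if l == i then x else o l.

Hypothesis le_kn : (k <= n)%N.

Lemma law1 f i : \sum_c law f i c = 1.
Proof. exact: sum_wt1. Qed.

Lemma law_ge0 f : (forall i v, 0 <= f i v <= 1) -> forall i c, 0 <= law f i c.
Proof. by move=> f01 i c; exact: wt_ge0. Qed.

Lemma sol_void_upd o i F c : sol (setk o i None) (upd F i c) = sol (setk o i None) F.
Proof.
apply/setP => s; rewrite !inE; apply/eq_forallb => l.
by rewrite /setk ffunE; case: eqP.
Qed.

Lemma sol_upd o i F c : sol o (upd F i c) = [set s in sol (setk o i None) F | ksat (o i) c s].
Proof.
apply/setP => s; rewrite !inE; apply/forallP/andP => [h|[/forallP h1 h2] l].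
  split; last by have := h i; rewrite ffunE eqxx.
  by apply/forallP => l; have := h l; rewrite /setk ffunE; case: eqP.
by rewrite ffunE; have := h1 l; rewrite /setk; case: eqP => // ->.
Qed.

Lemma sol_void_sub o i F : sol o F \subset sol (setk o i None) F.
Proof.
apply/subsetP => s; rewrite !inE => /forallP h; apply/forallP => l.
by have := h l; rewrite /setk; case: eqP.
Qed.

(** Conditionally on the other clauses, with solution set [S], clause [i] destroys satisfiability
    with probability [kill]. As [f0] is free at [i], two systems that differ in clause [i] become
    expectations under one law. *)
Lemma psat_kill f f0 o i J : (forall l, l != i -> f0 l =1 f l) -> o i = Some J ->
  psat f o = pexp (law f0) (fun F => (sol (setk o i None) F != set0)%:R
                                     - kill k (f i) J (sol (setk o i None) F)).
Proof.
move=> ef oi; rewrite /psat (@pexp_resample _ _ _ (law f0) (law f) i).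
- apply: eq_pexp => // F.
  have -> : (sol (setk o i None) F != set0)%:R
      = \sum_c law f i c * (sol (setk o i None) F != set0)%:R.
    by rewrite -mulr_suml law1 mul1r.
  rewrite /kill -sumrB; apply: eq_bigr => c _.
  rewrite -mulrBr; congr (_ * _); rewrite sol_upd oi /=.
  set S := sol _ F; have [->|[s sS]] := set_0Vmem S.
    rewrite !eqxx subrr; case: set0Pn => // -[s]; rewrite !inE //.
  have -> : S != set0 by apply/set0Pn; exists s.
  rewrite /=; case: (boolP [forall _ in _, _]) => [/'forall_implyP h|].
    by rewrite subrr; case: set0Pn => // -[t]; rewrite inE => /andP [tS]; rewrite (negbTE (h t tS)).
  move=> /forallPn [t]; rewrite negb_imply negbK subr0 => h.
  by case: set0Pn => // [[]]; exists t; rewrite inE.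
- move=> l c li; rewrite /law; congr (_ * (_ * (_ + _)));
  by apply: eq_bigr => j _; rewrite ef.
- exact: law1.
Qed.

Lemma psat_void_ge f o i : (forall i v, 0 <= f i v <= 1) ->
  psat f o <= psat f (setk o i None).
Proof.
move=> f01; apply: ler_pexp => [|F _]; first exact: law_ge0.
rewrite ler_nat; case: (set_0Vmem (sol o F)) => [->|[s sS]]; first by rewrite eqxx.
have -> : sol (setk o i None) F != set0.
  by apply/set0Pn; exists s; exact: (subsetP (sol_void_sub o i F)).
by case: (_ != _).
Qed.

Definition touched (c : vclause) x := [exists j, (c j).1 == x].

Lemma sum_wt_avoid (g : V -> R) (D : {set V}) :
  \sum_c wt g c * ([forall x in D, ~~ touched c x])%:R
  = ((n - #|D|) ^_ k)%:R / (n ^_ k)%:R.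
Proof.
have -> : (n - #|D|)%N = #|~: D| by rewrite [RHS]cardsCs setCK.
rewrite -mean_inj_in -(sum_wt_vars g); apply: eq_bigr => c _; congr (_ * _%:R).
congr nat_of_bool; apply/'forall_implyP/forallP => [h j|h x xD].
  by rewrite ffunE inE; apply/negP => /h /existsPn /(_ j); rewrite eqxx.
apply/existsPn => j; apply/eqP => e.
by have := h j; rewrite ffunE inE e xD.
Qed.

(** Probability that a clause misses a given variable ([sum_wt_avoid1]). *)
Definition q1 : R := (n%:R - k%:R) / n%:R.

Hypothesis k_gt0 : (0 < k)%N.

Let n_gt0 : (0 < n)%N. Proof. exact: leq_trans le_kn. Qed.
Let n0 : n%:R != 0 :> R. Proof. by rewrite pnatr_eq0 -lt0n. Qed.

Lemma q1_ge0 : 0 <= q1.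
Proof. by rewrite divr_ge0 ?ler0n// subr_ge0 ler_nat. Qed.

Lemma q1_le1 : q1 <= 1.
Proof. by rewrite ler_pdivrMr ?ltr0n// mul1r lerBlDr lerDl ler0n. Qed.

Lemma sum_wt_avoid1 g x : \sum_c wt g c * (~~ touched c x)%:R = q1.
Proof.
transitivity (\sum_c wt g c * ([forall y in [set x], ~~ touched c y])%:R).
  apply: eq_bigr => c _; congr (_ * _%:R); congr nat_of_bool.
  apply/idP/'forall_implyP => [h y /set1P ->//|]; apply; exact: set11.
rewrite sum_wt_avoid cards1 /q1; apply/eqP.
rewrite eqr_div // ?(ffact_neq0 _ le_kn)// -natrB // -!natrM eqr_nat.
by rewrite mulnC subn1 -ffactnS ffactnSr mulnC.
Qed.

(** Drawing without replacement makes the two misses negatively correlated: (n-k)(n-k-1) / (n(n-1))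
    is at most ((n-k)/n)^2. *)
Lemma sum_wt_avoid2 g x y : x != y ->
  \sum_c wt g c * (~~ touched c x && ~~ touched c y)%:R <= q1 ^+ 2.
Proof.
move=> xy.
have n2 : (1 < n)%N by rewrite (cardD1 x) (cardD1 y) !inE eq_sym xy.
have -> : \sum_c wt g c * (~~ touched c x && ~~ touched c y)%:R
   = \sum_c wt g c * ([forall z in [set x; y], ~~ touched c z])%:R.
  apply: eq_bigr => c _; congr (_ * _%:R); congr nat_of_bool.
  apply/andP/'forall_implyP => [[h1 h2] z /set2P [] ->//|h].
  by split; apply: h; rewrite !inE eqxx ?orbT.
rewrite sum_wt_avoid cards2 xy /q1.
have e : (n * n.-1 * ((n - 2) ^_ k) = n ^_ k * ((n - k) * (n - k.+1)))%N.
  rewrite mulnA -ffactnSr -ffactnSr ffactnS [in RHS]ffactnS mulnA.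
  by congr (_ * _ ^_ _)%N; lia.
have f0 := @ffact_neq0 R _ _ le_kn.
have n10 : n.-1%:R != 0 :> R by rewrite pnatr_eq0; lia.
have -> : ((n - 2) ^_ k)%:R / (n ^_ k)%:R
   = ((n - k) * (n - k.+1))%:R / (n * n.-1)%:R :> R.
  apply/eqP; rewrite eqr_div ?natrM ?mulf_neq0 // -!natrM eqr_nat.
  by rewrite mulnC e mulnC.
rewrite -natrB // expr_div_n -!natrX.
have nn : 0 < (n * n.-1)%:R :> R by rewrite ltr0n muln_gt0 n_gt0 -subn1 subn_gt0.
rewrite ler_pdivrMr //.
rewrite mulrAC ler_pdivlMr ?ltr0n ?expn_gt0 ?n_gt0 // -!natrM ler_nat.
have [b ->] : exists b, n = (b + k)%N by exists (n - k)%N; lia.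
rewrite addnK; case: b => [|b]; first by rewrite !mul0n.
have -> : (b.+1 + k - k.+1 = b)%N by lia.
have -> : ((b.+1 + k).-1 = b + k)%N by lia.
nia.
Qed.

Section Private.
Variables (f : I -> V -> R) (J : I -> {set V}) (j0 : 'I_k).
Hypothesis f01 : forall i v, 0 <= f i v <= 1.
Hypothesis J1 : forall i, (#|J i| <= 1)%N.
Let o i := Some (J i).

Let var i F : V := (F i j0).1.

(** Only the slot [j0] is inspected: its variable is uniform and independent of the other clauses,
    which makes the probability of this event explicit. *)
Definition private i F :=
  (var i F \notin J i) && [forall (l | l != i), ~~ touched (F l) (var i F)].

(* A variable occurring in no other clause can be set so as to satisfy clause i. *)
Lemma private_sol i F : private i F -> (sol o F != set0) = (sol (setk o i None) F != set0).
Proof.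
case/andP => vJ /'forall_implyP hp; apply/set0Pn/set0Pn => -[s sS].
  by exists s; exact: (subsetP (sol_void_sub o i F)).
exists [ffun x => if x == var i F then (F i j0).2 else s x].
move: sS; rewrite !inE => /forallP h; apply/forallP => l.
have [->|li] := eqVneq l i.
  by apply/existsP; exists j0; rewrite vJ ffunE !eqxx.
have := h l; rewrite /setk (negbTE li) /= => /existsP [j hj].
apply/existsP; exists j; rewrite ffunE.
by have /existsPn /(_ j) /negbTE -> := hp l li.
Qed.

Definition untouched i F : R :=
  \sum_(x | x \notin J i) ([forall (l | l != i), ~~ touched (F l) x])%:R.

(** [h] does not see clause [i]; given the other clauses, the variable in slot [j0] is uniform, so
    it is private with conditional probability [untouched i F / n]. *)
Lemma pexp_private (h : {ffun I -> vclause} -> R) i :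
  (forall F c, h (upd F i c) = h F) ->
  pexp (law f) (fun F => h F * (private i F)%:R)
  = pexp (law f) (fun F => h F * (untouched i F / n%:R)).
Proof.
move=> hu; rewrite (@pexp_resample _ _ _ (law f) (law f) i) //; last exact: law1.
apply: eq_pexp => // F.
under eq_bigr => c _ do rewrite hu mulrCA.
rewrite -mulr_sumr; congr (_ * _); rewrite /untouched mulr_suml.
transitivity (\sum_c \sum_(x | x \notin J i) law f i c * (cvars c j0 == x)%:R *
    ([forall (l | l != i), ~~ touched (F l) x])%:R).
  apply: eq_bigr => c _.
  have -> : private i (upd F i c) = (cvars c j0 \notin J i) &&
      [forall (l | l != i), ~~ touched (F l) (cvars c j0)].
    rewrite /private /var ffunE eqxx ffunE; congr andb; apply: eq_forallb => l.
    by rewrite ffunE; case: eqP.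
  have [cJ|cJ] /= := boolP (_ \in J i).
    rewrite mulr0 big1 // => x xJ; case: eqP => [e|]; last by rewrite mulr0 mul0r.
    by rewrite -e cJ in xJ.
  rewrite (bigD1 (cvars c j0)) //= eqxx mulr1 big1 ?addr0 // => x /andP [_].
  by rewrite eq_sym => /negbTE ->; rewrite mulr0 mul0r.
rewrite exchange_big /=; apply: eq_bigr => x _.
rewrite -mulr_suml mulrC; congr (_ * _).
rewrite /law (sum_wt_vars (f i) (fun K => (K j0 == x)%:R)).
exact: mean_inj_at.
Qed.

(** The probability of [private i] ([pexp_private1]), whatever the sign law. *)
Definition nu i : R := (n - #|J i|)%:R / n%:R * q1 ^+ m.-1.

Lemma card_notin i : #|[pred x | x \notin J i]| = (n - #|J i|)%N.
Proof.
have -> : (n - #|J i|)%N = #|~: J i| by rewrite [RHS]cardsCs setCK.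
by apply: eq_card => x; rewrite !inE.
Qed.

Lemma pexp_avoid_others i x :
  pexp (law f) (fun F => ([forall (l | l != i), ~~ touched (F l) x])%:R) = q1 ^+ m.-1.
Proof.
transitivity (pexp (law f) (fun F => \prod_l
    (if l == i then 1 else (~~ touched (F l) x)%:R))).
  apply: eq_pexp => // F; case: (boolP [forall (l | _), _]) => [/'forall_implyP h|].
    by rewrite big1 // => l _; case: eqVneq => // /h ->.
  case/forallPn => l; rewrite negb_imply negbK => /andP [li t].
  by rewrite (bigD1 l) //= (negbTE li) t mul0r.
rewrite (pexp_prod (law f) (fun l c => if l == i then 1 else (~~ touched c x)%:R)).
rewrite (bigD1 i) //= eqxx; under eq_bigr do rewrite mulr1.
rewrite law1 mul1r (eq_bigr (fun=> q1)); last first.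
  by move=> l /negbTE ->; exact: sum_wt_avoid1.
by rewrite prodr_const; congr (_ ^+ _); rewrite (eq_card (B := predC1 i)) ?cardC1.
Qed.

Lemma pexp_untouched i : pexp (law f) (untouched i) = n%:R * nu i.
Proof.
rewrite pexp_sum (eq_bigr _ (fun x _ => pexp_avoid_others i x)) sumr_const card_notin.
by rewrite /nu mulrA mulrCA mulfV // mulr1 mulr_natl.
Qed.

(** By [sum_wt_avoid2] distinct variables are negatively correlated, so only the diagonal, at most
    n, contributes to the variance of [untouched i]. *)
Lemma pexp_untouched2 i : pexp (law f) (fun F => (untouched i F / n%:R - nu i) ^+ 2) <= n%:R^-1.
Proof.
have e2 : pexp (law f) (fun F => untouched i F ^+ 2) <= n%:R + (n%:R * nu i) ^+ 2.
  have -> : pexp (law f) (fun F => untouched i F ^+ 2) = \sum_(x | x \notin J i)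
     \sum_(y | y \notin J i) pexp (law f) (fun F =>
       ([forall (l | l != i), ~~ touched (F l) x])%:R *
       ([forall (l | l != i), ~~ touched (F l) y])%:R).
    under [RHS]eq_bigr do rewrite -pexp_sum; rewrite -pexp_sum.
    apply: eq_pexp => // F; rewrite expr2 /untouched mulr_suml.
    by apply: eq_bigr => x _; rewrite mulr_sumr.
  have pair x y : x != y -> pexp (law f) (fun F =>
       ([forall (l | l != i), ~~ touched (F l) x])%:R *
       ([forall (l | l != i), ~~ touched (F l) y])%:R) <= q1 ^+ m.-1 * q1 ^+ m.-1.
    move=> xy.
    apply: (@le_trans _ _ (pexp (law f) (fun F => \prod_l
      (if l == i then 1 else (~~ touched (F l) x && ~~ touched (F l) y)%:R)))).
      apply: ler_pexp => [|F _]; first exact: law_ge0.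
      case: (boolP [forall (l | _), ~~ touched (F l) x]) => [/'forall_implyP h|_]; last first.
        by rewrite mul0r prodr_ge0 // => l _; case: eqP.
      case: (boolP [forall (l | _), ~~ touched (F l) y]) => [/'forall_implyP h'|_]; last first.
        by rewrite mulr0 prodr_ge0 // => l _; case: eqP.
      by rewrite mulr1 big1 // => l _; case: eqVneq => // li; rewrite h ?h'.
    rewrite (pexp_prod (law f)
       (fun l c => if l == i then 1 else (~~ touched c x && ~~ touched c y)%:R)).
    rewrite (bigD1 i) //= eqxx; under eq_bigr do rewrite mulr1.
    rewrite law1 mul1r.
    apply: (@le_trans _ _ (\prod_(l | l != i) q1 ^+ 2)).
      apply: ler_prod => l /negbTE ->; apply/andP; split; last exact: sum_wt_avoid2.
      by apply: sumr_ge0 => c _; rewrite mulr_ge0 ?law_ge0.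
    by rewrite prodr_const (eq_card (B := predC1 i)) ?cardC1 // exprAC expr2.
  apply: (@le_trans _ _ (\sum_(x | x \notin J i) (1 + \sum_(y | y \notin J i)
       q1 ^+ m.-1 * q1 ^+ m.-1))).
    apply: ler_sum => x xJ; rewrite (bigD1 x) //=; apply: lerD.
      rewrite -[leRHS](pexp_cst 1 (law1 f)); apply: ler_pexp => [|F _]; first exact: law_ge0.
      by rewrite -natrM mulnb lern1 leq_b1.
    rewrite [leRHS](bigD1 x) //= ler_wpDl ?mulr_ge0 ?exprn_ge0 ?q1_ge0 //.
    by apply: ler_sum => y /andP [_]; rewrite eq_sym => /pair.
  rewrite big_split /= !sumr_const !card_notin; apply: lerD.
    by rewrite ler_nat leq_subr.
  have -> : n%:R * nu i = (n - #|J i|)%:R * q1 ^+ m.-1 by rewrite /nu; field.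
  rewrite -[leLHS]mulr_natl -[X in _ * X]mulr_natl.
  by rewrite le_eqVlt; apply/orP; left; apply/eqP; ring.
have -> : pexp (law f) (fun F => (untouched i F / n%:R - nu i) ^+ 2)
  = n%:R^-1 ^+ 2 * pexp (law f) (fun F => untouched i F ^+ 2)
    - (2 * nu i / n%:R) * pexp (law f) (untouched i) + nu i ^+ 2.
  rewrite -!pexpZ -pexpB -[X in _ + X](pexp_cst (nu i ^+ 2) (law1 f)) -pexpD.
  by apply: eq_pexp => // F; ring.
rewrite pexp_untouched.
have := ler_wpM2l (_ : 0 <= n%:R^-1 ^+ 2) e2; rewrite exprn_ge0 ?invr_ge0 ?ler0n // => /(_ isT) h.
apply: le_trans (lerD (lerD h (lexx _)) (lexx _)) _.
by rewrite le_eqVlt; apply/orP; left; apply/eqP; field.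
Qed.

Lemma pexp_private1 i : pexp (law f) (fun F => (private i F)%:R) = nu i.
Proof.
transitivity (pexp (law f) (fun F => 1 * (private i F)%:R)).
  by apply: eq_pexp => // F; rewrite mul1r.
rewrite (pexp_private (h := fun=> 1)) //.
transitivity (pexp (law f) (fun F => n%:R^-1 * untouched i F)).
  by apply: eq_pexp => // F; rewrite mul1r mulrC.
by rewrite pexpZ pexp_untouched mulrA mulVf // mul1r.
Qed.

Lemma nu_ge0 i : 0 <= nu i.
Proof. by rewrite mulr_ge0 ?exprn_ge0 ?q1_ge0// divr_ge0 ?ler0n. Qed.

(** If both are private, their variables are distinct and avoided by the other [m - 2] clauses,
    whereas [nu i * nu i'] holds [2 * (m - 1)] factors [q1]; [1 - q1 ^+ 2] makes up the
    difference. *)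
Lemma pexp_private_pair i i' : i != i' ->
  pexp (law f) (fun F => (private i F)%:R * (private i' F)%:R)
  <= nu i * nu i' + (1 - q1 ^+ 2).
Proof.
move=> ii'.
pose g x y (l : I) (c : vclause) : R := if l == i then (cvars c j0 == x)%:R else
  if l == i' then (cvars c j0 == y)%:R else (~~ touched c x && ~~ touched c y)%:R.
apply: (@le_trans _ _ (pexp (law f) (fun F => \sum_(x | x \notin J i)
    \sum_(y | (y \notin J i') && (x != y)) \prod_l g x y l (F l)))).
  apply: ler_pexp => [|F _]; first exact: law_ge0.
  have g0 x y l c : 0 <= g x y l c by rewrite /g; case: eqP => // _; case: eqP.
  case: (boolP (private i F)) => [/andP [vJ /'forall_implyP hp]|_]; last first.
    by rewrite mul0r; do 2 (apply: sumr_ge0 => ? _); exact: prodr_ge0.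
  case: (boolP (private i' F)) => [/andP [vJ' /'forall_implyP hp']|_]; last first.
    by rewrite mulr0; do 2 (apply: sumr_ge0 => ? _); exact: prodr_ge0.
  have vv : var i F != var i' F.
    have := hp i'; rewrite eq_sym ii' => /(_ isT) /existsPn /(_ j0).
    by rewrite eq_sym.
  rewrite mulr1 (bigD1 (var i F)) //= (bigD1 (var i' F)) ?vJ' //=.
  rewrite big1 ?ler_wpDr ?addr_ge0 //.
  - by do 2 (apply: sumr_ge0 => ? _); exact: prodr_ge0.
  - by apply: sumr_ge0 => ? _; exact: prodr_ge0.
  move=> l _; rewrite /g; case: eqVneq => [->|li]; first by rewrite ffunE eqxx.
  case: eqVneq => [->|li']; first by rewrite ffunE eqxx.
  by rewrite hp ?hp'.
have one x y : x != y -> pexp (law f) (fun F => \prod_l g x y l (F l))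
    <= n%:R^-1 * (n%:R^-1 * (q1 ^+ 2) ^+ (m - 2)).
  move=> xy; rewrite (pexp_prod (law f) (g x y)) (bigD1 i) //=.
  have at_j0 (z : V) l : \sum_c law f l c * (cvars c j0 == z)%:R = n%:R^-1.
    by rewrite /law (sum_wt_vars (f l) (fun K => (K j0 == z)%:R)) mean_inj_at.
  rewrite {1}/g eqxx at_j0 ler_wpM2l ?invr_ge0 ?ler0n //.
  rewrite (bigD1 i') 1?eq_sym //= {1}/g eq_sym (negbTE ii') eqxx at_j0.
  rewrite ler_wpM2l ?invr_ge0 ?ler0n //.
  apply: (@le_trans _ _ (\prod_(l | (l != i) && (l != i')) q1 ^+ 2)).
    apply: ler_prod => l /andP [/negbTE li /negbTE li']; rewrite /g li li'.
    apply/andP; split; last exact: sum_wt_avoid2.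
    by apply: sumr_ge0 => c _; rewrite mulr_ge0 ?law_ge0.
  rewrite prodr_const; suff -> : #|[pred l | (l != i) && (l != i')]| = (m - 2)%N by [].
  have := cardC (pred2 i i'); rewrite card2 ii'.
  rewrite (eq_card (_ : [predC pred2 i i'] =i [pred l | (l != i) && (l != i')])).
    by move=> /(congr1 (fun x => x - 2)%N); rewrite addKn.
  by move=> l; rewrite !inE negb_or.
rewrite pexp_sum.
apply: (@le_trans _ _ (\sum_(x | x \notin J i) \sum_(y | y \notin J i')
    n%:R^-1 * (n%:R^-1 * (q1 ^+ 2) ^+ (m - 2)))).
  apply: ler_sum => x _; rewrite pexp_sum.
  rewrite [leLHS]big_mkcond [leRHS]big_mkcond /=; apply: ler_sum => y _.
  case: (y \notin J i') => //=; case: ifP => [/one //|_].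
  by rewrite !mulr_ge0 ?invr_ge0 ?ler0n ?exprn_ge0 ?q1_ge0.
rewrite !sumr_const !card_notin -[leLHS]mulr_natl -[X in _ * X]mulr_natl.
have m2 : (1 < m)%N by rewrite (cardD1 i) (cardD1 i') !inE eq_sym ii'.
rewrite /nu; set a := (n - #|J i|)%:R; set b := (n - #|J i'|)%:R.
have a1 : 0 <= a / n%:R <= 1.
  by rewrite divr_ge0 ?ler0n //= ler_pdivrMr ?ltr0n // mul1r ler_nat leq_subr.
have b1 : 0 <= b / n%:R <= 1.
  by rewrite divr_ge0 ?ler0n //= ler_pdivrMr ?ltr0n // mul1r ler_nat leq_subr.
have -> : m.-1 = (m - 2).+1 by lia.
set r := q1 ^+ (m - 2).
have r1 : 0 <= r <= 1 by rewrite exprn_ge0 ?q1_ge0 //= exprn_ile1 ?q1_ge0 ?q1_le1.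
rewrite exprAC -/r !(exprSr q1 (m - 2)) -/r.
have -> : a * (b * (n%:R^-1 * (n%:R^-1 * r ^+ 2))) = (a / n%:R) * (b / n%:R) * r ^+ 2 by ring.
have -> : a / n%:R * (r * q1) * (b / n%:R * (r * q1)) + (1 - q1 ^+ 2)
  = (a / n%:R) * (b / n%:R) * r ^+ 2 + (1 - q1 ^+ 2) * (1 - (a / n%:R) * (b / n%:R) * r ^+ 2).
  ring.
rewrite lerDl mulr_ge0 ?subr_ge0 ?exprn_ile1 ?q1_ge0 ?q1_le1 //.
case/andP: a1 => a0 a1; case/andP: b1 => b0 b1; case/andP: r1 => r0 r1.
have ab0 : 0 <= a / n%:R * (b / n%:R) by rewrite mulr_ge0.
have ab1 : a / n%:R * (b / n%:R) <= 1 by rewrite mulr_ile1.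
have r20 : 0 <= r ^+ 2 by rewrite exprn_ge0.
have r21 : r ^+ 2 <= 1 by rewrite exprn_ile1.
by rewrite mulr_ile1.
Qed.

Lemma pexp_private2 :
  pexp (law f) (fun F => (\sum_i ((private i F)%:R - nu i)) ^+ 2)
  <= m%:R + m%:R ^+ 2 * (1 - q1 ^+ 2).
Proof.
have -> : pexp (law f) (fun F => (\sum_i ((private i F)%:R - nu i)) ^+ 2)
  = \sum_i \sum_i' (pexp (law f) (fun F => (private i F)%:R * (private i' F)%:R)
                    - nu i * nu i').
  transitivity (\sum_i \sum_i' pexp (law f) (fun F =>
      ((private i F)%:R - nu i) * ((private i' F)%:R - nu i'))).
    under [RHS]eq_bigr do rewrite -pexp_sum; rewrite -pexp_sum.
    apply: eq_pexp => // F; rewrite expr2 mulr_suml.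
    by apply: eq_bigr => i _; rewrite mulr_sumr.
  apply: eq_bigr => i _; apply: eq_bigr => i' _.
  transitivity (pexp (law f) (fun F => (private i F)%:R * (private i' F)%:R)
     - nu i' * pexp (law f) (fun F => (private i F)%:R)
     - nu i * pexp (law f) (fun F => (private i' F)%:R) + nu i * nu i').
    rewrite -!pexpZ -!pexpB -[X in _ + X](pexp_cst (nu i * nu i') (law1 f)) -pexpD.
    by apply: eq_pexp => // F; ring.
  by rewrite !pexp_private1; ring.
have q21 : 0 <= 1 - q1 ^+ 2 by rewrite subr_ge0 exprn_ile1 ?q1_ge0 ?q1_le1.
apply: (@le_trans _ _ (\sum_(i : I) (1 + \sum_(i' : I) (1 - q1 ^+ 2)))).
  apply: ler_sum => i _; rewrite (bigD1 i) //=; apply: lerD.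
    rewrite lerBlDr; apply: (@le_trans _ _ 1); last by rewrite lerDl mulr_ge0 ?nu_ge0.
    rewrite -[leRHS](pexp_cst 1 (law1 f)); apply: ler_pexp => [|F _]; first exact: law_ge0.
    by rewrite -natrM mulnb lern1 leq_b1.
  rewrite [leRHS](bigD1 i) //= ler_wpDl //; apply: ler_sum => i'.
  by rewrite eq_sym => /pexp_private_pair; rewrite lerBlDl.
rewrite big_split /= !sumr_const -[X in _ + X]mulr_natl -[X in _ * X]mulr_natl.
by rewrite mulrA -expr2.
Qed.

(* Adding one more clause rarely destroys satisfiability: the number of clauses
   with a private variable fluctuates, and such clauses are irrelevant. *)
Lemma sum_psat_void (t t' : R) : 0 < t -> 0 < t' -> n%:R^-1 <= t ^+ 2 ->
  m%:R + m%:R ^+ 2 * (1 - q1 ^+ 2) <= t' ^+ 2 ->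
  (1 - n%:R^-1) * q1 ^+ m * (\sum_i (psat f (setk o i None) - psat f o)) <= m%:R * t + t'.
Proof.
move=> t0 t'0 ht ht'.
have step1 : (1 - n%:R^-1) * q1 ^+ m * (\sum_i (psat f (setk o i None) - psat f o))
    <= \sum_i nu i * (psat f (setk o i None) - psat f o).
  rewrite mulr_sumr; apply: ler_sum => i _; rewrite ler_wpM2r ?subr_ge0 ?psat_void_ge //.
  have m0 : (0 < m)%N by apply/card_gt0P; exists i.
  apply: ler_pM; rewrite ?exprn_ge0 ?q1_ge0 ?subr_ge0 //.
  - by rewrite invf_le1 ?ltr0n // ler1n.
  - rewrite natrB ?(leq_trans (J1 i)) // mulrBl divff // lerD2l lerN2.
    by rewrite -[leRHS]mul1r ler_wpM2r ?invr_ge0 ?ler0n // lern1.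
  - by rewrite ler_wiXn2l ?q1_ge0 ?q1_le1 // leq_pred.
apply: le_trans step1 _.
(* On [private i], voiding clause [i] changes nothing, and [pexp_private] trades privacy for
   [untouched]. Thus the weighted loss at clause [i] is a fluctuation of [untouched i] plus one of
   [private i]. The latter are summed before taking absolute values, so that they cancel down to the
   square root of their variance. *)
have -> : \sum_i nu i * (psat f (setk o i None) - psat f o)
  = \sum_i pexp (law f) (fun F => (sol (setk o i None) F != set0)%:R *
        (nu i - untouched i F / n%:R))
    + pexp (law f) (fun F => (sol o F != set0)%:R * \sum_i ((private i F)%:R - nu i)).
  rewrite -[X in _ + X](_ : \sum_i pexp (law f) (fun F => (sol o F != set0)%:R *
      ((private i F)%:R - nu i)) = _); last first.
    by rewrite -pexp_sum; apply: eq_pexp => // F; rewrite mulr_sumr.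
  rewrite -big_split /=; apply: eq_bigr => i _.
  have := @pexp_private (fun F => (sol (setk o i None) F != set0)%:R) i
    (fun F c => congr1 (fun S => (S != set0)%:R) (sol_void_upd o i F c)).
  have -> : pexp (law f) (fun F => (sol (setk o i None) F != set0)%:R * (private i F)%:R)
     = pexp (law f) (fun F => (sol o F != set0)%:R * (private i F)%:R).
    apply: eq_pexp => // F; case: (boolP (private i F)) => [/private_sol -> //|].
    by rewrite !mulr0.
  move=> e.
  transitivity (nu i * psat f (setk o i None)
    - pexp (law f) (fun F => (sol (setk o i None) F != set0)%:R * (untouched i F / n%:R))
    + (pexp (law f) (fun F => (sol o F != set0)%:R * (private i F)%:R) - nu i * psat f o)).
    by rewrite e; ring.
  rewrite /psat -!pexpZ -!pexpB; congr (_ + _); apply: eq_pexp => // F; ring.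
apply: lerD.
  have -> : m%:R * t = \sum_(i : I) t by rewrite sumr_const mulr_natl.
  apply: ler_sum => i _.
  apply: le_trans (pexp_norm_le (law_ge0 f01) (law1 f) t0
    (le_trans (pexp_untouched2 i) ht)).
  apply: ler_pexp => [|F _]; first exact: law_ge0.
  rewrite -normrN opprB; case: (_ != _); first by rewrite mul1r ler_norm.
  by rewrite mul0r normr_ge0.
apply: le_trans (pexp_norm_le (law_ge0 f01) (law1 f) t'0 (le_trans pexp_private2 ht')).
apply: ler_pexp => [|F _]; first exact: law_ge0.
case: (_ != _); first by rewrite mul1r ler_norm.
by rewrite mul0r normr_ge0.
Qed.

End Private.
End Formula.

(** * Replacing the clauses one by one *)

Definition harm (R : realFieldType) (m : nat) : R := \sum_(j < m) j.+1%:R^-1.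

Section Exchange.
Variables (R : realFieldType) (k : nat) (V I : finType).

Lemma eq_sol (o o' : I -> option {set V}) (F : {ffun I -> {ffun 'I_k -> V * bool}}) :
  o =1 o' -> sol o F = sol o' F.
Proof. by move=> e; apply/setP => s; rewrite !inE; apply: eq_forallb => i; rewrite e. Qed.

Lemma eq_psat (f f' : I -> V -> R) o o' : (forall i, f i =1 f' i) -> o =1 o' ->
  psat k f o = psat k f' o'.
Proof.
move=> ef eo; apply: eq_pexp => [i c|F]; last by rewrite (eq_sol F eo).
rewrite /law; congr (_ * (_ * (_ + _)));
by apply: eq_bigr => j _; rewrite ef.
Qed.

Lemma psat_perm (s : {perm I}) (f : I -> V -> R) o :
  psat k (fun i => f (s i)) (fun i => o (s i)) = psat k f o.
Proof.
rewrite /psat (pexp_perm s (law f)); apply: eq_pexp => // F.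
congr ((_ != _)%:R); apply/setP => t; rewrite !inE.
apply/forallP/forallP => h i; last by rewrite ffunE.
by have := h ((s^-1)%g i); rewrite ffunE permKV.
Qed.

End Exchange.

Section Hybrid.
Variables (R : realFieldType) (k : nat) (V : finType) (m : nat).
Local Notation n := #|V|.
Variables (fa fb : V -> R) (Ja Jb : {set V}).
Hypotheses (k_gt0 : (0 < k)%N) (le_kn : (k <= n)%N).
Hypotheses (fa01 : forall v, 0 <= fa v <= 1) (fb01 : forall v, 0 <= fb v <= 1).
Hypotheses (Ja1 : (#|Ja| <= 1)%N) (Jb1 : (#|Jb| <= 1)%N).
Variables (C eta kap t t' : R).
Hypotheses (C0 : 0 <= C) (eta0 : 0 <= eta) (kap0 : 0 < kap).
Hypothesis kill_diff : forall S : {set {ffun V -> bool}}, S != set0 ->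
  kill k fb Jb S - kill k fa Ja S <= C * #|frozen S|%:R / n%:R ^+ 2.
Hypothesis kill_lower : forall S : {set {ffun V -> bool}}, S != set0 ->
  eta * n%:R <= #|frozen S|%:R -> kap <= kill k fa Ja S.
Hypotheses (t0 : 0 < t) (t'0 : 0 < t') (ht : n%:R^-1 <= t ^+ 2)
  (ht' : m%:R + m%:R ^+ 2 * (1 - q1 R k V ^+ 2) <= t' ^+ 2).
Hypothesis lt_kn : (k < n)%N.

Let fh l (i : 'I_m) := if (i < l)%N then fb else fa.
Let Jh l (i : 'I_m) := if (i < l)%N then Jb else Ja.
Let oh l i := Some (Jh l i).

Let n_gt1 : (1 < n)%N. Proof. exact: leq_ltn_trans lt_kn. Qed.
Let n0 : 0 < n%:R :> R. Proof. by rewrite ltr0n ltnW. Qed.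

Let nu0 : 0 < (1 - n%:R^-1) * q1 R k V ^+ m.
Proof.
rewrite mulr_gt0 ?subr_gt0 ?invf_lt1 ?ltr1n // exprn_gt0 // divr_gt0 //.
by rewrite subr_gt0 ltr_nat.
Qed.

Let fh01 l i v : 0 <= fh l i v <= 1.
Proof. by rewrite /fh; case: ifP. Qed.

Let Jh1 l i : (#|Jh l i| <= 1)%N.
Proof. by rewrite /Jh; case: ifP. Qed.

Let x (l : 'I_m) := psat k (fh l) (setk (oh l) l None) - psat k (fh l) (oh l).

(** Clauses [l] to [m - 1] still have the law [fa] and the ignored set [Ja], so they share the loss
    [x l]; these [m - l] equal terms are bounded by the full sum in [sum_psat_void]. *)
Let x_le (l : 'I_m) :
  x l <= (m%:R * t + t') / ((1 - n%:R^-1) * q1 R k V ^+ m) * (m - l)%:R^-1.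
Proof.
have := sum_psat_void le_kn k_gt0 (Ordinal k_gt0) (@fh01 l) (@Jh1 l) t0 t'0 ht.
rewrite card_ord => /(_ ht').
rewrite -(mulrC (\sum_(i < m) _)) -ler_pdivlMr // => h.
have ml : 0 < (m - l)%:R :> R by rewrite ltr0n subn_gt0.
rewrite ler_pdivlMr //; apply: le_trans h.
rewrite mulrC mulr_natl.
have eqx (i : 'I_m) : (l <= i)%N -> x l = psat k (fh l) (setk (oh l) i None) - psat k (fh l) (oh l).
  move=> li; congr (_ - _).
  rewrite -[LHS](psat_perm k (tperm l i)); apply: eq_psat => j.
    by rewrite /fh; case: tpermP => [->|->|//]; rewrite ltnn ltnNge li.
  rewrite /setk /oh /Jh; case: tpermP => [->|->|/eqP jl /eqP ji].
  - by rewrite [l == i]eq_sym ltnn ltnNge li.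
  - by rewrite !eqxx.
  - by rewrite (negbTE jl) (negbTE ji).
apply: (@le_trans _ _ (\sum_(i < m | (l <= i)%N) x l)).
  by rewrite -(big_geq_mkord _ _ predT (fun=> x l)) sumr_const_nat.
rewrite (eq_bigr _ (fun i li => eqx i li)) big_mkcond /=; apply: ler_sum => i _.
by case: ifP => // _; rewrite subr_ge0 psat_void_ge.
Qed.

Let step (l : 'I_m) : psat k (fh l) (oh l) - psat k (fh l.+1) (oh l.+1)
  <= C / n%:R * (eta + x l / kap).
Proof.
have ea : fh l l = fa by rewrite /fh ltnn.
have eb : fh l.+1 l = fb by rewrite /fh ltnS leqnn.
have oa : oh l l = Some Ja by rewrite /oh /Jh ltnn.
have ob : oh l.+1 l = Some Jb by rewrite /oh /Jh ltnS leqnn.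
have off (i : 'I_m) : i != l -> (i < l.+1)%N = (i < l)%N.
  by move=> il; rewrite ltnS leq_eqVlt (inj_eq val_inj) (negbTE il).
have same (F : {ffun 'I_m -> {ffun 'I_k -> V * bool}}) :
    sol (setk (oh l.+1) l None) F = sol (setk (oh l) l None) F :> {set {ffun V -> bool}}.
  by apply: eq_sol => i; rewrite /setk /oh /Jh; case: eqVneq => // /off ->.
rewrite (psat_kill le_kn (f0 := fh l) (i := l) _ oa) // ea.
rewrite (psat_kill le_kn (f := fh l.+1) (f0 := fh l) (i := l) _ ob) => [|i il]; last first.
  by rewrite /fh off.
rewrite eb -pexpB.
(* The loss [x l] is the expected killing probability of the clause about to be replaced. *)
have -> : x l = pexp (law (fh l)) (fun F : {ffun 'I_m -> {ffun 'I_k -> V * bool}} =>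
    kill k fa Ja (sol (setk (oh l) l None) F)).
  rewrite /x (psat_kill le_kn (f0 := fh l) (i := l) _ oa) // ea /psat -pexpB.
  by apply: eq_pexp => // F; ring.
have -> : C / n%:R * (eta + pexp (law (fh l)) (fun F : {ffun 'I_m -> {ffun 'I_k -> V * bool}} =>
      kill k fa Ja (sol (setk (oh l) l None) F)) / kap)
  = pexp (law (fh l)) (fun F : {ffun 'I_m -> {ffun 'I_k -> V * bool}} =>
      C / n%:R * (eta + kap^-1 * kill k fa Ja (sol (setk (oh l) l None) F))).
  by rewrite pexpZ pexpD pexpZ pexp_cst ?[_ / kap]mulrC //; exact: law1.
apply: ler_pexp => [|F _]; first exact: law_ge0.
rewrite same; set S := sol _ _.
have [->|S0] := eqVneq S set0.
  have k0 f (J : {set V}) : kill k f J set0 = 0 :> R.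
    by rewrite /kill eqxx /= big1 // => c _; rewrite mulr0.
  by rewrite !k0 subrr mulr0 addr0 mulr_ge0 ?divr_ge0.
have := kill_diff S0; have kS0 : 0 <= kill k fa Ja S.
  by apply: sumr_ge0 => c _; rewrite mulr_ge0 ?wt_ge0.
set ka := kill _ fa _ _ in kS0 *; set kb := kill _ fb _ _ => hd.
rewrite [leLHS](_ : _ = kb - ka); last by ring.
apply: le_trans hd _.
have fn : #|frozen S|%:R <= n%:R :> R by rewrite ler_nat max_card.
have Cn : 0 <= C / n%:R by rewrite divr_ge0 // ltW.
have -> : C * #|frozen S|%:R / n%:R ^+ 2 = C / n%:R * (#|frozen S|%:R / n%:R).
  by field; rewrite gt_eqF.
rewrite ler_wpM2l //.
have kk : 0 <= kap^-1 * ka by rewrite mulr_ge0 ?invr_ge0 ?(ltW kap0).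
(* Pointwise, [#|frozen S| / n] is at most [eta], or else it is at most 1 and [ka / kap] is at least
   1. *)
case: (lerP (eta * n%:R) #|frozen S|%:R) => [he|/ltW he].
  apply: (@le_trans _ _ 1); first by rewrite ler_pdivrMr // mul1r.
  rewrite ler_wpDl // mulrC ler_pdivlMr // mul1r; exact: kill_lower.
by apply: (@le_trans _ _ eta); rewrite ?lerDl // ler_pdivrMr.
Qed.

(* Either at most eta n variables are frozen before step l, or the l-th clause is
   decisive with probability at least kap; the second alternative
   has probability at most x l / kap. *)
Lemma hybrid_bound : psat k (fun _ : 'I_m => fa) (fun=> Some Ja)
    - psat k (fun _ : 'I_m => fb) (fun=> Some Jb)
  <= C / n%:R * (m%:R * eta +
      (m%:R * t + t') / ((1 - n%:R^-1) * q1 R k V ^+ m) / kap * harm R m).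
Proof.
have -> : psat k (fun _ : 'I_m => fa) (fun=> Some Ja) = psat k (fh 0) (oh 0).
  by apply: eq_psat => i.
have -> : psat k (fun _ : 'I_m => fb) (fun=> Some Jb) = psat k (fh m) (oh m).
  by apply: eq_psat => [i v|i]; rewrite /fh /oh /Jh ltn_ord.
rewrite -(opprB (psat k (fh m) _)) -(telescope_sumr (fun l => psat k (fh l) (oh l))) //.
rewrite -sumrN big_mkord.
apply: (@le_trans _ _ (\sum_(l < m) C / n%:R * (eta + x l / kap))).
  by apply: ler_sum => l _; rewrite opprB step.
rewrite -mulr_sumr ler_wpM2l ?divr_ge0 ?(ltW n0) // big_split /=.
apply: lerD; first by rewrite sumr_const card_ord mulr_natl.
(* Reversing the order turns the bounds 1 / (m - l) into the terms of [harm]. *)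
rewrite /harm (reindex_inj rev_ord_inj) /= mulr_sumr; apply: ler_sum => l _.
have := x_le (rev_ord l); rewrite /= subKn // => h.
rewrite mulrAC ler_wpM2r ?invr_ge0 ?(ltW kap0) //.
Qed.

End Hybrid.

(** * The sign kernel of a pair of variables *)

Section Pairs.
Variables (R : realFieldType) (k : nat) (V I : finType).
Local Notation vclause := {ffun 'I_k -> V * bool}.
Local Notation asg := {ffun V -> bool}.
Implicit Types (c : vclause) (F : {ffun I -> vclause}) (S : {set asg}).

Definition sgn_pair S u u' : R :=
  [exists s in S, s u == s u']%:R - [exists s in S, s u != s u']%:R.

(** The factor 1/2 is the coin that chooses the copy for an occurrence of a split variable. *)
Definition wdeg u c : R := if touched c u then 2^-1 else 1.

Definition wdegF u F : R := \prod_i wdeg u (F i).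

(** A clause holding both copies of a split variable would repeat that variable after gluing. *)
Definition apart u u' F := [forall i, ~~ (touched (F i) u && touched (F i) u')].

Definition solF F := sol (fun=> Some set0) F.

Lemma sgn_pairC S u u' : sgn_pair S u u' = sgn_pair S u' u.
Proof.
rewrite /sgn_pair; congr (_%:R - _%:R); congr nat_of_bool; apply: eq_existsb => s;
by rewrite eq_sym.
Qed.

Lemma sgn_pairE S s0 u u' : s0 \in S ->
  sgn_pair S u u' = (if s0 u then 1 else -1) * (if s0 u' then 1 else -1) *
    ([set s in S | s u != s0 u] == [set s in S | s u' != s0 u'])%:R.
Proof.
move=> s0S; rewrite /sgn_pair.
case: (boolP [exists s in S, s u == s u']) => [/'exists_andP [s [sS /eqP e]]|/existsPn nE];
case: (boolP [exists s in S, s u != s u']) => [/'exists_andP [t [tS ne]]|/existsPn nN].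
- rewrite subrr; case: eqP; last by rewrite mulr0.
  move=> /setP h; have := h s; have := h t; rewrite !inE sS tS /=.
  rewrite !negb_eqb; move: ne e; rewrite negb_eqb => + ->.
  case: (s u'); case: (t u); case: (t u'); case: (s0 u); case: (s0 u') => //.
- have al r : r \in S -> r u = r u'.
    by move=> rS; have := nN r; rewrite rS /= negbK => /eqP.
  rewrite (al _ s0S) subr0; have -> : [set s in S | s u != s0 u'] = [set s in S | s u' != s0 u'].
    by apply/setP => r; rewrite !inE; case: (boolP (r \in S)) => //= /al ->.
  by rewrite eqxx mulr1; case: (s0 u'); rewrite ?mulrNN ?mulr1.
- have al r : r \in S -> r u = ~~ r u'.
    by move=> rS; have := nE r; rewrite rS /=; case: (r u); case: (r u').
  rewrite (al _ s0S) sub0r; have -> : [set s in S | s u != ~~ s0 u'] = [set s in S | s u' != s0 u'].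
    apply/setP => r; rewrite !inE; case: (boolP (r \in S)) => //= /al ->.
    by case: (r u'); case: (s0 u').
  by rewrite eqxx mulr1; case: (s0 u'); rewrite ?mulr1 ?mul1r.
- by have := nE s0; have := nN s0; rewrite s0S /= negbK => ->.
Qed.

(** By [sgn_pairE] the form is a sum of squares, one for each class of variables at which the same
    solutions differ from [s0]. *)
Lemma sgn_pair_quad S (A : {set V}) (w : V -> R) :
  0 <= \sum_(u in A) \sum_(u' in A) w u * w u' * sgn_pair S u u'.
Proof.
have [->|[s0 s0S]] := set_0Vmem S.
  rewrite !big1 // => u _; rewrite big1 // => u' _.
  rewrite /sgn_pair; have -> : [exists s in (set0 : {set asg}), s u == s u'] = false :> bool.
    by apply/existsP => -[s]; rewrite inE.
  have -> : [exists s in (set0 : {set asg}), s u != s u'] = false :> bool.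
    by apply/existsP => -[s]; rewrite inE.
  by rewrite subrr mulr0.
pose a u := [set s in S | s u != s0 u].
pose g u : R := w u * (if s0 u then 1 else -1).
have -> : \sum_(u in A) \sum_(u' in A) w u * w u' * sgn_pair S u u'
  = \sum_(b : {set asg}) (\sum_(u in A) g u * (a u == b)%:R) ^+ 2.
  transitivity (\sum_(b : {set asg}) \sum_(u in A) \sum_(u' in A)
      g u * (a u == b)%:R * (g u' * (a u' == b)%:R)); last first.
    apply: eq_bigr => b _; rewrite expr2 mulr_suml; apply: eq_bigr => u _.
    by rewrite mulr_sumr.
  rewrite [RHS]exchange_big /=; apply: eq_bigr => u _; rewrite [RHS]exchange_big /=.
  apply: eq_bigr => u' _; rewrite (bigD1 (a u)) //= eqxx big1 ?addr0 => [|b].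
    rewrite mulr1 (sgn_pairE _ _ s0S) -/(a u) -/(a u') [a u' == _]eq_sym /g.
    set x := (a u == a u'). ring.
  by rewrite eq_sym => /negbTE ->; rewrite mulr0 mul0r.
by apply: sumr_ge0 => b _; exact: sqr_ge0.
Qed.

Definition tied S u := [exists u', (u' != u) && (sgn_pair S u u' != 0)].

(** If an assignment satisfies the formula without the literals on [u], then [u] can be set freely,
    so both relations between [u] and [u'] occur among the solutions and the kernel vanishes. *)
Lemma tied_ignore F u : tied (solF F) u ->
  (solF F != set0) && (sol (fun=> Some [set u]) F == set0).
Proof.
case/existsP => u' /andP [u'u nz]; apply/andP; split.
  apply: contraNneq nz => e; rewrite /sgn_pair e.
  have -> : [exists s in (set0 : {set asg}), s u == s u'] = false :> bool.
    by apply/existsP => -[s]; rewrite inE.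
  have -> : [exists s in (set0 : {set asg}), s u != s u'] = false :> bool.
    by apply/existsP => -[s]; rewrite inE.
  by rewrite subrr.
apply: contraNT nz => /set0Pn [s sS].
have inS b : [ffun x => if x == u then b else s x] \in solF F.
  rewrite inE; apply/forallP => i; move: sS; rewrite inE => /forallP /(_ i) /existsP [j].
  rewrite inE => /andP [nu sj]; apply/existsP; exists j.
  by rewrite inE /= ffunE (negbTE nu).
rewrite /sgn_pair.
have -> : [exists s in solF F, s u == s u'] = true.
  apply/existsP; exists [ffun x => if x == u then s u' else s x].
  by rewrite inS !ffunE eqxx (negbTE u'u) eqxx.
have -> : [exists s in solF F, s u != s u'] = true.
  apply/existsP; exists [ffun x => if x == u then ~~ s u' else s x].
  by rewrite inS !ffunE eqxx (negbTE u'u); case: (s u').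
by rewrite subrr.
Qed.

Lemma wdeg_ge0 u c : 0 <= wdeg u c.
Proof. by rewrite /wdeg; case: touched; rewrite ?invr_ge0. Qed.

Lemma wdeg_le1 u c : wdeg u c <= 1.
Proof. by rewrite /wdeg; case: touched => //; lra. Qed.

Lemma wdegF_ge0 u F : 0 <= wdegF u F.
Proof. by apply: prodr_ge0 => i _; exact: wdeg_ge0. Qed.

Lemma wdegF_le1 u F : wdegF u F <= 1.
Proof. by apply: prodr_ile1 => i _; rewrite wdeg_ge0 wdeg_le1. Qed.

(** [2 ^- d * d <= 1]: the weight offsets the number of clauses through which [u] meets other
    variables. *)
Lemma wdegF_deg u F : wdegF u F * (\sum_i (touched (F i) u : nat))%:R <= 1.
Proof.
have -> : wdegF u F = 2 ^- (\sum_i (touched (F i) u : nat)).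
  rewrite -exprVn -prodrXr; apply: eq_bigr => i _; rewrite /wdeg.
  by case: touched.
set d := (\sum_i _)%N; rewrite mulrC ler_pdivrMr ?exprn_gt0 // mul1r.
by rewrite -natrX ler_nat ltnW // ltn_expl.
Qed.

Lemma card_touched c : (\sum_u (touched c u : nat) <= k)%N.
Proof.
rewrite -[X in (_ <= X)%N]card_ord -sum1_card.
apply: (@leq_trans (\sum_(j < k) \sum_u (((c j).1 == u) : nat))).
  rewrite exchange_big /=; apply: leq_sum => u _.
  case: (boolP (touched c u)) => //= /existsP [j ju].
  by rewrite (bigD1 j) //= ju.
apply: leq_sum => j _; rewrite (bigD1 (c j).1) //= eqxx big1 // => u.
by rewrite eq_sym => /negbTE ->.
Qed.

(* For nonempty S, [sgn_pair S] is positive semidefinite: fixing s0 in S, it is, up to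
   the signs s0 u, the kernel of the equivalence "every s in S differs from s0 at
   u iff it does at u'". The loss is due to the diagonal and to pairs sharing a clause. *)
Lemma sum_pairs_ge F (A : {set V}) :
  - (k.+1%:R * (\sum_(u in A) (tied (solF F) u : nat))%:R) <=
  \sum_(u in A) \sum_(u' in A | u' != u)
     wdegF u F * wdegF u' F * (apart u u' F)%:R * sgn_pair (solF F) u u' :> R.
Proof.
set S := solF F; pose B := [set u in A | tied S u].
have cB : (\sum_(u in A) (tied S u : nat) = #|B|)%N.
  rewrite -sum1_card [RHS]big_mkcond [LHS]big_mkcond /=.
  by apply: eq_bigr => u _; rewrite !inE; case: (u \in A) => //=; case: tied.
have sg1 u u' : `|sgn_pair S u u'| <= 1.
  rewrite /sgn_pair; case: [exists s in S, s u == s u']; case: [exists s in S, s u != s u'];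
    by rewrite ?subrr ?subr0 ?sub0r ?normr0 ?normrN ?normr1.
have restr (h : V -> V -> R) : \sum_(u in A) \sum_(u' in A | u' != u) h u u' * sgn_pair S u u'
   = \sum_(u in B) \sum_(u' in B | u' != u) h u u' * sgn_pair S u u'.
  have nt u u' : ~~ tied S u -> u' != u -> sgn_pair S u u' = 0.
    by move=> /existsPn /(_ u'); rewrite negb_and => /orP [/negP //|/negPn /eqP].
  rewrite (bigID (tied S)) /= addrC big1 ?add0r => [|u /andP [_ nu]]; last first.
    by apply: big1 => u' /andP [_ /(nt _ _ nu) ->]; rewrite mulr0.
  rewrite (eq_bigl (mem B)) => [|u]; last by rewrite !inE.
  apply: eq_bigr => u _; rewrite (bigID (tied S)) /= addrC big1 ?add0r => [|u']; last first.
    by move=> /andP [/andP [_ u'u] nu']; rewrite sgn_pairC nt ?mulr0 // eq_sym.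
  by apply: eq_bigl => u'; rewrite !inE andbAC.
rewrite cB (restr (fun u u' => wdegF u F * wdegF u' F * (apart u u' F)%:R)).
have quad := sgn_pair_quad S B (fun u => wdegF u F).
(* The diagonal costs at most 1 per tied variable. *)
have diag : \sum_(u in B) \sum_(u' in B) wdegF u F * wdegF u' F * sgn_pair S u u'
   <= \sum_(u in B) (1 + \sum_(u' in B | u' != u) wdegF u F * wdegF u' F * sgn_pair S u u').
  apply: ler_sum => u uB; rewrite (bigD1 u) //= lerD2r.
  apply: (@le_trans _ _ (wdegF u F * wdegF u F * 1)).
    rewrite ler_wpM2l ?mulr_ge0 ?wdegF_ge0 //.
    exact: le_trans (ler_norm _) (sg1 u u).
  by rewrite mulr1 mulr_ile1 ?wdegF_ge0 ?wdegF_le1.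
(* At most [k] times the degree of [u] variables share a clause with it; by [wdegF_deg] this costs
   at most [k] per tied variable. *)
have bad : \sum_(u in B) \sum_(u' in B | u' != u) wdegF u F * wdegF u' F * sgn_pair S u u'
   <= \sum_(u in B) (k%:R + \sum_(u' in B | u' != u)
        wdegF u F * wdegF u' F * (apart u u' F)%:R * sgn_pair S u u').
  apply: ler_sum => u uB.
  apply: (@le_trans _ _ (\sum_(u' in B | u' != u) (wdegF u F * (~~ apart u u' F)%:R +
       wdegF u F * wdegF u' F * (apart u u' F)%:R * sgn_pair S u u'))).
    apply: ler_sum => u' _; case: apart; rewrite ?mulr0 ?add0r ?mulr1 // !mul0r addr0.
    rewrite -mulrA -[leRHS]mulr1 mulr1 -[leRHS](mulr1 (wdegF u F)) ler_wpM2l ?wdegF_ge0 //.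
    apply: le_trans (ler_norm _) _; rewrite normrM mulr_ile1 ?normr_ge0 ?sg1 //.
    by rewrite ger0_norm ?wdegF_ge0 ?wdegF_le1.
  rewrite big_split /= lerD2r -mulr_sumr.
  have cnt : (\sum_(u' in B | u' != u) (~~ apart u u' F : nat) <=
       k * \sum_i (touched (F i) u : nat))%N.
    apply: (@leq_trans (\sum_u' \sum_i (touched (F i) u && touched (F i) u'))).
      rewrite big_mkcond /=; apply: leq_sum => u' _; case: ifP => // _.
      case: (boolP (apart u u' F)) => //= /forallPn [i].
      by rewrite negbK => e; rewrite (bigD1 i) //= e.
    rewrite exchange_big big_distrr /=; apply: leq_sum => i _.
    case: touched; last by rewrite muln0 big1.
    by rewrite muln1; exact: card_touched.
  rewrite -natr_sum.
  apply: (@le_trans _ _ (k%:R * (wdegF u F * (\sum_i (touched (F i) u : nat))%:R))).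
    by rewrite mulrCA ler_wpM2l ?wdegF_ge0 // -natrM ler_nat.
  by rewrite -[leRHS]mulr1 ler_wpM2l ?ler0n ?wdegF_deg.
rewrite big_split /= sumr_const -[_ *+ #|_|]mulr_natr in bad.
rewrite big_split /= sumr_const -[_ *+ #|_|]mulr_natr in diag.
rewrite -natr1 mulrDl; lra.
Qed.

End Pairs.

(** * Exchangeable variables *)

Section Relabel.
Variables (R : realFieldType) (k : nat) (V I : finType) (f : V -> R).
Local Notation vclause := {ffun 'I_k -> V * bool}.
Local Notation asg := {ffun V -> bool}.
Implicit Types (c : vclause) (F : {ffun I -> vclause}).

Definition pair_corr u u' : R := pexp (law (fun=> f)) (fun F : {ffun I -> vclause} =>
  wdegF R u F * wdegF R u' F * (apart u u' F)%:R * sgn_pair R (solF F) u u').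

Definition relabel (s : {perm V}) c : vclause := [ffun j => (s (c j).1, (c j).2)].

Lemma wt_relabel (s : {perm V}) c : (forall x, f (s x) = f x) -> wt f (relabel s c) = wt f c.
Proof.
move=> fs; rewrite /wt; congr (_ / _ * (_ * (_ + _))).
- congr (_%:R); congr nat_of_bool; apply/injectiveP/injectiveP => h i j; rewrite !ffunE => e.
    by apply: h; rewrite !ffunE e.
  by apply: h; rewrite !ffunE; apply: (@perm_inj _ s).
- by apply: eq_bigr => j _; rewrite ffunE fs.
- by apply: eq_bigr => j _; rewrite ffunE fs.
Qed.

Lemma pair_corr_perm (s : {perm V}) u u' : (forall x, f (s x) = f x) ->
  pair_corr (s u) (s u') = pair_corr u u'.
Proof.
move=> fs; rewrite /pair_corr.
rewrite (@pexp_push _ _ _ _ (relabel s) (law (fun=> f)) (law (fun=> f))); last first.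
  move=> i c; pose c0 := relabel (s^-1)%g c.
  have c0E : relabel s c0 = c.
    by apply/ffunP => j; rewrite !ffunE /= permKV; case: (c j).
  rewrite (big_pred1 c0) => [|c'].
    by rewrite /law -{1}c0E wt_relabel.
  apply/eqP/eqP => [e|->//]; rewrite /c0 -e.
  by apply/ffunP => j; rewrite !ffunE /= permK; case: (c' j).
apply: eq_pexp => // F; set F' := [ffun i => _].
have tE x i : touched (F' i) (s x) = touched (F i) x.
  by apply: eq_existsb => j; rewrite !ffunE /= (inj_eq perm_inj).
have wE x : wdegF R (s x) F' = wdegF R x F.
  by apply: eq_bigr => i _; rewrite /wdeg tE.
have solE (t : asg) : (t \in solF F') = ([ffun x => t (s x)] \in solF F).
  rewrite !inE; apply: eq_forallb => i; rewrite /= /csat; apply: eq_existsb => j.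
  by rewrite !inE !ffunE.
rewrite !wE; have -> : apart (s u) (s u') F' = apart u u' F.
  by apply: eq_forallb => i; rewrite !tE.
congr (_ * _); rewrite /sgn_pair.
pose unr (t : asg) : asg := [ffun x => t ((s^-1)%g x)].
have solU t : (unr t \in solF F') = (t \in solF F).
  rewrite solE; have -> // : [ffun x => unr t (s x)] = t.
  by apply/ffunP => x; rewrite !ffunE permK.
congr (_%:R - _%:R); congr nat_of_bool; apply/existsP/existsP => -[t /andP [tS e]].
- by exists [ffun x => t (s x)]; rewrite -solE tS !ffunE.
- by exists (unr t); rewrite solU tS !ffunE !permK.
- by exists [ffun x => t (s x)]; rewrite -solE tS !ffunE.
- by exists (unr t); rewrite solU tS !ffunE !permK.
Qed.

Variables (A : {set V}).
Hypothesis fA : {in A &, forall u u', f u = f u'}.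

Lemma tperm_f a b : a \in A -> b \in A -> forall x, f (tperm a b x) = f x.
Proof. by move=> aA bA x; case: tpermP => [->|->|//]; exact: fA. Qed.

(** Two transpositions within [A], which preserve [f], carry ([u0], [u1]) to ([u], [u']). *)
Lemma pair_corr_eq u0 u1 u u' : u0 \in A -> u1 \in A -> u \in A -> u' \in A ->
  u0 != u1 -> u != u' -> pair_corr u u' = pair_corr u0 u1.
Proof.
move=> u0A u1A uA u'A ne ne'.
rewrite -(pair_corr_perm u0 u1 (tperm_f u0A uA)) tpermL.
set w := tperm u0 u u1.
have wA : w \in A by rewrite /w; case: tpermP.
have wu : w != u by rewrite /w -(inj_eq (@perm_inj _ (tperm u0 u))) tpermK tpermR eq_sym.
rewrite -(pair_corr_perm u w (tperm_f wA u'A)) tpermL tpermD // eq_sym //.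
Qed.

Hypothesis f01 : forall v, 0 <= f v <= 1.
Hypothesis le_kn : (k <= #|V|)%N.

Lemma pexp_tied u : pexp (law (fun=> f)) (fun F : {ffun I -> vclause} => (tied R (solF F) u)%:R)
  <= psat k (fun _ : I => f) (fun=> Some set0) - psat k (fun _ : I => f) (fun=> Some [set u]).
Proof.
rewrite /psat -pexpB; apply: ler_pexp => [i c|F _]; first exact: wt_ge0.
have sub : sol (fun=> Some [set u]) F \subset solF F.
  apply/subsetP => s; rewrite !inE => /forallP h; apply/forallP => i.
  have /existsP [j] := h i; rewrite inE => /andP [_ e].
  by apply/existsP; exists j; rewrite inE.
case: (boolP (tied _ _ _)) => [/tied_ignore /andP [-> /eqP ->]|_].
  by rewrite eqxx subr0.
rewrite subr_ge0 ler_nat; case: (boolP (sol _ F != set0)) => // /set0Pn [s sS].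
suff -> : sol (fun=> Some set0) F != set0 by [].
by apply/set0Pn; exists s; exact: (subsetP sub).
Qed.

(** All ordered pairs of distinct variables in [A] have the same correlation, and by [sum_pairs_ge]
    their sum is at least [- (k.+1 * #|A| * beta)], as each variable is tied with probability at
    most [beta]. *)
Lemma pair_corr_ge u0 u1 beta : u0 \in A -> u1 \in A -> u0 != u1 ->
  (forall u, psat k (fun _ : I => f) (fun=> Some set0)
             - psat k (fun _ : I => f) (fun=> Some [set u]) <= beta) ->
  - (k.+1%:R * beta) <= pair_corr u0 u1 * (#|A|%:R - 1).
Proof.
move=> u0A u1A ne hb.
have A0 : (0 < #|A|)%N by apply/card_gt0P; exists u0.
rewrite -(ler_pM2l (_ : 0 < #|A|%:R)) ?ltr0n //.
have -> : #|A|%:R * (pair_corr u0 u1 * (#|A|%:R - 1))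
  = \sum_(u in A) \sum_(u' in A | u' != u) pair_corr u u'.
  transitivity (\sum_(u in A) (pair_corr u0 u1 * (#|A|%:R - 1))).
    by rewrite sumr_const mulr_natl.
  apply: eq_bigr => u uA.
  rewrite (eq_bigr (fun=> pair_corr u0 u1)) => [|u' /andP [u'A u'u]]; last first.
    by apply: pair_corr_eq => //; rewrite eq_sym.
  rewrite sumr_const -[RHS]mulr_natr; congr (_ * _).
  rewrite (cardsD1 u A) uA natrD addrAC subrr add0r; congr (_%:R).
  by apply: eq_card => u'; rewrite !inE andbC.
apply: (@le_trans _ _ (- (k.+1%:R * \sum_(u in A) pexp (law (fun=> f))
    (fun F : {ffun I -> vclause} => (tied R (solF F) u)%:R)))).
  rewrite mulrN lerN2 mulrCA ler_wpM2l ?ler0n // mulr_natl -sumr_const.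
  by apply: ler_sum => u _; exact: le_trans (pexp_tied u) (hb u).
rewrite -pexp_sum -pexpZ.
have -> : \sum_(u in A) \sum_(u' in A | u' != u) pair_corr u u'
  = pexp (law (fun=> f)) (fun F : {ffun I -> vclause} => \sum_(u in A)
     \sum_(u' in A | u' != u) wdegF R u F * wdegF R u' F * (apart u u' F)%:R
        * sgn_pair R (solF F) u u').
  by rewrite pexp_sum; apply: eq_bigr => u _; rewrite pexp_sum.
rewrite -mulN1r -pexpZ; apply: ler_pexp => [i c|F _]; first exact: wt_ge0.
by rewrite mulN1r -natr_sum; exact: sum_pairs_ge.
Qed.

End Relabel.

(** * Splitting a variable into two copies *)

Section Split.
Variables (R : realFieldType) (k : nat) (V I : finType) (v : V) (p : R).
Variable g : option V -> R.
Hypotheses (gN : g None = p) (gv : g (Some v) = p).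
Hypothesis le_kn : (k <= #|V|)%N.
Local Notation vclause := {ffun 'I_k -> V * bool}.
Local Notation sclause := {ffun 'I_k -> option V * bool}.

(* Identifies the two copies [Some v] and [None] of v, with the same sign if
   [e = false] and with opposite signs if [e = true]. *)
Definition glue_lit (e : bool) (x : option V * bool) : V * bool :=
  if x.1 is Some y then (y, x.2) else (v, x.2 (+) e).

Definition glue e (c : sclause) : vclause := [ffun j => glue_lit e (c j)].

(* Gluing with opposite signs turns a slot of law p, whose copy is drawn by a
   fair coin, into a slot with a uniform sign. *)
Definition glued (e : bool) (y : V) : R := if (y == v) && e then 2^-1 else g (Some y).

Let half (x : option V) : R := if (x == Some v) || (x == None) then 2^-1 else 1.

(** Law of a clause whose slots on [v] have been split: the tuple is drawn from [V], so distinctness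
    is required after gluing, and [half] is the coin. *)
Let wsplit (c : sclause) : R :=
  (injectiveb (cvars (glue false c)))%:R / (#|V| ^_ k)%:R
  * (2^-1 * (\prod_j (half (c j).1 * bern (g (c j).1) (c j).2)
           + \prod_j (half (c j).1 * bern (g (c j).1) (~~ (c j).2)))).

Lemma cvars_glue e c : cvars (glue e c) = cvars (glue false c).
Proof. by apply/ffunP => j; rewrite !ffunE /glue_lit; case: (c j) => [[]]. Qed.

(** [h] will be the identity for B = 1 and the negation for B = -1. With opposite signs, the two
    preimages of a literal on [v] have weights p / 2 and (1 - p) / 2 in some order, which add up to
    1/2. *)
Let fiber e (y : V) (b : bool) (h : bool -> bool) : (forall b', h (b (+) b') = h b (+) b') ->
  \sum_(x | glue_lit e x == (y, b)) half x.1 * bern (g x.1) (h x.2) = bern (glued e y) (h b).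
Proof.
move=> hb; rewrite (bigD1 (Some y, b)) //= /half /glued.
have [->|yv] := eqVneq y v; last first.
  rewrite (inj_eq (@Some_inj _)) (negbTE yv) mul1r big1 ?addr0 // => -[[z|] b'] /andP [].
    by rewrite /glue_lit /= => /eqP [-> ->]; rewrite eqxx.
  by rewrite /glue_lit /= => /eqP [e']; rewrite e' eqxx in yv.
rewrite (bigD1 (None, b (+) e)) /=; last by rewrite /glue_lit /= addbK eqxx.
rewrite big1 ?addr0 => [|[[z|] b'] /andP [/andP [] + + +]]; last first.
- rewrite /glue_lit /= => /eqP [e1] _; rewrite -e1 addbK eqxx //.
- by rewrite /glue_lit /= => /eqP [-> ->]; rewrite eqxx.
rewrite !eqxx /= gv gN hb; case: e; rewrite /= ?addbT ?addbF ?gv.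
  by case: (h b) => /=; field.
by case: (h b) => /=; field.
Qed.

Lemma wt_glue e c : wt (glued e) c = \sum_(c' | glue e c' == c) wsplit c'.
Proof.
rewrite (eq_bigr (fun c' : sclause => (injectiveb (cvars c))%:R / (#|V| ^_ k)%:R
  * (2^-1 * (\prod_j (half (c' j).1 * bern (g (c' j).1) (c' j).2)
           + \prod_j (half (c' j).1 * bern (g (c' j).1) (~~ (c' j).2)))))); last first.
  by move=> c' /eqP <-; rewrite /wsplit (cvars_glue e).
rewrite -mulr_sumr /wt; congr (_ * _); rewrite -mulr_sumr big_split /=; congr (_ * _).
have fam (G : 'I_k -> option V * bool -> R) : \sum_(c' | glue e c' == c) \prod_j G j (c' j)
    = \prod_j \sum_(x | glue_lit e x == c j) G j x.
  rewrite bigA_distr_big_dep; apply: eq_bigl => c'; apply/eqP/familyP => [<- j|h].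
    by rewrite ffunE; exact: eqxx.
  by apply/ffunP => j; rewrite ffunE; apply/eqP/h.
rewrite (fam (fun j x => half x.1 * bern (g x.1) x.2)).
rewrite (fam (fun j x => half x.1 * bern (g x.1) (~~ x.2))).
congr (_ + _); apply: eq_bigr => j _; case: (c j) => y b /=.
  by rewrite (fiber _ _ (h := id)).
by rewrite (fiber _ _ (h := negb)) // => b'; rewrite addNb.
Qed.

Local Notation W := (option V : finType).

(** Density with respect to the ordinary clause law over [option V]: distinctness after gluing means
    distinctness and not both copies, so at most one coin is tossed. *)
Lemma wsplitE c : wsplit c = (#|W| ^_ k)%:R / (#|V| ^_ k)%:R *
  (wdeg R (Some v) c * wdeg R None c * (~~ (touched c (Some v) && touched c None))%:R) * wt g c.
Proof.
have lkW : (k <= #|W|)%N by rewrite card_option ltnW.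
have fW := @ffact_neq0 R k W lkW.
have injG : injectiveb (cvars (glue false c)) =
    injectiveb (cvars c) && ~~ (touched c (Some v) && touched c None).
  apply/injectiveP/andP => [h|[/injectiveP ic nb] i j].
    split; first apply/injectiveP => i j e.
      by apply: h; move: e; rewrite !ffunE /glue_lit => ->; case: (c j).1.
    apply/negP => /andP [/existsP [i /eqP ei] /existsP [j /eqP ej]].
    have : i = j by apply: h; rewrite !ffunE /glue_lit ei ej.
    by move=> eij; rewrite eij ej in ei.
  rewrite !ffunE /glue_lit => e; apply: ic; rewrite !ffunE.
  case ei: (c i).1 e => [x|]; case ej: (c j).1 => [y|] //= e; first by rewrite e.
    case/negP: nb; apply/andP; split; apply/existsP.
      by exists i; rewrite ei e.
    by exists j; rewrite ej.
  case/negP: nb; apply/andP; split; apply/existsP.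
    by exists j; rewrite ej e.
  by exists i; rewrite ei.
have [injc|ninj] := boolP (injectiveb (cvars c)); last first.
  by rewrite /wsplit /wt injG (negbTE ninj) !mul0r mulr0.
have [nb|both] := boolP (~~ (touched c (Some v) && touched c None)); last first.
  by rewrite /wsplit injG injc (negbTE both) !(mulr0, mul0r).
have prodh : \prod_j half (c j).1 = wdeg R (Some v) c * wdeg R None c.
  have atone x j : (c j).1 = x -> (x == Some v) || (x == None) ->
      \prod_j half (c j).1 = 2^-1 :> R.
    move=> cj xs; rewrite (bigD1 j) //= {1}/half cj xs big1 ?mulr1 // => i ij.
    rewrite /half; case: ifP => // ci.
    have ne : (c i).1 != (c j).1.
      by have := ij; rewrite -(inj_eq (injectiveP _ injc)) !ffunE.
    case/negP: nb; move: ci ne; rewrite cj.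
    case/orP: xs => /eqP xs; rewrite xs => /orP [/eqP ci|/eqP ci]; rewrite ci ?eqxx // => _.
      by apply/andP; split; apply/existsP; [exists j; rewrite cj xs|exists i; rewrite ci].
    by apply/andP; split; apply/existsP; [exists i; rewrite ci|exists j; rewrite cj xs].
  rewrite /wdeg; case: (boolP (touched c (Some v))) => [/existsP [j /eqP cj]|nv].
    rewrite (atone _ _ cj) ?eqxx //; case: (boolP (touched c None)) => [tN|]; last by rewrite mulr1.
    by case/negP: nb; rewrite tN andbT; apply/existsP; exists j; rewrite cj.
  case: (boolP (touched c None)) => [/existsP [j /eqP cj]|nN].
    by rewrite (atone _ _ cj) ?eqxx ?orbT // mul1r.
  rewrite mulr1 big1 // => j _; rewrite /half.
  move/existsPn: nv => /(_ j) /negbTE ->; by move/existsPn: nN => /(_ j) /negbTE ->.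
rewrite /wsplit /wt injG injc nb 2!big_split /= -mulrDr prodh.
have fV := @ffact_neq0 R k V le_kn.
by field; rewrite fV fW.
Qed.

Lemma csat_glue e c (s : {ffun V -> bool}) (s' : {ffun option V -> bool}) :
  (forall y, s' (Some y) = s y) -> s' None = s v (+) e ->
  csat set0 (glue e c) s = csat set0 c s'.
Proof.
move=> sS sN; apply: eq_existsb => j; rewrite !inE ffunE /glue_lit.
case: (c j) => [[y|] b] /=; first by rewrite sS.
by rewrite {}sN; case: (s v); case: b; case: e.
Qed.

Lemma sol_glue e (F : {ffun I -> sclause}) :
  (solF [ffun i => glue e (F i)] != set0)
  = [exists s in solF F, (s (Some v) != s None) == e].
Proof.
apply/set0Pn/existsP => [[s sS]|[s /andP [sS /eqP es]]].
  pose s' : {ffun option V -> bool} := [ffun x => if x is Some y then s y else s v (+) e].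
  exists s'; rewrite !ffunE; apply/andP; split; last by case: e {sS s'}; case: (s v).
  move: sS; rewrite !inE => /forallP h; apply/forallP => i.
  have := h i; rewrite /= ffunE (@csat_glue e _ s s') // => [y|]; by rewrite ffunE.
exists [ffun y => s (Some y)].
move: sS; rewrite !inE => /forallP h; apply/forallP => i.
rewrite /= ffunE (_ : csat _ _ _ = csat set0 (F i) s); first exact: h.
apply: csat_glue => [y|]; rewrite ffunE //.
by rewrite -es; case: (s (Some v)); case: (s None).
Qed.

(** One split formula underlies both gluings, so the difference of the indicators is [sgn_pair]; the
    density of [wsplitE] supplies the other factors. *)
Lemma psat_glue_diff :
  psat k (fun _ : I => glued false) (fun=> Some set0)
    - psat k (fun _ : I => glued true) (fun=> Some set0)
  = ((#|W| ^_ k)%:R / (#|V| ^_ k)%:R) ^+ #|I| * pair_corr k I g (Some v) None.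
Proof.
have pg e : psat k (fun _ : I => glued e) (fun=> Some set0)
   = pexp (fun _ : I => wsplit) (fun F => ([exists s in solF F, (s (Some v) != s None) == e])%:R).
  rewrite /psat (@pexp_push _ _ _ _ (glue e) _ (fun=> wsplit)); last first.
    by move=> i c; exact: wt_glue.
  by apply: eq_pexp => // F; rewrite sol_glue.
rewrite !pg -pexpB /pair_corr -pexpZ; apply: eq_bigr => F _.
have cst (a : R) : \prod_(i : I) a = a ^+ #|I| by rewrite prodr_const.
rewrite (eq_bigr _ (fun i _ => wsplitE (F i))) 2!big_split /= cst 2!big_split /=.
have -> : \prod_i (~~ (touched (F i) (Some v) && touched (F i) None))%:R
   = (apart (Some v) None F)%:R :> R.
  case: (boolP (apart _ _ _)) => [/forallP h|/forallPn [i]].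
    by rewrite big1 // => i _; rewrite h.
  by rewrite negbK => e; rewrite (bigD1 i) //= e mul0r.
have -> : sgn_pair R (solF F) (Some v) None =
   ([exists s in solF F, (s (Some v) != s None) == false])%:R
   - ([exists s in solF F, (s (Some v) != s None) == true])%:R.
  rewrite /sgn_pair; congr (_%:R - _%:R); congr nat_of_bool; apply: eq_existsb => s.
    by rewrite eqbF_neg negbK.
  by rewrite eqb_id.
rewrite /wdegF /law; set w := \prod_i wt g (F i); ring.
Qed.

End Split.

(** * One sign law for all variables: comparison with fair signs, first moment, Efron's
    inequality *)

Section Uniform.
Variables (R : realFieldType) (k n : nat).
Hypothesis le_kn : (k <= n)%N.
Local Notation V := 'I_n.

Definition usat (p : R) (m : nat) : R :=
  psat k (fun (_ : 'I_m) (_ : V) => p) (fun=> Some set0).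

Let le_kV : (k <= #|V|)%N. Proof. by rewrite card_ord. Qed.

(* At step v the v + 2 variables of law p, among them the two copies of v, are
   exchangeable; this gains the factor 1 / (v + 1) that sums up to [harm]. *)
Lemma usat_glue m (p beta : R) : 0 <= p <= 1 -> 0 <= beta ->
  (forall (g : option V -> R) u, (forall x, 0 <= g x <= 1) ->
     psat k (fun _ : 'I_m => g) (fun=> Some set0)
     - psat k (fun _ : 'I_m => g) (fun=> Some [set u]) <= beta) ->
  usat 2^-1 m - usat p m <=
    ((n.+1 ^_ k)%:R / (n ^_ k)%:R) ^+ m * (k.+1%:R * beta) * harm R n.
Proof.
move=> p01 beta0 hb.
pose h (r : nat) (y : V) : R := if (y < r)%N then p else 2^-1.
pose H r := psat k (fun _ : 'I_m => h r) (fun=> Some set0).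
have -> : usat 2^-1 m = H 0%N by apply: eq_psat.
have -> : usat p m = H n by apply: eq_psat => // i y; rewrite /h ltn_ord.
rewrite -opprB -(telescope_sumr H) // big_mkord -sumrN /harm mulr_sumr.
apply: ler_sum => v _.
pose g (x : option V) : R := if x is Some y then h v.+1 y else p.
have g01 x : 0 <= g x <= 1.
  by rewrite /g /h; case: x => [y|//]; case: ifP => // _; lra.
have gv : g (Some v) = p by rewrite /g /h ltnSn.
pose A : {set option V} := None |: (Some @: [set y : V | (y < v.+1)%N]).
have gA x : x \in A -> g x = p.
  by rewrite !inE => /orP [/eqP ->//|/imsetP [y]]; rewrite inE => yv ->; rewrite /g /h yv.
have cA : #|A| = v.+2.
  rewrite cardsU1 (card_imset _ (@Some_inj _)).
  have -> : None \notin Some @: [set y : V | (y < v.+1)%N].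
    by apply/imsetP => -[].
  have -> : #|[set y : V | (y < v.+1)%N]| = v.+1; last by [].
  by rewrite -sum1dep_card -(big_ord_widen n (fun=> 1%N)) // sum1_card card_ord.
have vA : Some v \in A.
  by rewrite !inE /=; apply/imsetP; exists v; rewrite ?inE.
have NA : None \in A by rewrite !inE eqxx.
have fA : {in A &, forall x y, g x = g y} by move=> x y /gA -> /gA ->.
have pc : - (k.+1%:R * beta) <= pair_corr k 'I_m g (Some v) None * v.+1%:R.
  have := pair_corr_ge fA g01 vA NA isT (fun u => hb g u g01).
  by rewrite cA -[v.+2%:R]natr1 addrK.
have {}pc : - (k.+1%:R * beta / v.+1%:R) <= pair_corr k 'I_m g (Some v) None.
  by rewrite -mulNr ler_pdivrMr ?ltr0n.
have := psat_glue_diff 'I_m (erefl : g None = p) gv le_kV.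
rewrite card_option !card_ord.
have -> : psat k (fun _ : 'I_m => glued v g false) (fun=> Some set0) = H v.+1.
  by apply: eq_psat => // i y; rewrite /glued andbF.
have -> : psat k (fun _ : 'I_m => glued v g true) (fun=> Some set0) = H v.
  apply: eq_psat => // i y; rewrite /glued andbT /g /h.
  have [->|yv] := eqVneq y v; first by rewrite ltnn.
  by rewrite ltnS leq_eqVlt (inj_eq val_inj) (negbTE yv).
move=> ->; rewrite lerNl -mulNr -mulrN -mulrA ler_wpM2l ?exprn_ge0 ?divr_ge0 //.
by rewrite mulNr.
Qed.

Lemma kill_half1 (s : {ffun V -> bool}) : kill k (fun=> 2^-1) set0 [set s] = 2 ^- k :> R.
Proof.
have s0 : [set s] != set0 by apply/set0Pn; exists s; rewrite inE.
rewrite killE //.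
have av v b : avoids [set s] v b = (s v != b).
  by apply/'forall_implyP/idP => [/(_ s (set11 s))//|h t /set1P ->].
rewrite -[RHS](@mean_inj_cst R k V le_kV); apply: eq_mean_inj => K _.
have half1 (h : bool -> bool) : involutive h -> \prod_j \sum_b bern 2^-1 (h b) *
    (avoids [set s] (K j) b)%:R = 2^-1 ^+ k :> R.
  move=> hh; transitivity (\prod_(j < k) (2^-1 : R)); last by rewrite prodr_const card_ord.
  apply: eq_bigr => j _.
  have bh b : bern 2^-1 b = 2^-1 :> R by case: b => /=; field.
  by rewrite big_bool /= !av !bh; case: (s _) => /=; field.
rewrite (half1 id) // (half1 negb) ?exprVn; last exact: negbK.
by field; rewrite expf_neq0 // pnatr_eq0.
Qed.

(** Union bound over the 2^n assignments. By [kill_half_le] for a single assignment, biased signs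
    violate it with probability at least 2^-k, up to the error of drawing without replacement. *)
Lemma usat_first_moment (p : R) m : 0 <= p <= 1 ->
  usat p m <= 2 ^+ n * (1 - 2 ^- k + k%:R ^+ 2 * n%:R * n%:R ^+ (k - 2) / (n ^_ k)%:R) ^+ m.
Proof.
move=> p01; set a := 1 - _ + _.
pose P (_ : V) := p; have P01 v : 0 <= P v <= 1 by [].
have sat1 (s : {ffun V -> bool}) :
    \sum_(c : {ffun 'I_k -> V * bool}) wt P c * (csat set0 c s)%:R = 1 - kill k P set0 [set s].
  have s0 : [set s] != set0 by apply/set0Pn; exists s; rewrite inE.
  rewrite -[1 in RHS](sum_wt1 le_kV P) /kill -sumrB; apply: eq_bigr => c _.
  rewrite s0 /= -[X in X - _]mulr1 -mulrBr; congr (_ * _).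
  have -> : [forall t in [set s], ~~ csat set0 c t] = ~~ csat set0 c s.
    by apply/'forall_implyP/idP => [/(_ s (set11 s))//|h t /set1P ->].
  by case: csat; rewrite ?subr0 ?subrr.
have kill1 (s : {ffun V -> bool}) : 0 <= 1 - kill k P set0 [set s] <= a.
  rewrite -sat1 sumr_ge0 => [/=|c _]; last by rewrite mulr_ge0 ?wt_ge0.
  have s0 : [set s] != set0 by apply/set0Pn; exists s; rewrite inE.
  have := kill_half_le k s0 P01; rewrite kill_half1 sat1 card_ord => h.
  have : k%:R ^+ 2 * #|frozen [set s]|%:R * n%:R ^+ (k - 2) / (n ^_ k)%:R
      <= k%:R ^+ 2 * n%:R * n%:R ^+ (k - 2) / (n ^_ k)%:R :> R.
    rewrite !ler_wpM2r ?invr_ge0 ?exprn_ge0 ?ler0n // ler_wpM2l ?exprn_ge0 ?ler0n //.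
    by rewrite ler_nat -[X in (_ <= X)%N]card_ord max_card.
  by move: h; rewrite /a; lra.
apply: (@le_trans _ _ (pexp (law (fun _ : 'I_m => P)) (fun F =>
    \sum_(s : {ffun V -> bool}) \prod_i (csat set0 (F i) s)%:R))).
  apply: ler_pexp => [i c|F _]; first exact: wt_ge0.
  have p0 (s : {ffun V -> bool}) : 0 <= \prod_i (csat set0 (F i) s)%:R :> R by apply: prodr_ge0.
  case: (boolP (_ != _)) => [/set0Pn [s]|_]; last exact: sumr_ge0.
  rewrite inE => /forallP h; rewrite (bigD1 s) //= [\prod_i _]big1 => [|i _].
    by rewrite lerDl sumr_ge0.
  by have /= -> := h i.
rewrite pexp_sum; apply: (@le_trans _ _ (\sum_(s : {ffun V -> bool}) a ^+ m)).
  apply: ler_sum => s _.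
  rewrite (pexp_prod (law (fun=> P)) (fun _ c => (csat set0 c s)%:R)).
  rewrite -[m in leRHS]card_ord -prodr_const; apply: ler_prod => i _.
  by rewrite /law sat1 kill1.
rewrite sumr_const -[leLHS]mulr_natl card_ffun card_bool card_ord natrX.
by rewrite lexx.
Qed.

(* Two independent formulas, turned into each other one clause at a time. *)
Lemma usat_variance m (p : R) : 0 <= p <= 1 -> usat p m * (1 - usat p m) <=
  \sum_i (psat k (fun (_ : 'I_m) (_ : V) => p) (setk (fun=> Some set0) i None) - usat p m).
Proof.
have bit_step (x y z : R) : x = 0 \/ x = 1 -> y = 0 \/ y = 1 -> x <= z -> y <= z ->
    x * (1 - y) <= z - y by move=> [] -> [] ->; lra.
have bit_tel (f x y z : R) : f = 0 \/ f = 1 -> x = 0 \/ x = 1 -> y = 0 \/ y = 1 ->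
    f * (1 - x) <= z -> f * (1 - y) <= z + x * (1 - y).
  by move=> [] -> [] -> [] ->; lra.
move=> p01; pose P (_ : V) := p; have P01 v : 0 <= P v <= 1 by [].
pose w := law (k := k) (fun _ : 'I_m => P).
have w0 i c : 0 <= w i c by exact: wt_ge0.
have w1 i : \sum_c w i c = 1 by exact: sum_wt1.
pose chi (F : {ffun 'I_m -> {ffun 'I_k -> V * bool}}) : R := (solF F != set0)%:R.
pose chi' i (F : {ffun 'I_m -> {ffun 'I_k -> V * bool}}) : R :=
  (sol (setk (fun=> Some set0) i None) F != set0)%:R.
have chi01 F : chi F = 0 \/ chi F = 1 by rewrite /chi; case: (_ != _); [right|left].
have chi_le i F : chi F <= chi' i F.
  rewrite /chi /chi' ler_nat; case: (boolP (solF F != set0)) => // /set0Pn [s sS].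
  suff -> : sol (setk (fun=> Some set0) i None) F != set0 by [].
  by apply/set0Pn; exists s; apply: (subsetP (sol_void_sub _ i F)).
pose M l (F G : {ffun 'I_m -> {ffun 'I_k -> V * bool}}) := mix (fun i : 'I_m => (i < l)%N) F G.
(* [M l] and [M l.+1] agree off clause [l], so both are dominated by the same [chi' l]; a drop from
   1 to 0 makes clause [l] of [M l.+1] decisive. *)
have Mstep (l : 'I_m) F G : chi (M l F G) * (1 - chi (M l.+1 F G))
    <= chi' l (M l.+1 F G) - chi (M l.+1 F G).
  have e : chi' l (M l F G) = chi' l (M l.+1 F G).
    rewrite /chi'; suff -> : sol (setk (fun=> Some set0) l None) (M l F G)
      = sol (setk (fun=> Some set0) l None) (M l.+1 F G) by [].
    apply/setP => s; rewrite !inE; apply: eq_forallb => i; rewrite /setk.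
    case: eqVneq => // il; rewrite !ffunE.
    by rewrite ltnS [in RHS]leq_eqVlt (inj_eq val_inj) (negbTE il).
  have := chi_le l (M l F G); rewrite e => le0; apply: bit_step => //; exact: chi_le.
have M0 F G : M 0%N F G = F by apply/ffunP => i; rewrite ffunE.
have Mm F G : M m F G = G by apply/ffunP => i; rewrite ffunE ltn_ord.
have tel F G l : chi F * (1 - chi (M l F G)) <=
    \sum_(i < l) chi (M i F G) * (1 - chi (M i.+1 F G)).
  elim: l => [|l IH]; last by rewrite big_ord_recr; exact: bit_tel.
  by rewrite big_ord0 M0; case: (chi01 F) => ->; rewrite ?mul0r ?subrr ?mulr0.
have -> : usat p m * (1 - usat p m) =
    pexp w (fun G => pexp w (fun F => chi F * (1 - chi G))).
  transitivity (pexp w (fun G => usat p m * (1 - chi G))).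
    by rewrite pexpZ pexpB pexp_cst.
  apply: eq_pexp => // G.
  transitivity (pexp w (fun F => (1 - chi G) * chi F)); first by rewrite pexpZ mulrC.
  by apply: eq_pexp => // F; rewrite mulrC.
have -> : \sum_i (psat k (fun (_ : 'I_m) (_ : V) => p) (setk (fun=> Some set0) i None) - usat p m)
    = \sum_(i < m) pexp w (fun G => pexp w (fun F => chi' i (M i.+1 F G) - chi (M i.+1 F G))).
  apply: eq_bigr => i _.
  by rewrite (@pexp_mix _ _ _ _ _ (fun F => chi' i F - chi F)) // pexpB.
rewrite -pexp_sum; apply: ler_pexp => // G _; rewrite -pexp_sum; apply: ler_pexp => // F _.
rewrite -[X in 1 - chi X](Mm F) ; apply: le_trans (tel F G m) _.
by apply: ler_sum => i _; exact: Mstep.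
Qed.

(** Symmetry brings clause [i] to the last place, where a void clause integrates out. *)
Lemma usat_drop (p : R) m (i : 'I_m.+1) :
  psat k (fun (_ : 'I_m.+1) (_ : V) => p) (setk (fun=> Some set0) i None) = usat p m.
Proof.
pose P (_ : V) := p.
rewrite -[LHS](psat_perm k (tperm i ord_max)) /=.
rewrite (@eq_psat _ _ _ _ _ (fun=> P) _ (setk (fun=> Some set0) ord_max None)) //; last first.
  by move=> j; rewrite /setk (canF_eq (tpermK i ord_max)) tpermL.
pose T := {ffun 'I_k -> V * bool}.
pose cons (x : {ffun 'I_m -> T} * T) : {ffun 'I_m.+1 -> T} :=
  [ffun j => if unlift ord_max j is Some j' then x.1 j' else x.2].
have consb : bijective cons.
  exists (fun F : {ffun 'I_m.+1 -> T} =>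
      ([ffun j : 'I_m => F (lift ord_max j)], F ord_max)).
    move=> [F c]; congr pair; rewrite ?ffunE ?unlift_none //.
    by apply/ffunP => j; rewrite !ffunE liftK.
  by move=> F; apply/ffunP => j; rewrite !ffunE; case: unliftP => [j' ->|->] //; rewrite ffunE.
rewrite /usat /psat /pexp (reindex cons) /=; last exact: onW_bij.
rewrite -(pair_bigA _ (fun F c => (\prod_(j < m.+1) law (fun=> P) j (cons (F, c) j)) *
   (sol (setk (fun=> Some set0) ord_max None) (cons (F, c)) != set0)%:R)) /=.
apply: eq_bigr => F _.
have solE c : sol (setk (fun=> Some set0) ord_max None) (cons (F, c))
    = sol (fun=> Some set0) F.
  apply/setP => s; rewrite !inE; apply/forallP/forallP => h j.
    have := h (lift ord_max j); rewrite /setk eq_sym (negbTE (neq_lift _ _)) ffunE liftK.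
    exact.
  rewrite /setk ffunE; case: unliftP => [j' ->|->]; last by rewrite eqxx.
  by rewrite eq_sym (negbTE (neq_lift _ _)); exact: h.
under eq_bigr do rewrite solE.
rewrite -mulr_suml; congr (_ * _).
transitivity ((\prod_(j < m) law (fun=> P) j (F j)) * \sum_(c : T) wt P c).
  rewrite mulr_sumr; apply: eq_bigr => c _.
  rewrite big_ord_recr /=; congr (_ * _); last by rewrite /law ffunE unlift_none.
  apply: eq_bigr => j _; rewrite /law ffunE.
  have -> : widen_ord (leqnSn m) j = lift ord_max j by apply: val_inj; rewrite [RHS]lift_max.
  by rewrite liftK.
by rewrite sum_wt1 ?mulr1.
Qed.

Lemma usat_le (p : R) m m' : 0 <= p <= 1 -> (m <= m')%N -> usat p m' <= usat p m.
Proof.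
move=> p01; elim: m' => [|m' IH]; first by rewrite leqn0 => /eqP ->.
rewrite leq_eqVlt => /orP [/eqP -> //|]; rewrite ltnS => /IH; apply: le_trans.
rewrite -(usat_drop p (@ord_max m')); exact: psat_void_ge.
Qed.

Lemma usat_decr (p : R) m : 0 <= p <= 1 ->
  usat p m.+1 * (1 - usat p m.+1) <= m.+1%:R * (usat p m - usat p m.+1).
Proof.
move=> p01; apply: le_trans (usat_variance _ p01) _.
rewrite (eq_bigr (fun=> usat p m - usat p m.+1)) => [|i _]; rewrite ?usat_drop //.
by rewrite sumr_const card_ord mulr_natl.
Qed.

End Uniform.

(** * Explicit rates for the replacement of clauses *)

Section Quantitative.
Variable (R : realType).

Lemma harm_ge0 m : 0 <= harm R m.
Proof. by apply: sumr_ge0 => j _; rewrite invr_ge0 ler0n. Qed.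

Lemma harm_le m m' : (m <= m')%N -> harm R m <= harm R m'.
Proof.
move=> mm'; rewrite /harm (big_ord_widen m' (fun j => j.+1%:R^-1 : R)) //.
rewrite [leLHS]big_mkcond; by apply: ler_sum => j _; case: ifP; rewrite ?invr_ge0.
Qed.

(* The harmonic sums grow slower than any root of n. *)
Lemma harm_pow J : exists2 C : R, 0 <= C & forall n, (harm R n + 1) ^+ J <= C * n.+1%:R.
Proof.
elim: J => [|J [C C0 IH]].
  by exists 1 => // n; rewrite expr0 mul1r ler1n.
exists (1 + 2 * J.+1%:R * C); first by rewrite addr_ge0 ?mulr_ge0.
elim=> [|n IHn]; first by rewrite /harm big_ord0 add0r expr1n mulr1 lerDl !mulr_ge0.
have hS : harm R n.+1 = harm R n + n.+1%:R^-1 by rewrite /harm big_ord_recr.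
have step (x y : R) N : 0 <= x -> x <= y -> y ^+ N.+1 - x ^+ N.+1 <= N.+1%:R * (y - x) * y ^+ N.
  move=> x0 xy; rewrite subrXX mulrC mulrAC ler_wpM2r ?subr_ge0 //.
  rewrite -[N.+1 in leRHS]card_ord mulr_natl -sumr_const; apply: ler_sum => i _.
  apply: (@le_trans _ _ (y ^+ (N - i) * y ^+ i)).
    by rewrite ler_wpM2l ?exprn_ge0 ?(le_trans x0) // lerXn2r ?nnegrE ?(le_trans x0).
  by rewrite -exprD subnK // -ltnS.
have := @step (harm R n + 1) (harm R n.+1 + 1) J.
have h0 := harm_ge0 n; have h1 := harm_le (leqnSn n).
have -> : harm R n.+1 + 1 - (harm R n + 1) = n.+1%:R^-1 by rewrite hS; ring.
have -> : 0 <= harm R n + 1 by lra.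
have -> : harm R n + 1 <= harm R n.+1 + 1 by lra.
move=> /(_ isT isT); rewrite lerBlDr => /le_trans; apply.
(* This product bounds the increment of the (J + 1)-st power; the linear bound on the J-th power
   makes it a constant. *)
have a : J.+1%:R / n.+1%:R * (harm R n.+1 + 1) ^+ J <= 2 * J.+1%:R * C.
  apply: (@le_trans _ _ (J.+1%:R / n.+1%:R * (C * n.+2%:R))).
    by rewrite ler_wpM2l ?divr_ge0.
  have -> : J.+1%:R / n.+1%:R * (C * n.+2%:R) = J.+1%:R * C * (n.+2%:R / n.+1%:R) by ring.
  have -> : 2 * J.+1%:R * C = J.+1%:R * C * 2 by ring.
  rewrite ler_wpM2l ?mulr_ge0 // ler_pdivrMr ?ltr0n // -natrM ler_nat; lia.
apply: le_trans (lerD a IHn) _.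
rewrite -[n.+2%:R]natr1 mulrDr mulr1 addrC lerD2l; lra.
Qed.

(** For [2 * k <= N], (1 - k/N)(1 + 2k/N) >= 1 gives 1 - k/N >= exp(-2k/N). So with m = O(n) clauses
    the probability of a private variable stays away from 0. *)
Lemma q1_pow_ge (k M m : nat) (V : finType) : (0 < k)%N -> (2 * k <= #|V|)%N ->
  (m <= M * #|V|)%N -> expR (- (2 * k * M)%:R) <= q1 R k V ^+ m.
Proof.
move=> k0 kN mM; set N := #|V| in kN mM *.
have N0 : 0 < N%:R :> R by rewrite ltr0n; lia.
have q : expR (- (2 * k%:R / N%:R)) <= q1 R k V.
  rewrite expRN -div1r ler_pdivrMr ?expR_gt0 // /q1 -/N.
  have e := expR_ge1Dx (2 * k%:R / N%:R : R).
  have qq : 0 <= (N%:R - k%:R) / N%:R :> R.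
    by rewrite divr_ge0 ?(ltW N0) // subr_ge0 ler_nat; lia.
  apply: le_trans (ler_wpM2l qq e).
  have -> : (N%:R - k%:R) / N%:R * (1 + 2 * k%:R / N%:R)
     = 1 + k%:R * (N%:R - 2 * k%:R) / N%:R ^+ 2 :> R by field; rewrite gt_eqF.
  rewrite lerDl divr_ge0 ?exprn_ge0 ?(ltW N0) // mulr_ge0 // subr_ge0 -natrM ler_nat //.
apply: le_trans (_ : expR (- (2 * k%:R / N%:R)) ^+ m <= _); last first.
  by rewrite lerXn2r ?nnegrE ?expR_ge0 // (le_trans _ q) ?expR_ge0.
rewrite -expRM_natl ler_expR mulrN lerN2.
have -> : m%:R * (2 * k%:R / N%:R) = (2 * k)%:R * (m%:R / N%:R) :> R.
  by rewrite natrM; ring.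
by rewrite [leRHS]natrM ler_wpM2l // ler_pdivrMr // -natrM ler_nat.
Qed.

Lemma hybrid_quant (k M : nat) : (0 < k)%N -> (0 < M)%N -> exists2 B : R, 0 <= B &
  forall (s m : nat) (V : finType) (fa fb : V -> R) (J : {set V}) (C : R),
  (2 * k <= #|V|)%N -> (0 < s)%N -> (2 * s <= #|V|)%N -> (m <= M * #|V|)%N -> 0 <= C ->
  (forall v, 0 <= fa v <= 1) -> (forall v, 0 <= fb v <= 1) -> (#|J| <= 1)%N ->
  (forall S : {set {ffun V -> bool}}, S != set0 ->
     kill k fb J S - kill k fa set0 S <= C * #|frozen S|%:R / #|V|%:R ^+ 2) ->
  psat k (fun _ : 'I_m => fa) (fun=> Some set0) - psat k (fun _ : 'I_m => fb) (fun=> Some J)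
  <= C * (M%:R * (2 / s%:R + 2 * k%:R / #|V|%:R)
          + B * s%:R ^+ k * harm R (M * #|V|) / Num.sqrt #|V|%:R).
Proof.
move=> k0 M0.
(* Three factors: for [m * t + t'] relative to sqrt N, for the inverse of [(1 - N^-1) * q1 ^+ m],
   and, together with [s ^+ k], for the inverse of [kap]. *)
exists ((2 * M + 2 * k * M ^ 2)%:R * (2 * expR (2 * k * M)%:R) * (2 ^+ k.+1 * 2 ^+ k)).
  by rewrite !mulr_ge0 ?exprn_ge0 ?expR_ge0.
move=> s m V fa fb J C kN s0 sN mM C0 fa01 fb01 J1 hd.
set N := #|V| in kN sN mM hd *.
have [a aE] : exists a, a = (M + 2 * k * M ^ 2)%N by eexists.
have a1 : (0 < a)%N by rewrite aE; lia.
have aM : (2 * M + 2 * k * M ^ 2)%N = (M + a)%N by rewrite aE; lia.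
have N2 : (1 < N)%N by lia.
have lkN : (k < N)%N by lia.
have kN' := ltnW lkN.
have Np : 0 < N%:R :> R by rewrite ltr0n; lia.
have sNp : 0 < Num.sqrt N%:R :> R by rewrite sqrtr_gt0.
have sNN : Num.sqrt N%:R ^+ 2 = N%:R :> R by rewrite sqr_sqrtr // ltW.
pose d := (N %/ s)%N.
have d0 : (0 < d)%N by rewrite divn_gt0 //; lia.
(* Rounding down in [d] costs at most a factor 2, as [d] is positive. *)
have dN : (N <= 2 * s * d)%N.
  by have := ltn_ceil N s0; rewrite -/d; nia.
have dsN : (d * s <= N)%N by rewrite leq_trunc_div.
pose eta : R := 2 * (d + k)%:R / N%:R.
pose kap : R := 2 ^- k.+1 * (d%:R / N%:R) ^+ k.
have kap0 : 0 < kap.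
  by rewrite mulr_gt0 ?invr_gt0 ?exprn_gt0 // divr_gt0 // ltr0n.
have eta0 : 0 <= eta by rewrite divr_ge0 ?mulr_ge0 // ltW.
have hl (S : {set {ffun V -> bool}}) : S != set0 -> eta * N%:R <= #|frozen S|%:R ->
    kap <= kill k fa set0 S.
  move=> S0; rewrite /eta divfK ?gt_eqF // -natrM ler_nat => h.
  by apply: kill_ge => //; rewrite -/N; lia.
have t0 : 0 < (Num.sqrt N%:R)^-1 :> R by rewrite invr_gt0.
have a0 : 0 < a%:R :> R by rewrite ltr0n.
have t'0 : 0 < a%:R * Num.sqrt N%:R :> R by rewrite mulr_gt0.
have ht : N%:R^-1 <= (Num.sqrt N%:R)^-1 ^+ 2 :> R by rewrite exprVn sNN.
have mMR : m%:R <= M%:R * N%:R :> R by rewrite -natrM ler_nat.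
have q10 : 0 <= q1 R k V by exact: q1_ge0.
have q11 : q1 R k V <= 1 by exact: q1_le1.
have ht' : m%:R + m%:R ^+ 2 * (1 - q1 R k V ^+ 2) <= (a%:R * Num.sqrt N%:R) ^+ 2.
  have q2 : 1 - q1 R k V ^+ 2 <= 2 * k%:R / N%:R.
    rewrite /q1 -/N.
    have -> : 1 - ((N%:R - k%:R) / N%:R) ^+ 2 = 2 * k%:R / N%:R - (k%:R / N%:R) ^+ 2 :> R.
      by field; rewrite gt_eqF.
    by rewrite gerBl sqr_ge0.
  rewrite [leRHS]exprMn sNN.
  apply: (@le_trans _ _ (a%:R * N%:R)); last first.
    by rewrite ler_wpM2r ?(ltW Np) // -natrX ler_nat -mulnn leq_pmulr.
  apply: (@le_trans _ _ (M%:R * N%:R + (M%:R * N%:R) ^+ 2 * (2 * k%:R / N%:R))).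
    apply: lerD => //; apply: ler_pM; rewrite ?exprn_ge0 //.
      by rewrite subr_ge0 exprn_ile1.
    by rewrite lerXn2r ?nnegrE ?mulr_ge0 ?(ltW Np).
  rewrite aE natrD !natrM le_eqVlt; apply/orP; left; apply/eqP.
  by field; rewrite gt_eqF.
have := @hybrid_bound R k V m fa fb set0 J k0 (ltnW lkN) fa01 fb01 _ J1 C eta kap _ _
   C0 eta0 kap0 hd hl t0 t'0 ht ht' lkN.
rewrite cards0 => /(_ isT) /le_trans; apply; rewrite -/N.
rewrite -mulrA ler_wpM2l //.
pose E : R := expR (2 * k * M)%:R.
have E0 : 0 < E by exact: expR_gt0.
have nu : (2 * E)^-1 <= (1 - N%:R^-1) * q1 R k V ^+ m.
  rewrite invfM; apply: ler_pM; rewrite ?invr_ge0 ?(ltW E0) //.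
    have : N%:R^-1 <= 2^-1 :> R by rewrite lef_pV2 ?posrE // ler_nat.
    lra.
  by rewrite -expRN; exact: q1_pow_ge.
have nu0 : 0 < (1 - N%:R^-1) * q1 R k V ^+ m.
  by apply: lt_le_trans nu; rewrite invr_gt0 mulr_gt0.
rewrite mulrC ler_pdivrMr // [leRHS]mulrDl; apply: lerD.
  apply: (@le_trans _ _ (M%:R * N%:R * (2 / s%:R + 2 * k%:R / N%:R))); last first.
    by rewrite mulrAC.
  apply: ler_pM => //; rewrite /eta natrD mulrDr mulrDl lerD2r.
  rewrite -mulrA ler_wpM2l // ler_pdivrMr // mulrC ler_pdivlMr ?ltr0n //.
  by rewrite -natrM ler_nat.
have hm : harm R m <= harm R (M * N) by exact: harm_le.
apply: (@le_trans _ _ ((2 * M + 2 * k * M ^ 2)%:R * Num.sqrt N%:R * (2 * E)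
    * (2 ^+ k.+1 * (2 ^+ k * s%:R ^+ k)) * harm R (M * N))).
  apply: ler_pM; rewrite ?harm_ge0 //.
    rewrite !divr_ge0 ?(ltW kap0) ?(ltW nu0) // addr_ge0 ?mulr_ge0 ?(ltW t0) ?sqrtr_ge0 //.
  apply: ler_pM.
  - by rewrite divr_ge0 ?(ltW nu0) // addr_ge0 ?mulr_ge0 ?(ltW t0) ?sqrtr_ge0.
  - by rewrite invr_ge0 ltW.
  - apply: ler_pM.
    + by rewrite addr_ge0 ?mulr_ge0 ?(ltW t0) ?sqrtr_ge0.
    + by rewrite invr_ge0 ltW.
    + rewrite aM natrD mulrDl lerD2r ler_pdivrMr // -mulrA -expr2 sNN //.
    + by rewrite invf_ple ?posrE // mulr_gt0 ?ltr0n.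
  - rewrite /kap invfM invrK ler_wpM2l ?exprn_ge0 // -exprVn -exprMn.
    rewrite lerXn2r ?nnegrE ?invr_ge0 ?divr_ge0 ?mulr_ge0 ?(ltW Np) //.
    rewrite invf_div ler_pdivrMr ?ltr0n // -!natrM ler_nat //.
rewrite -/E le_eqVlt; apply/orP; left; apply/eqP.
have {3}-> : N%:R = Num.sqrt N%:R ^+ 2 :> R by rewrite sNN.
by field; rewrite gt_eqF.
Qed.

End Quantitative.

(** * Comparison with fair signs in both directions, for m = O(n) *)

Section Asymptotics.
Variable (R : realType).

Lemma nat_ge (x : R) : exists n : nat, forall N, (n <= N)%N -> x <= N%:R.
Proof.
exists (Num.bound x) => N h; apply: le_trans (ler_norm x) _.
apply: le_trans (ltW (archi_boundP (normr_ge0 x))) _.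
by rewrite ler_nat (leq_trans _ h) // /Num.bound normr_id.
Qed.

Lemma harm_small (J M : nat) (e : R) : 0 < e ->
  exists n0, forall N, (n0 <= N)%N -> (harm R (M * N) + 1) ^+ J <= e * Num.sqrt N%:R.
Proof.
(* Comparing fourth powers sets the linear bound of [harm_pow] against [e ^+ 4 * N ^+ 2]. *)
move=> e0; have [C C0 hC] := harm_pow R (J * 4).
have [n0 hn0] := nat_ge (C * M.+1%:R / e ^+ 4).
exists n0.+1 => N nN.
have N0 : 0 < N%:R :> R by rewrite ltr0n (leq_ltn_trans _ nN).
have g0 : 0 <= harm R (M * N) + 1 by rewrite addr_ge0 ?harm_ge0.
rewrite -(ler_pXn2r (n := 4)) ?nnegrE ?exprn_ge0 ?mulr_ge0 ?sqrtr_ge0 ?(ltW e0) //.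
rewrite -exprM; apply: le_trans (hC _) _.
rewrite exprMn (exprM (Num.sqrt _) 2 2) sqr_sqrtr ?(ltW N0) //.
apply: (@le_trans _ _ (C * (M.+1%:R * N%:R))).
  by rewrite ler_wpM2l // -natrM ler_nat; lia.
have := hn0 N (ltnW nN); rewrite ler_pdivrMr ?exprn_gt0 // => h.
rewrite expr2 !mulrA ler_wpM2r ?(ltW N0) // mulrC [in leRHS]mulrC.
by rewrite mulrC.
Qed.

Lemma pow_le_ffact (k n : nat) : (1 < k)%N -> (2 * k <= n)%N ->
  n%:R ^+ (k - 2) * n%:R ^+ 2 <= 2 ^+ k * (n ^_ k)%:R :> R.
Proof.
move=> k1 kn; have nk : (n <= 2 * (n - k))%N by lia.
have nkk : (n - k + k = n)%N by lia.
rewrite -exprD subnK // -!natrX -natrM ler_nat.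
apply: leq_trans (_ : (2 * (n - k)) ^ k <= _)%N; first by rewrite leq_exp2r // ltnW.
by rewrite expnMn leq_mul // -[X in (_ <= X ^_ _)%N]nkk ffact_ge_exp.
Qed.

(** Here the sign law stays the same and only the ignored set changes from [set0] to [[set u]]. The
    2 in [2 * k] comes from n - 1 >= n / 2. *)
Lemma psat_ignore_quant (k M : nat) : (1 < k)%N -> (0 < M)%N -> exists2 B : R, 0 <= B &
  forall (s m : nat) (V : finType) (g : V -> R) u,
  (2 * k <= #|V|)%N -> (0 < s)%N -> (2 * s <= #|V|)%N ->
  (m <= M * #|V|)%N -> (forall v, 0 <= g v <= 1) ->
  psat k (fun _ : 'I_m => g) (fun=> Some set0) - psat k (fun _ : 'I_m => g) (fun=> Some [set u])
  <= (2 * k)%:R * (M%:R * (2 / s%:R + 2 * k%:R / #|V|%:R)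
          + B * s%:R ^+ k * harm R (M * #|V|) / Num.sqrt #|V|%:R).
Proof.
move=> k1 M0; have k0 := ltnW k1.
have [B B0 hB] := hybrid_quant R k0 M0; exists B => // s m V g u kN s0 sN mM g01.
have N2 : (1 < #|V|)%N by lia.
apply: hB => //; first by rewrite cards1.
move=> S S0; have kk : (1 < k <= #|V|)%N by rewrite k1; lia.
apply: le_trans (kill_ignore1 S0 u g01 kk) _.
have Np : 0 < #|V|%:R :> R by rewrite ltr0n; lia.
have N1 : #|V|%:R <= 2 * (#|V|%:R - 1) :> R.
  by rewrite mulrBr mulr1 -natrM lerBrDr -natrD ler_nat; lia.
have N1p : 0 < #|V|%:R - 1 :> R by lra.
rewrite ler_pdivrMr ?mulr_gt0 // natrM.
have -> : 2 * k%:R * #|frozen S|%:R / #|V|%:R ^+ 2 * (#|V|%:R * (#|V|%:R - 1))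
    = k%:R * #|frozen S|%:R * (2 * (#|V|%:R - 1) / #|V|%:R) :> R.
  by field; rewrite gt_eqF.
by rewrite ler_peMr ?mulr_ge0 // ler_pdivlMr // mul1r.
Qed.

(** [kill_half_le] supplies [k ^+ 2], and [pow_le_ffact] turns its falling factorial into a power at
    the cost of [2 ^+ k]. *)
Lemma usat_half_quant (k M : nat) : (1 < k)%N -> (0 < M)%N -> exists2 B : R, 0 <= B &
  forall (s m n : nat) (q : R), (2 * k <= n)%N -> (0 < s)%N -> (2 * s <= n)%N ->
  (m <= M * n)%N -> 0 <= q <= 1 ->
  usat k n q m - usat k n 2^-1 m
  <= k%:R ^+ 2 * 2 ^+ k * (M%:R * (2 / s%:R + 2 * k%:R / n%:R)
          + B * s%:R ^+ k * harm R (M * n) / Num.sqrt n%:R).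
Proof.
move=> k1 M0; have k0 := ltnW k1.
have [B B0 hB] := hybrid_quant R k0 M0; exists B => // s m n q kN s0 sN mM q01.
have Np : 0 < n%:R :> R by rewrite ltr0n; lia.
have h01 : 0 <= (2^-1 : R) <= 1 by lra.
have := @hB s m 'I_n (fun=> q) (fun=> 2^-1) set0 (k%:R ^+ 2 * 2 ^+ k).
rewrite card_ord; apply => //; rewrite ?mulr_ge0 ?exprn_ge0 ?cards0 // => S S0.
apply: le_trans (kill_half_le k S0 (fun _ : 'I_n => q01)) _; rewrite card_ord.
have f0 : 0 < (n ^_ k)%:R :> R by rewrite ltr0n ffact_gt0; lia.
have key := pow_le_ffact k1 kN.
rewrite ler_pdivrMr //.
have -> : k%:R ^+ 2 * 2 ^+ k * #|frozen S|%:R / n%:R ^+ 2 * (n ^_ k)%:R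
    = k%:R ^+ 2 * #|frozen S|%:R * (2 ^+ k * (n ^_ k)%:R / n%:R ^+ 2) :> R by ring.
by rewrite ler_wpM2l ?mulr_ge0 ?exprn_ge0 // ler_pdivlMr ?exprn_gt0.
Qed.

Lemma usat_le_half (k M : nat) (q e : R) : (1 < k)%N -> (0 < M)%N -> 0 <= q <= 1 -> 0 < e ->
  exists n0, forall n m, (n0 <= n)%N -> (m <= M * n)%N -> usat k n q m <= usat k n 2^-1 m + e.
Proof.
move=> k1 M0 q01 e0; have [b b0 hb] := usat_half_quant k1 M0; set C : R := k%:R ^+ 2 * 2 ^+ k.
have C0 : 0 < C by rewrite mulr_gt0 ?exprn_gt0 // ltr0n; lia.
have M0' : 0 < M%:R :> R by rewrite ltr0n.
have [s' hs] := nat_ge (6 * C * M%:R / e).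
(* [s] does not depend on [n]: it makes the first of three error terms at most e / 3, and large [n]
   does the rest. The [+ 1] keeps [B] positive for the divisions. *)
pose s := s'.+1; pose B := b * s%:R ^+ k + 1.
have B0 : 0 < B by rewrite ltr_wpDl // mulr_ge0 ?exprn_ge0.
have [n1 h1] := nat_ge (6 * C * M%:R * k%:R / e).
have d2 : 0 < e / (3 * C * B) := divr_gt0 e0 (mulr_gt0 (mulr_gt0 (ltr0n _ 3) C0) B0).
have [n2 h2] := harm_small 1 M d2.
exists (maxn (maxn n1 n2) (maxn (2 * k) (2 * s))) => n m.
rewrite !geq_max => /andP [/andP [n1n n2n] /andP [kn sn]] mM.
have np : (0 < n)%N by rewrite (leq_trans _ kn) // muln_gt0 /= ltnW.
have Np : 0 < n%:R :> R by rewrite ltr0n.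
rewrite -lerBlDl; apply: le_trans (hb _ _ _ _ kn (ltn0Sn s') sn mM q01) _.
rewrite -/C -/s.
have t1 : C * (M%:R * (2 / s%:R)) <= e / 3.
  have := hs s (leqnSn s'); rewrite ler_pdivrMr // => h.
  rewrite !mulrA ler_pdivrMr ?ltr0n //; lra.
have t2 : C * (M%:R * (2 * k%:R / n%:R)) <= e / 3.
  have := h1 n n1n; rewrite ler_pdivrMr // => h.
  rewrite !mulrA ler_pdivrMr //; lra.
have t3 : C * (b * s%:R ^+ k * harm R (M * n) / Num.sqrt n%:R) <= e / 3.
  have sq : 0 < Num.sqrt n%:R :> R by rewrite sqrtr_gt0.
  have := h2 n n2n; rewrite expr1 => h.
  apply: (@le_trans _ _ (C * (B * (e / (3 * C * B) * Num.sqrt n%:R) / Num.sqrt n%:R))).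
    rewrite ler_wpM2l ?(ltW C0) // ler_wpM2r ?invr_ge0 ?sqrtr_ge0 //.
    apply: ler_pM; rewrite ?harm_ge0 ?mulr_ge0 ?exprn_ge0 //.
      by rewrite /B lerDl.
    by apply: le_trans h; rewrite lerDl.
  by rewrite le_eqVlt; apply/orP; left; apply/eqP; field; rewrite !gt_eqF.
have -> : C * (M%:R * (2 / s%:R + 2 * k%:R / n%:R) +
      b * s%:R ^+ k * harm R (M * n) / Num.sqrt n%:R)
   = C * (M%:R * (2 / s%:R)) + C * (M%:R * (2 * k%:R / n%:R))
     + C * (b * s%:R ^+ k * harm R (M * n) / Num.sqrt n%:R) by ring.
have -> : e = e / 3 + e / 3 + e / 3 by field.
by apply: lerD => //; apply: lerD.
Qed.

(** The ratio is (n + 1) / (n + 1 - k), the inverse of [q1] for the n + 1 variables of the split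
    formula. *)
Lemma ffact_ratio_pow (k M m n : nat) : (0 < k)%N -> (2 * k <= n)%N -> (m <= M * n)%N ->
  ((n.+1 ^_ k)%:R / (n ^_ k)%:R) ^+ m <= expR (2 * k * M)%:R :> R.
Proof.
move=> k0 kn mM.
have f0 : (n ^_ k)%:R != 0 :> R by rewrite pnatr_eq0 -lt0n ffact_gt0; lia.
have f1 : n.+1%:R != 0 :> R by rewrite pnatr_eq0.
have f2 : n.+1%:R - k%:R != 0 :> R by rewrite subr_eq0 eqr_nat; lia.
have e : (n.+1 ^_ k * (n.+1 - k) = n.+1 * n ^_ k)%N by rewrite -ffactnSr ffactSS.
have -> : (n.+1 ^_ k)%:R / (n ^_ k)%:R = (q1 R k (option 'I_n))^-1.
  rewrite /q1 card_option card_ord invf_div; apply/eqP; rewrite eqr_div //.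
  by rewrite -natrB -?natrM ?e //; lia.
rewrite exprVn -[leRHS]invrK -expRN.
have cO : #|{: option 'I_n}| = n.+1 by rewrite card_option card_ord.
have h : expR (- (2 * k * M)%:R) <= q1 R k (option 'I_n) ^+ m.
  by apply: q1_pow_ge => //; rewrite cO; lia.
by rewrite lef_pV2 ?posrE ?expR_gt0 // (lt_le_trans _ h) ?expR_gt0.
Qed.

Lemma half_le_usat (k M : nat) (p e : R) : (1 < k)%N -> (0 < M)%N -> 0 <= p <= 1 -> 0 < e ->
  exists n0, forall n m, (n0 <= n)%N -> (m <= M * n)%N -> usat k n 2^-1 m <= usat k n p m + e.
Proof.
move=> k1 M0 p01 e0; have k0 := ltnW k1; have [b b0 hig] := psat_ignore_quant k1 M0.
set C : R := expR (2 * k * M)%:R * k.+1%:R * (2 * k)%:R.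
have C0 : 0 < C by rewrite !mulr_gt0 ?expR_gt0 // ltr0n; lia.
have M0' : 0 < M%:R :> R by rewrite ltr0n.
have [L' hL] := nat_ge (6 * C * M%:R / e).
pose L := L'.+1; pose B := b * L%:R ^+ k + 1.
have B0 : 0 < B by rewrite ltr_wpDl // mulr_ge0 ?exprn_ge0.
have kR : 0 < k%:R :> R by rewrite ltr0n.
have d3 : 0 < e / (3 * C * B) := divr_gt0 e0 (mulr_gt0 (mulr_gt0 (ltr0n _ 3) C0) B0).
have d2 : 0 < e / (6 * C * M%:R * k%:R) :=
  divr_gt0 e0 (mulr_gt0 (mulr_gt0 (mulr_gt0 (ltr0n _ 6) C0) M0') kR).
have d1 : 0 < (2 * L%:R)^-1 :> R by rewrite invr_gt0 mulr_gt0 ?ltr0n.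
have [n1 h1] := harm_small 1 M d1.
have [n2 h2] := harm_small 1 M d2.
(* Exponent k + 2: k from [s ^+ k], one from the harmonic sum in [beta], one from that in
   [usat_glue]. *)
have [n3 h3] := harm_small k.+2 M d3.
exists (maxn (maxn n1 n2) (maxn n3 (2 * k))) => n m.
rewrite !geq_max => /andP [/andP [/leqW n1n /leqW n2n] /andP [/leqW n3n kn]] mM.
have kn' : (k <= n)%N by rewrite (leq_trans _ kn) // leq_pmull.
have mM' : (m <= M * n.+1)%N by rewrite mulnS (leq_trans mM) // leq_addl.
set N := n.+1 in n1n n2n n3n mM'.
have Np : 0 < N%:R :> R by rewrite ltr0n.
have N1 : 1 <= N%:R :> R by rewrite ler1n.
have sq : 0 < Num.sqrt N%:R :> R by rewrite sqrtr_gt0.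
have sqN : Num.sqrt N%:R <= N%:R :> R.
  rewrite -[leRHS](sqr_sqrtr (ltW Np)) expr2 ler_peMr ?(ltW sq) //.
  by rewrite -[leLHS]sqrtr1 ler_wsqrtr.
set H := harm R n.
have H0 : 0 <= H by exact: harm_ge0.
have HM : H <= harm R (M * N).
  by apply: harm_le; rewrite (leq_trans (leqnSn n)) // leq_pmull.
pose h := (Num.truncn H).+1.
have [hlo hhi] : H <= h%:R /\ h%:R <= H + 1.
  have /andP [ha hb] := truncn_itv H0; split; first exact: ltW.
  by rewrite -natr1 lerD2r.
(* Since [h] is at least the harmonic sum [H], [H * (2 / s)] is at most [2 / L]. *)
pose s := (L * h)%N.
have s0 : (0 < s)%N by rewrite muln_gt0.
have sN : (2 * s <= N)%N.
  rewrite -(ler_nat R) !natrM.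
  have := h1 N n1n; rewrite expr1 mulrC ler_pdivlMr ?mulr_gt0 ?ltr0n // => hh.
  apply: le_trans (le_trans _ hh) sqN; rewrite mulrA [leRHS]mulrC.
  by rewrite ler_wpM2l ?mulr_ge0 // (le_trans hhi) // lerD2r.
have cO : #|{: option 'I_n}| = N by rewrite card_option card_ord.
pose beta : R := (2 * k)%:R * (M%:R * (2 / s%:R + 2 * k%:R / N%:R)
          + b * s%:R ^+ k * harm R (M * N) / Num.sqrt N%:R).
have hb (g : option 'I_n -> R) u : (forall x, 0 <= g x <= 1) ->
     psat k (fun _ : 'I_m => g) (fun=> Some set0)
     - psat k (fun _ : 'I_m => g) (fun=> Some [set u]) <= beta.
  move=> g01; have := @hig s m (option 'I_n) g u.
  by rewrite cO; apply => //; rewrite (leq_trans kn) // leqnSn.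
have beta0 : 0 <= beta.
  apply: mulr_ge0 => //; apply: addr_ge0.
    apply: mulr_ge0 => //; apply: addr_ge0; apply: divr_ge0 => //; exact: mulr_ge0.
  apply: divr_ge0; rewrite ?sqrtr_ge0 //; apply: mulr_ge0; rewrite ?harm_ge0 //.
  by apply: mulr_ge0 => //; exact: exprn_ge0.
rewrite -lerBlDl; have hg := usat_glue kn' p01 beta0 hb; apply: le_trans hg _.
apply: (@le_trans _ _ (expR (2 * k * M)%:R * (k.+1%:R * beta) * H)).
  rewrite ler_wpM2r // ler_wpM2r //; first by rewrite mulr_ge0.
  by apply: ffact_ratio_pow.
rewrite /beta.
have -> : expR (2 * k * M)%:R * (k.+1%:R * ((2 * k)%:R *
   (M%:R * (2 / s%:R + 2 * k%:R / N%:R) +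
    b * s%:R ^+ k * harm R (M * N) / Num.sqrt N%:R))) * H
  = C * (M%:R * (2 / s%:R)) * H + C * (M%:R * (2 * k%:R / N%:R)) * H
    + C * (b * s%:R ^+ k * harm R (M * N) / Num.sqrt N%:R) * H.
  by rewrite /C; ring.
have -> : e = e / 3 + e / 3 + e / 3 by field.
apply: lerD; first apply: lerD.
- have hp : 0 < h%:R :> R by rewrite ltr0n.
  have Lp : 0 < L%:R :> R by rewrite ltr0n.
  apply: (@le_trans _ _ (C * (M%:R * (2 / s%:R)) * h%:R)).
    rewrite ler_wpM2l //.
    by rewrite (mulr_ge0 (ltW C0)) // mulr_ge0 // divr_ge0.
  have -> : C * (M%:R * (2 / s%:R)) * h%:R = 2 * C * M%:R / L%:R.
    by rewrite natrM; field; rewrite !gt_eqF.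
  rewrite ler_pdivrMr //.
  have := hL L (leqnSn L'); rewrite ler_pdivrMr // => hh; lra.
- have := h2 N n2n; rewrite expr1 => hh.
  have HH : H <= e / (6 * C * M%:R * k%:R) * N%:R.
    apply: le_trans HM _; apply: (le_trans _ (le_trans hh _)); first by rewrite lerDl.
    by rewrite ler_wpM2l ?(ltW d2).
  apply: (@le_trans _ _ (C * (M%:R * (2 * k%:R / N%:R)) * (e / (6 * C * M%:R * k%:R) * N%:R))).
    by rewrite ler_wpM2l // (mulr_ge0 (ltW C0)) // mulr_ge0 // divr_ge0 // mulr_ge0.
  by rewrite le_eqVlt; apply/orP; left; apply/eqP; field; rewrite !gt_eqF.
- have := h3 N n3n; set g := harm R (M * N) + 1 => hh.
  have g0 : 0 <= g by rewrite addr_ge0 ?harm_ge0.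
  have hg : h%:R <= g by rewrite (le_trans hhi) // lerD2r.
  have Hg : H <= g by rewrite (le_trans HM) // lerDl.
  apply: (@le_trans _ _ (C * (B * g ^+ k.+2 / Num.sqrt N%:R))).
    rewrite -mulrA ler_wpM2l ?(ltW C0) // mulrAC ler_wpM2r ?invr_ge0 ?sqrtr_ge0 //.
    rewrite natrM exprMn !exprSr !mulrA ler_pM ?mulr_ge0 ?exprn_ge0 ?harm_ge0 //.
    rewrite ler_pM ?mulr_ge0 ?exprn_ge0 ?harm_ge0 //; last by rewrite lerDl.
    rewrite ler_pM ?mulr_ge0 ?exprn_ge0 //; first by rewrite /B lerDl.
    by rewrite lerXn2r ?nnegrE.
  apply: (@le_trans _ _ (C * (B * (e / (3 * C * B) * Num.sqrt N%:R) / Num.sqrt N%:R))).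
    rewrite ler_wpM2l ?(ltW C0) // ler_wpM2r ?invr_ge0 ?sqrtr_ge0 // ler_wpM2l ?(ltW B0) //.
  by rewrite le_eqVlt; apply/orP; left; apply/eqP; field; rewrite !gt_eqF.
Qed.

End Asymptotics.

(** * Translation to the draws of the given model *)

Section ProbSat.
Variables (R : realType) (k n : nat).

Lemma satisfiableE m (F : formula m k n) :
  satisfiable F = (sol (fun=> Some set0) F != set0).
Proof.
apply/existsP/set0Pn => -[s hs]; exists s.
  rewrite inE; apply/forallP => i; have /existsP [j h] := forallP hs i.
  by apply/existsP; exists j; rewrite inE.
apply/forallP => i; move: hs; rewrite inE => /forallP /(_ i) /existsP [j].
by rewrite inE /= => h; apply/existsP; exists j.
Qed.

Lemma card_index_tuple : #|index_tuple k n| = (n ^_ k)%N.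
Proof.
have := card_inj_ffuns 'I_k 'I_n; rewrite !card_ord => <-.
by rewrite card_sig; apply: eq_card => K; rewrite !inE.
Qed.

(** For each value of B exactly one sign vector P produces the literals of [c]; the two terms of
    [wt] are these two draws. A clause with a repeated variable has no draw, and [wt] is 0. *)
Lemma wt_clause_mass (p : R) (c : clause k n) :
  wt (fun=> p) c = \sum_(w : clause_draw k n | clause_of w == c) clause_mass p w.
Proof.
rewrite /wt card_ord -card_index_tuple.
pose P (B : bool) : {ffun 'I_k -> bool} := [ffun j => B == (c j).2].
pose mass B : R := #|index_tuple k n|%:R^-1 * 2^-1 * \prod_j bern p (P B j).
have eqc (w : clause_draw k n) : (clause_of w == c) =
    (val w.1.1 == cvars c) && (w.2 == P w.1.2).
  case: w => [[K B] Q] /=; apply/eqP/andP.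
    move=> cE; split; apply/eqP/ffunP => j; rewrite !ffunE -cE !ffunE //=.
    by case: B {cE}; case: (Q j).
  move=> [/eqP Kc /eqP ->]; apply/ffunP => j; rewrite !ffunE Kc ffunE.
  by case: (c j) => x b /=; case: B; case: b.
transitivity (\sum_(K : index_tuple k n | val K == cvars c) \sum_B mass B); last first.
  rewrite (eq_bigl _ _ eqc) pair_big_dep /= [RHS](reindex_omap
    (fun x : index_tuple k n * bool => (x, P x.2)) (fun w => Some w.1)) /=; last first.
    by move=> [x Q] /= /andP [_ /eqP ->].
  by apply: eq_big => [[K B]|[K B] _] //=; rewrite !eqxx !andbT.
case: (boolP (injectiveb (cvars c))) => ci.
  rewrite (big_pred1 (exist (fun K : {ffun _ -> _} => injectiveb K) _ ci)) //.
  rewrite big_bool /mass /bern /=.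
  rewrite -mulrDr -!mulrA mul1r; congr (_ * (_ * (_ + _)));
    by apply: eq_bigr => j _; rewrite ffunE //; case: (c j).2.
rewrite !mul0r big_pred0 // => K; apply/eqP => Kc.
by move: ci; rewrite -Kc (valP K).
Qed.

Lemma prob_satE m (p : R) : prob_sat m n k p = usat k n p m.
Proof.
rewrite /usat /psat (pexp_push _ (fun _ => wt_clause_mass p)) /prob_sat /pexp.
rewrite big_mkcond; apply: eq_bigr => w _.
by rewrite satisfiableE /formula_of; case: (_ != _); rewrite ?mulr1 ?mulr0.
Qed.

End ProbSat.

(** * Exponential tail and asymptotic comparison for all m *)

Section Thresholds.
Variables (R : realType) (k : nat).
Hypothesis k_gt1 : (1 < k)%N.

Let c : R := 1 - 2 ^- k.

Lemma clause_base_itv : 0 < c < 1.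
Proof.
have e0 : 0 < 2 ^- k :> R by rewrite invr_gt0 exprn_gt0.
have e1 : 2 ^- k < 1 :> R by rewrite invf_lt1 ?exprn_gt0 // exprn_egt1 ?ltr1n // -lt0n ltnW.
by rewrite /c; apply/andP; split; lra.
Qed.

(** Any base [b] above [c] absorbs the O(1 / n) error of the first moment bound once [n] is
    large. *)
Lemma usat_le_pow (p b : R) : 0 <= p <= 1 -> c < b ->
  exists n0, forall n m, (n0 <= n)%N -> usat k n p m <= 2 ^+ n * b ^+ m.
Proof.
move=> p01 cb; have [n1 h1] := nat_ge (k%:R ^+ 2 * 2 ^+ k / (b - c)).
exists (n1 + 2 * k + 1)%N => n m hn.
have k0 := ltnW k_gt1.
have kn : (2 * k <= n)%N by lia.
have kn' : (k <= n)%N by lia.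
have n1n : (n1 <= n)%N by lia.
have Np : 0 < n%:R :> R by rewrite ltr0n; lia.
apply: le_trans (usat_first_moment kn' m p01) _.
have f0 : 0 < (n ^_ k)%:R :> R by rewrite ltr0n ffact_gt0.
have /andP [c0 c1] := clause_base_itv.
have t0 : 0 <= k%:R ^+ 2 * n%:R * n%:R ^+ (k - 2) / (n ^_ k)%:R :> R.
  by rewrite divr_ge0 ?mulr_ge0 ?exprn_ge0 // ltW.
have tb : k%:R ^+ 2 * n%:R * n%:R ^+ (k - 2) / (n ^_ k)%:R <= b - c.
  have bc : 0 < b - c by rewrite subr_gt0.
  have := h1 n n1n; rewrite ler_pdivrMr // => hb.
  have := pow_le_ffact R k_gt1 kn; rewrite expr2 => hf.
  rewrite ler_pdivrMr // -(ler_pM2r Np).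
  apply: (@le_trans _ _ (k%:R ^+ 2 * (2 ^+ k * (n ^_ k)%:R))).
    by rewrite -!mulrA !ler_wpM2l // mulrCA.
  have -> : (b - c) * (n ^_ k)%:R * n%:R = n%:R * (b - c) * (n ^_ k)%:R by ring.
  by rewrite mulrA ler_wpM2r ?(ltW f0).
rewrite ler_wpM2l ?exprn_ge0 // lerXn2r ?nnegrE //; rewrite -/c; lra.
Qed.

Lemma usat_tail (p : R) : 0 <= p <= 1 -> exists2 M, (0 < M)%N &
  forall e, 0 < e -> exists n0, forall n m, (n0 <= n)%N -> (M * n <= m)%N -> usat k n p m <= e.
Proof.
move=> p01; have /andP [c0 c1] := clause_base_itv.
pose b : R := (1 + c) / 2.
have cb : c < b by rewrite /b; lra.
have b0 : 0 < b by rewrite /b; lra.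
have b1 : b < 1 by rewrite /b; lra.
have [M0 hM0] := nat_ge (4 / (b^-1 - 1)).
have bi : 0 < b^-1 - 1 by rewrite subr_gt0 invf_gt1.
(* With this exponent the bound 2^n b^(M n) is at most 2^-n; Bernoulli's inequality for [b^-1]
   provides it. *)
have hM : b ^+ M0.+1 <= 4^-1.
  have := hM0 M0.+1 (leqnSn _); rewrite ler_pdivrMr // => h.
  rewrite -[leLHS]invrK -exprVn lef_pV2 ?posrE ?exprn_gt0 ?invr_gt0 //.
  have -> : b^-1 = 1 + (b^-1 - 1) by ring.
  apply: le_trans (_ : 1 + (b^-1 - 1) *+ M0.+1 <= _).
    by rewrite -mulr_natl; lra.
  elim: M0.+1 => [|N IH]; first by rewrite mulr0n addr0 expr0.
  rewrite exprS; apply: le_trans (ler_wpM2l _ IH); last by lra.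
  have := mulr_ge0 (ltW bi) (mulrn_wge0 N (ltW bi)); rewrite mulrS; lra.
exists M0.+1 => // e e0; have [n1 h1] := usat_le_pow p01 cb.
have [n2 h2] := nat_ge e^-1.
exists (maxn 1 (maxn n1 n2)) => n m; rewrite !geq_max => /and3P [n0 n1n n2n] mn.
have Np : 0 < n%:R :> R by rewrite ltr0n.
apply: le_trans (h1 n m n1n) _.
apply: (@le_trans _ _ (2 ^+ n * 4^-1 ^+ n)).
  rewrite ler_wpM2l ?exprn_ge0 //.
  apply: (@le_trans _ _ (b ^+ (M0.+1 * n))).
    by apply: ler_wiXn2l => //; exact: ltW.
  by rewrite exprM lerXn2r ?nnegrE ?exprn_ge0 // ltW.
rewrite -exprMn (_ : 2 * 4^-1 = 2^-1 :> R); last by field.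
apply: (@le_trans _ _ n%:R^-1).
  by rewrite exprVn lef_pV2 ?posrE ?exprn_gt0 // -natrX ler_nat ltnW // ltn_expl.
by rewrite -[leRHS]invrK lef_pV2 ?posrE ?invr_gt0 // h2.
Qed.

Lemma usat_asymp_le (p q e : R) : 0 <= p <= 1 -> 0 <= q <= 1 -> 0 < e ->
  exists n0, forall n m, (n0 <= n)%N -> usat k n q m <= usat k n p m + e.
Proof.
move=> p01 q01 e0; have [M M0 hM] := usat_tail q01.
have e2 : 0 < e / 2 by rewrite divr_gt0.
have [n1 h1] := hM e e0.
have [n2 h2] := usat_le_half k_gt1 M0 q01 e2.
have [n3 h3] := half_le_usat k_gt1 M0 p01 e2.
exists (maxn n1 (maxn n2 n3)) => n m; rewrite !geq_max => /and3P [n1n n2n n3n].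
have [mM|mM] := leqP m (M * n).
  have := h2 n m n2n mM; have := h3 n m n3n mM; lra.
apply: le_trans (h1 n m n1n (ltnW mM)) _; rewrite lerDr.
by apply: pexp_ge0 => // i f; exact: wt_ge0.
Qed.

End Thresholds.

(** * Median thresholds *)

Section Median.
Variables (R : realType) (k : nat).
Hypothesis k_gt1 : (1 < k)%N.

Let half01 : 0 <= (2^-1 : R) <= 1. Proof. lra. Qed.

(* While the probability is between 1/2 and 3/4, each clause decreases it by at
   least 1 / (8 M n), so a discrepancy d in probability is worth 8 M n d clauses. *)
Lemma usat_median_le (p e : R) : 0 <= p <= 1 -> 0 < e ->
  exists n0, forall n m m', (n0 <= n)%N ->
    (forall l, usat k n (2^-1 : R) l <= 2^-1 -> (m <= l)%N) ->
    usat k n p m' <= 2^-1 -> m%:R <= m'%:R + e * n%:R.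
Proof.
have mid_range (u : R) : 2^-1 < u -> u <= 3 / 4 -> 8^-1 <= u * (1 - u).
  move=> u1 u2; have : 0 <= (u - 2^-1) * (3 / 4 - u) by apply: mulr_ge0; lra.
  lra.
move=> p01 e0; have [M M0 hM] := usat_tail k_gt1 half01.
have Mp : 0 < M%:R :> R by rewrite ltr0n.
(* 1/4 keeps the probabilities below 3/4; [e / (16 * M)] makes the [8 * M * n * d] clauses at most
   [e * n / 2]. The other half of [e * n] absorbs, through [n3], the extra clause in
   [m = (m' + j).+1]. *)
pose d := Num.min 4^-1 (e / (16 * M%:R)).
have d0 : 0 < d by rewrite lt_min invr_gt0 ltr0n /= divr_gt0 // mulr_gt0.
have d4 : d <= 4^-1 by rewrite ge_min lexx.
have de : d <= e / (16 * M%:R) by rewrite ge_min lexx orbT.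
have h0 : 0 < 2^-1 :> R by rewrite invr_gt0.
have [n1 h1] := hM _ h0.
have [n2 h2] := usat_asymp_le k_gt1 p01 half01 d0.
have [n3 h3] := nat_ge (2 / e).
exists (maxn (maxn n1 n2) (maxn n3 k)) => n m m'.
rewrite !geq_max => /andP [/andP [n1n n2n] /andP [n3n kn]] min_m hm'.
have np : (0 < n)%N by rewrite (leq_trans _ kn) // ltnW.
have mMn : (m <= M * n)%N by apply: min_m; exact: h1.
have Np : 0 < n%:R :> R by rewrite ltr0n.
have [le_m|lt_m] := leqP m m'.
  by apply: (@le_trans _ _ m'%:R); rewrite ?ler_nat // lerDl mulr_ge0 // ltW.
have below l : (l < m)%N -> 2^-1 < usat k n (2^-1 : R) l.
  by move=> lm; rewrite ltNge; apply/negP => /min_m; rewrite leqNgt lm.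
have Um' : usat k n (2^-1 : R) m' <= 2^-1 + d.
  by apply: le_trans (h2 n m' n2n) _; rewrite lerD2r.
pose D : R := 8 * M%:R * n%:R.
have D0 : 0 < D by rewrite !mulr_gt0.
have drop j : (m' + j < m)%N -> usat k n (2^-1 : R) (m' + j) <= 2^-1 + d - j%:R / D.
  elim: j => [|j IH] hj; first by rewrite addn0 mul0r subr0.
  rewrite addnS in hj *; have := usat_decr kn (m' + j) half01.
  have u1 := below _ hj; have := IH (ltnW hj).
  set u := usat k n _ (m' + j).+1 in u1 *; set v := usat _ _ _ _.
  move=> hv hd; have S0 : 0 < (m' + j).+1%:R :> R by rewrite ltr0n.
  have SM : (m' + j).+1%:R <= M%:R * n%:R :> R.
    by rewrite -natrM ler_nat (leq_trans (ltnW hj)).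
  have j0 : 0 <= j%:R / D by rewrite divr_ge0 // ltW.
  have vu : 0 <= v - u by rewrite subr_ge0; exact: usat_le.
  have p8 : 8^-1 <= u * (1 - u).
    have u34 : u <= 3 / 4 by move: hv vu d4 j0; clear; lra.
    exact: mid_range u1 u34.
  have : 8^-1 <= M%:R * n%:R * (v - u).
    by apply: le_trans p8 (le_trans hd _); rewrite ler_wpM2r.
  have -> : j.+1%:R / D = j%:R / D + D^-1 by rewrite -natr1 mulrDl mul1r.
  move=> h; suff : D^-1 <= v - u by lra.
  rewrite -div1r ler_pdivrMr // /D; lra.
have [j mE] : exists j, m = (m' + j).+1.
  by exists (m - m').-1; rewrite -addnS prednK ?subn_gt0 // subnKC // ltnW.
have := drop j; rewrite mE ltnSn => /(_ isT); have := below (m' + j)%N.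
rewrite mE ltnSn => /(_ isT) lo hi.
have : j%:R / D <= d by lra.
rewrite ler_pdivrMr // => jd.
have jn : j%:R <= e / 2 * n%:R.
  apply: le_trans jd _; apply: le_trans (ler_wpM2r (ltW D0) de) _.
  rewrite /D le_eqVlt; apply/orP; left; apply/eqP; field; rewrite gt_eqF //.
have := h3 n n3n; rewrite ler_pdivrMr // => en.
by rewrite -natr1 natrD; lra.
Qed.

Lemma usat_median_exists (p e : R) : 0 <= p <= 1 -> 0 < e ->
  exists n0, forall n, (n0 <= n)%N -> exists2 m, usat k n p m <= 2^-1 &
    m%:R <= (1 + e) * (ln 2 / - ln (1 - 2 ^- k)) * n%:R.
Proof.
move=> p01 e0; have /andP [c0 c1] := clause_base_itv R k_gt1.
set c : R := 1 - 2 ^- k in c0 c1 *.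
have L0 : 0 < - ln c by rewrite oppr_gt0 ln_lt0 // c0.
have l2 : 0 < ln 2 :> R by rewrite ln_gt0 // ltr1n.
(* Half of [e] is spent on a base slightly above [c], the other half on rounding and additive
   constants. *)
set L := - ln c in L0 *; pose f := 1 + e / 2.
have f1 : 1 < f by rewrite /f; lra.
have f0 : 0 < f by lra.
have cb : c < expR (- (L / f)).
  rewrite -[ltLHS](lnK (c0 : c \is Num.pos)) ltr_expR.
  rewrite -[ln c]opprK -/L ltrN2 ltr_pdivrMr //.
  by rewrite ltr_pMr.
have [n1 h1] := usat_le_pow k_gt1 p01 cb.
have K0 : 0 < ln 2 * (e / 2) / L by rewrite divr_gt0 // mulr_gt0 // divr_gt0.
have [n2 h2] := nat_ge ((ln 2 * f / L + 1) / (ln 2 * (e / 2) / L)).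
exists (maxn n1 n2) => n; rewrite geq_max => /andP [n1n n2n].
have x0 : 0 <= n.+1%:R * ln 2 * f / L.
  by rewrite divr_ge0 ?(ltW L0) // !mulr_ge0 // ltW.
(* With n + 1 in place of n, the first moment bound is at most 2^n 2^-(n+1) = 1/2. *)
pose m := (Num.truncn (n.+1%:R * ln 2 * f / L)).+1.
have /andP [mlo mhi] := truncn_itv x0.
exists m.
  apply: le_trans (h1 n m n1n) _.
  rewrite -[X in X ^+ n](lnK (ltr0n _ 2 : 2%:R \is Num.pos)) -!expRM_natl -expRD.
  rewrite -[leRHS](lnK (_ : 2^-1 \is Num.pos)) ?posrE ?invr_gt0 //.
  rewrite ler_expR lnV ?posrE //.
  have : n.+1%:R * ln 2 <= m%:R * (L / f) :> R.
    by rewrite mulrA ler_pdivlMr // -ler_pdivrMr // ltW.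
  by rewrite -natr1; lra.
have := h2 n n2n; rewrite ler_pdivrMr // => h.
rewrite /m -natr1; apply: le_trans (lerD mlo (lexx 1)) _.
have -> : n.+1%:R * ln 2 * f / L = n%:R * (ln 2 * f / L) + ln 2 * f / L.
  by rewrite -natr1; ring.
have -> : (1 + e) * (ln 2 / L) * n%:R = n%:R * (ln 2 * f / L) + n%:R * (ln 2 * (e / 2) / L).
  by rewrite /f; field; rewrite gt_eqF.
by rewrite -addrA lerD2l.
Qed.

(** A witness [m] rules out the value [+oo]. *)
Lemma median_thresholdE (p : R) n m : usat k n p m <= 2^-1 ->
  exists m0, [/\ median_threshold k p n = (m0%:R / n%:R)%:E, (m0 <= m)%N,
    usat k n p m0 <= 2^-1 & forall l, usat k n p l <= 2^-1 -> (m0 <= l)%N].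
Proof.
move=> hm; rewrite /median_threshold; case: pselect => [ex|[]]; last first.
  by exists m; rewrite prob_satE.
exists (ex_minn ex); case: ex_minnP => m0 h0 min0; split=> //.
- by apply: min0; rewrite prob_satE.
- by rewrite -prob_satE.
- by move=> l hl; apply: min0; rewrite prob_satE.
Qed.

End Median.

Local Open Scope classical_set_scope.

Lemma cvg0_of_le (R : realType) (u : nat -> R) : (forall n, 0 <= u n) ->
  (forall e, 0 < e -> exists n0, forall n, (n0 <= n)%N -> u n <= e) ->
  u n @[n --> \oo] --> (0 : R).
Proof.
move=> u0 h; apply/cvgrPdist_le => e /h [n0 hn0]; exists n0 => // n /= hn.
by rewrite sub0r normrN ger0_norm // hn0.
Qed.

Theorem theorem1 (R : realType) (k : nat) (hk : (2 <= k)%N) :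
  (forall (p q : R) (m : nat -> nat),
      0 <= p -> p <= q -> q <= 2^-1 -> (forall n, (0 < m n)%N) ->
      exists e : nat -> R,
        e n @[n --> \oo] --> (0 : R) /\
        \forall n \near \oo,
          prob_sat (m n) n k p >= prob_sat (m n) n k q - e n) /\
  (forall p : R, 0 <= p -> p <= 2^-1 ->
      exists e1 e2 : nat -> R,
        e1 n @[n --> \oo] --> (0 : R) /\
        e2 n @[n --> \oo] --> (0 : R) /\
        \forall n \near \oo,
          (median_threshold k (2^-1 : R) n - (e1 n)%:E
             <= median_threshold k p n)%E /\
          (median_threshold k p n
             <= ((1 + e2 n) / - log2 (1 - 2 ^- k))%:E)%E).
Proof.
split=> [p q m p0 pq q2 _|p p0 p2].
  have p01 : 0 <= p <= 1 by apply/andP; split; lra.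
  have q01 : 0 <= q <= 1 by apply/andP; split; lra.
  (* With the positive part of the deficit as error term the inequality holds for every [n], and
     only convergence remains. *)
  exists (fun n => Num.max 0 (prob_sat (m n) n k q - prob_sat (m n) n k p)); split.
    apply: cvg0_of_le => [n|e e0]; first by rewrite le_max lexx.
    have [n0 hn0] := usat_asymp_le hk p01 q01 e0; exists n0 => n nn; have h := hn0 n (m n) nn.
    by rewrite ge_max (ltW e0) !prob_satE lerBlDl.
  by near=> n; rewrite lerBlDl -lerBlDr le_max lexx orbT.
have p01 : 0 <= p <= 1 by apply/andP; split; lra.
have h01 : 0 <= (2^-1 : R) <= 1 by apply/andP; split; lra.
(* [fine] sends [+oo] to 0; by [aE] the thresholds are finite for large [n]. *)
pose a (r : R) n := fine (median_threshold k r n).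
pose L : R := ln 2 / - ln (1 - 2 ^- k).
have L0 : 0 < L.
  have /andP [c0 c1] := clause_base_itv R hk.
  by rewrite divr_gt0 ?oppr_gt0 ?ln_lt0 ?c0 // ln_gt0 // ltr1n.
have aE r e : 0 <= r <= 1 -> 0 < e -> exists n0, forall n, (n0 <= n)%N ->
    [/\ median_threshold k r n = (a r n)%:E, a r n <= (1 + e) * L &
      exists2 m, a r n = m%:R / n%:R & usat k n r m <= 2^-1 /\
        forall l, usat k n r l <= 2^-1 -> (m <= l)%N].
  move=> r01 e0; have [n0 hn0] := usat_median_exists hk r01 e0.
  exists n0.+1 => n nn; have [m hm mn] := hn0 n (ltnW nn).
  have [m0 [tE m0m hm0 min0]] := median_thresholdE hm; rewrite /a tE /=.
  have Np : 0 < n%:R :> R by rewrite ltr0n (leq_ltn_trans _ nn).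
  split=> //; last by exists m0.
  by rewrite ler_pdivrMr // (le_trans _ mn) // ler_nat.
(* Again positive parts: of the gap to the fair threshold, and of the relative excess over the first
   moment constant [L]. *)
exists (fun n => Num.max 0 (a 2^-1 n - a p n)), (fun n => Num.max 0 (a p n / L - 1)).
split; first apply: cvg0_of_le => [n|e e0]; first by rewrite le_max lexx.
  have [n1 h1] := aE _ _ h01 ltr01; have [n2 h2] := aE _ _ p01 ltr01.
  have [n3 h3] := usat_median_le hk p01 e0.
  exists (maxn n1 (maxn n2 n3)).+1 => n nn.
  have Np : 0 < n%:R :> R by rewrite ltr0n (leq_ltn_trans _ nn).
  move: (ltnW nn); rewrite !geq_max => /and3P [n1n n2n n3n].
  have [_ _ [m -> [_ min_m]]] := h1 n n1n; have [_ _ [m' -> [hm' _]]] := h2 n n2n.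
  rewrite ge_max (ltW e0) /= -mulrBl ler_pdivrMr // lerBlDl.
  exact: h3 min_m hm'.
split; first apply: cvg0_of_le => [n|e e0]; first by rewrite le_max lexx.
  have [n1 h1] := aE _ _ p01 e0; exists n1 => n /h1 [_ h _].
  by rewrite ge_max (ltW e0) /= lerBlDl ler_pdivrMr.
have [n1 h1] := aE _ _ h01 ltr01; have [n2 h2] := aE _ _ p01 ltr01.
exists (maxn n1 n2) => // n /=; rewrite geq_max => /andP [n1n n2n].
have [-> _ _] := h1 n n1n; have [-> _ _] := h2 n n2n.
rewrite -EFinB !lee_fin; split; first by rewrite lerBlDl -lerBlDr le_max lexx orbT.
have -> : (- log2 (1 - 2 ^- k))^-1 = L.
  by rewrite /log2 /L -mulNr invf_div.
by rewrite -ler_pdivrMr // -lerBlDl le_max lexx orbT.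
Unshelve. all: by end_near.
Qed.
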